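(* Let $n\ge 2$, let $B,C$ be $n\times n$ generic matrices over $\mathbb{Q}$, let $K$ be the field generated over $\mathbb{Q}$ by all their entries and $\overline{K}$ its algebraic closure. Consider the equation $$X^2+BXB+C=0_n\qquad\text{in the unknown }X\in\mathcal{M}_n(\overline{K}).$$ When $n=2$, this equation has an effective solution and its solvability complexity is $(6,S_6)$. When $n>2$, this equation admits a finite number of solutions and is non-solvable.
   Context: Generic matrices: matrices whose entries, taken all together, are independent commuting indeterminates over $\mathbb{Q}$ (algebraically independent over $\mathbb{Q}$). Effective solution: the matrix equation is regarded as a system of $n^2$ polynomial equations over $K$ in the entries $x_{i,j}$ of $X$. It has an effective solution if the ideal generated by these $n^2$ polynomials has a Gröbner basis of the form: for some $(i,j)$, $p(x_{i,j})=0$ where $p\in K[x]$ has degree $\delta$, and for every $(k,l)\neq(i,j)$, $x_{k,l}=p_{k,l}(x_{i,j})$ where $p_{k,l}\in K[x]$ has degree $<\delta$ (so that solving the equation amounts to solving the univariate equation $p=0$). Solvable: when a matrix equation over $K$ has a finite positive number of solutions in $\mathcal{M}_n(\overline{K})$, it is called solvable if the entries of each solution can be calculated by radicals over $K$ (i.e. lie in a radical extension of $K$), and non-solvable otherwise. Solvability complexity (SC): consider a matrix equation over $K$ with a finite number $\nu$ of solutions in $\mathcal{M}_n(\overline{K})$. Assume that finding the entries of each solution is equivalent to finding the roots of a polynomial (over $K$) whose Galois group over $K$ is $G$, in the sense that the extension of $K$ generated by the entries of all the solutions is the splitting field over $K$ of that polynomial. Then the solvability complexity of the equation is the couple $(\nu,G)$.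 $S_m$ denotes the symmetric group on $m$ letters. *)

(* Defs.v *)
From HB Require Import structures.
From mathcomp Require Import all_boot all_order all_fingroup all_algebra.
From mathcomp Require Import all_solvable all_field.
From mathcomp Require Import mpoly.

Set Implicit Arguments.
Unset Strict Implicit.
Unset Printing Implicit Defensive.

Import GRing.Theory.

Local Open Scope ring_scope.

(* Field extensions are given by a field morphism [iota : F -> L]. *)

(* [adjoin iota A] is the subfield F(A) of L generated by the image of F and
   the elements satisfying A; since 0^-1 = 0, division needs no side
   condition. *)
Inductive adjoin (F L : fieldType) (iota : {rmorphism F -> L})
    (A : L -> Prop) : L -> Prop :=
| adjoin_base a : adjoin iota A (iota a)
| adjoin_gen x : A x -> adjoin iota A x
| adjoin_sub x y : adjoin iota A x -> adjoin iota A y -> adjoin iota A (x - y)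
| adjoin_div x y : adjoin iota A x -> adjoin iota A y -> adjoin iota A (x / y).

Definition is_algebraic_closure (F : fieldType) (L : closedFieldType)
    (iota : {rmorphism F -> L}) : Prop :=
  forall x : L, algebraicOver iota x.

Definition is_entry (R : Type) (n : nat) (M : 'M[R]_n) (x : R) : Prop :=
  exists i j, x = M i j.

(* The 2 n^2 entries of B and C, taken all together, are algebraically
   independent over Q; [q] is the (unique) embedding of Q into K. *)
Definition generic_matrices (K : fieldType) (q : {rmorphism rat -> K})
    (n : nat) (B C : 'M[K]_n) : Prop :=
  forall p : {mpoly rat[n * n + n * n]},
    (map_mpoly q p).@[fun v => row_mx (mxvec B) (mxvec C) 0 v] = 0 -> p = 0.

Definition generated_by_entries (K : fieldType) (q : {rmorphism rat -> K})
    (n : nat) (B C : 'M[K]_n) : Prop :=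
  forall x : K, adjoin q (fun y => is_entry B y \/ is_entry C y) x.

Definition quad_lhs (R : comNzRingType) (n : nat) (B C X : 'M[R]_n) : 'M[R]_n :=
  X *m X + B *m X *m B + C.

Definition quad_solution (K L : fieldType) (iota : {rmorphism K -> L})
    (n : nat) (B C : 'M[K]_n) (X : 'M[L]_n) : Prop :=
  quad_lhs (map_mx iota B) (map_mx iota C) X = 0.

(* The unknown x_{i,j} is the variable of index [mxvec_index i j]. *)
Definition unknown (K : fieldType) (n : nat) (i j : 'I_n) : {mpoly K[n * n]} :=
  'X_(mxvec_index i j).

Definition quad_system (K : fieldType) (n : nat) (B C : 'M[K]_n) :
    'M[{mpoly K[n * n]}]_n :=
  quad_lhs (map_mx (@mpolyC (n * n) K) B) (map_mx (@mpolyC (n * n) K) C)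
           (\matrix_(i, j) unknown K i j).

Definition ideal_of_entries (R : comNzRingType) (n : nat) (E : 'M[R]_n)
    (f : R) : Prop :=
  exists a : 'M[R]_n, f = \sum_i \sum_j a i j * E i j.

(* Well-foundedness is automatic, by Dickson's lemma. *)
Definition monomial_order (m : nat) (le : rel 'X_{1..m}) : Prop :=
  [/\ total le, antisymmetric le, transitive le,
      forall u, le 0%MM u
    & forall u v w, le u v -> le (u + w)%MM (v + w)%MM].

Definition leading_monomial (K : fieldType) (m : nat) (le : rel 'X_{1..m})
    (f : {mpoly K[m]}) (u : 'X_{1..m}) : Prop :=
  u \in msupp f /\ forall v, v \in msupp f -> le v u.

Definition groebner_basis (K : fieldType) (m : nat) (le : rel 'X_{1..m})
    (I G : {mpoly K[m]} -> Prop) : Prop :=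
  (forall g, G g -> I g) /\
  (forall f, I f -> f != 0 ->
     exists g u v, [/\ G g, leading_monomial le g u, leading_monomial le f v
                     & (u <= v)%MM]).

(* p(x_{i,j}) = 0, and x_{k,l} = p_{k,l}(x_{i,j}) for (k,l) <> (i,j). *)
Definition shape_basis (K : fieldType) (n : nat) (i j : 'I_n) (p : {poly K})
    (pp : 'I_n -> 'I_n -> {poly K}) (g : {mpoly K[n * n]}) : Prop :=
  g = horner_alg (unknown K i j) p \/
  exists k l, (k, l) != (i, j) /\
    g = unknown K k l - horner_alg (unknown K i j) (pp k l).

(* Since [size] is degree + 1, the size comparison is deg p_{k,l} < deg p. *)
Definition has_effective_solution (K : fieldType) (n : nat)
    (E : 'M[{mpoly K[n * n]}]_n) : Prop :=
  exists (i j : 'I_n) (p : {poly K}) (pp : 'I_n -> 'I_n -> {poly K}),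
    [/\ p != 0,
        forall k l, (k, l) != (i, j) -> (size (pp k l) < size p)%N
      & exists le : rel 'X_{1..(n * n)}, monomial_order le /\
          groebner_basis le (ideal_of_entries E) (shape_basis i j p pp)].

Definition number_of_solutions (L : fieldType) (n : nat)
    (sol : 'M[L]_n -> Prop) (nu : nat) : Prop :=
  exists s : seq 'M[L]_n, [/\ uniq s, size s = nu & forall X, sol X <-> X \in s].

Definition finitely_many_solutions (L : fieldType) (n : nat)
    (sol : 'M[L]_n -> Prop) : Prop :=
  exists nu, number_of_solutions sol nu.

(* F(a_0, ..., a_{r-1}) is a radical extension of F via this sequence: each
   a_i has a positive power in F(a_0, ..., a_{i-1}). *)
Definition radical_sequence (F L : fieldType) (iota : {rmorphism F -> L})
    (a : seq L) : Prop :=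
  forall i, (i < size a)%N -> exists m, (0 < m)%N /\
    adjoin iota (fun x => x \in take i a) (a`_i ^+ m).

Definition entries_by_radicals (F L : fieldType) (iota : {rmorphism F -> L})
    (n : nat) (X : 'M[L]_n) : Prop :=
  exists a : seq L, radical_sequence iota a /\
    forall i j, adjoin iota (fun x => x \in a) (X i j).

(* Solvability is only defined for equations with a finite positive number of
   solutions, so this number is part of both notions. *)
Definition finite_positive (L : fieldType) (n : nat)
    (sol : 'M[L]_n -> Prop) : Prop :=
  exists nu, (0 < nu)%N /\ number_of_solutions sol nu.

Definition solvable_equation (F L : fieldType) (iota : {rmorphism F -> L})
    (n : nat) (sol : 'M[L]_n -> Prop) : Prop :=
  finite_positive sol /\ (forall X, sol X -> entries_by_radicals iota X).

Definition non_solvable_equation (F L : fieldType) (iota : {rmorphism F -> L})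
    (n : nat) (sol : 'M[L]_n -> Prop) : Prop :=
  finite_positive sol /\ ~ solvable_equation iota sol.

Definition is_solution_entry (L : fieldType) (n : nat) (sol : 'M[L]_n -> Prop)
    (x : L) : Prop :=
  exists X, sol X /\ is_entry X x.

(* N is a splitting field of f over K with Galois group isomorphic to G, and
   [j] is a K-embedding of N into L whose image is the extension of K
   generated by the entries of all the solutions. *)
Definition solvability_complexity (K L : fieldType)
    (iota : {rmorphism K -> L}) (n : nat) (sol : 'M[L]_n -> Prop) (nu : nat)
    (gT : finGroupType) (G : {group gT}) : Prop :=
  number_of_solutions sol nu /\
  exists (f : {poly K}) (N : splittingFieldType K) (j : {rmorphism N -> L}),
    [/\ splittingFieldFor 1%VS (map_poly (in_alg N) f) {:N}%VS,
        ('Gal({:N} / 1%AS) \isog G)%g,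
        forall a : K, j a%:A = iota a
      & forall x : L, adjoin iota (is_solution_entry sol) x <->
                      exists y : N, j y = x].

(* Main.v *)
(* If X is a solution, then C = -(X^2 + BXB) is a polynomial in the entries of
   B and X; as the 2 n^2 entries of B and C are algebraically independent over
   Q, a dimension count shows that so are those of B and X.  Hence there are
   finitely many solutions, and the ideal of the equation is maximal: all
   solutions satisfy the same polynomial relations over K.

   Galois groups are bounded below by specialization.  If B0, C0 have entries in
   a field k and X_1, .., X_r are nondegenerate solutions for (B0, C0), then
   Hensel's lemma over power series deforms them to solutions for (B, C), and
   each permutation of the X_i induced by an automorphism of k fixing B0 and C0
   preserves the relations over K between the deformed solutions.  For
   B0 = diag(1, -1) and C0 = [[0, 1/4], [3/4, -1/2]] the traces of the solutions
   are the roots of t (t^5 + 2 t^4 - 3 t^3 - 4 t^2 + 4 t + 3), where the quintic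
   has Galois group S_5 over Q.

   For n > 2, these matrices completed by diagonal blocks give five solutions
   permuted by S_5, so that not all of them are expressible by radicals.  For n = 2, the
   trace of a solution determines it and is a root of a polynomial of degree 6,
   so there are six solutions; their Galois group is transitive and contains all
   the permutations fixing one of them, so it is S_6.  Being 2-transitive, it
   separates the solutions by any entry that is not in K; the field generated by
   a solution is then generated by this entry, which gives the Groebner basis,
   since the ideal of the equation is the ideal of one solution. *)

Require Import Defs.
From HB Require Import structures.
From mathcomp Require Import all_boot all_order all_fingroup all_algebra.
From mathcomp Require Import all_solvable all_field.
From mathcomp Require Import mpoly ring zify.
From mathcomp Require boolp.

Set Implicit Arguments.
Unset Strict Implicit.
Unset Printing Implicit Defensive.

Import Order.TTheory GRing.Theory Num.Theory.

Local Open Scope ring_scope.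

(** * Algebraic dependence and conjugation *)

(** The deformed solutions live in the fraction field of a power series ring, which comes with no
    embedding into [L] or out of it. What travels between the fields is therefore the set of
    polynomial relations over [K] between the entries of a finite family of solutions. These entries
    are algebraic over [K], so a primitive element turns equal sets of relations into a conjugation
    and, inside a splitting field, an inclusion of relations into a Galois automorphism.

    The choice of [diag(1, -1)] makes the special equation solvable by hand. For a solution with
    rows [(x, z)] and [(w, y)] and trace [t], the off-diagonal equations are [(t - 1) z = - 1/4] and
    [(t - 1) w = - 3/4], and the difference of the diagonal ones is [(t + 1) (x - y) = - 1/2]. The
    solution is thus rational in [t], and one diagonal equation remains. The root [0] is rational:
    it labels the solution fixed by S_5. The quintic is irreducible modulo 2 and has exactly two
    non-real roots, so its group contains a transposition and acts transitively on a prime number of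
    roots. *)

Lemma mpoly_morph_ext (n : nat) (R : comNzRingType) (S : nzRingType)
    (f g : {rmorphism {mpoly R[n]} -> S}) :
  (forall c, f c%:MP = g c%:MP) -> (forall i, f 'X_i = g 'X_i) -> f =1 g.
Proof.
move=> fgC fgX p; rewrite (mpolyE p) (rmorph_sum f) (rmorph_sum g); apply: eq_bigr => m _.
rewrite -mul_mpolyC (rmorphM f) (rmorphM g) fgC mpolyXE_id; congr (_ * _).
rewrite (rmorph_prod f) (rmorph_prod g); apply: eq_bigr => i _.
by rewrite (rmorphXn f) (rmorphXn g) fgX.
Qed.

Lemma map_mpoly_meval (n : nat) (R S : comNzRingType) (f : {rmorphism R -> S})
    (v : 'I_n -> S) (p : {mpoly R[n]}) : (map_mpoly f p).@[v] = mmap f v p.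
Proof.
apply: (mpoly_morph_ext (f := [the {rmorphism _ -> _} of meval v \o map_mpoly f])
  (g := [the {rmorphism _ -> _} of mmap f v])) => [c|i] /=.
  by rewrite map_mpolyC mevalC mmapC.
by rewrite map_mpolyX mevalXU mmapX mmap1U.
Qed.

Lemma rmorph_mmap (n : nat) (R S T : comNzRingType) (f : {rmorphism R -> S})
    (g : {rmorphism S -> T}) (v : 'I_n -> S) (p : {mpoly R[n]}) :
  g (mmap f v p) = mmap (g \o f) (g \o v) p.
Proof.
apply: (mpoly_morph_ext (f := [the {rmorphism _ -> _} of g \o mmap f v])
  (g := [the {rmorphism _ -> _} of mmap (g \o f) (g \o v)])) => [c|i] /=.
  by rewrite !mmapC.
by rewrite !mmapX !mmap1U.
Qed.

Lemma eq_mmap (n : nat) (R S : comNzRingType) (f g : {rmorphism R -> S})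
    (u v : 'I_n -> S) : f =1 g -> u =1 v -> forall p, mmap f u p = mmap g v p.
Proof. by move=> fg uv p; apply: eq_bigr => m _; rewrite fg (mmap1_eq _ uv). Qed.

Lemma mmap_comp (n k : nat) (R S : comNzRingType) (f : {rmorphism R -> S})
    (U : 'I_n -> {mpoly R[k]}) (v : 'I_k -> S) (p : {mpoly R[n]}) :
  mmap f v (mmap (@mpolyC k R) U p) = mmap f (fun i => mmap f v (U i)) p.
Proof. by rewrite rmorph_mmap /=; apply: eq_bigr => m _ /=; rewrite mmapC. Qed.

(* Modulo [g], polynomials of degree at most [N] are combinations of monomials
   that the leading monomial of [g] does not divide, of which there are only
   O(N ^ (m - 1)): some exponent is bounded. *)
Section AlgebraicDependence.

Variables (m : nat) (g : {mpoly rat[m.+1]}).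
Hypothesis g_neq0 : g != 0.

Let a := mdeg (mlead g).

(** An index gives the position of the bounded exponent, its value, and the other exponents. A
    monomial may have several indices, which is harmless for an upper bound on their number. *)
Let J N := ('I_m.+1 * 'I_a * {ffun 'I_m -> 'I_N.+1})%type.

Let mon N (j : J N) : 'X_{1..m.+1} :=
  [multinom if unlift j.1.1 k is Some l then j.2 l : nat else j.1.2 | k < m.+1].

Let spanned N (f : {mpoly rat[m.+1]}) :=
  exists (w : J N -> rat) h, f = \sum_j w j *: 'X_[mon j] + g * h.

Let spannedZ N c f : spanned N f -> spanned N (c *: f).
Proof.
move=> [w [h ->]]; exists (fun j => c * w j), (c *: h).
rewrite scalerDr scaler_sumr scalerAr; congr (_ + _).
by apply: eq_bigr => j _; rewrite scalerA.
Qed.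

Let spannedD N f1 f2 : spanned N f1 -> spanned N f2 -> spanned N (f1 + f2).
Proof.
move=> [w1 [h1 ->]] [w2 [h2 ->]]; exists (fun j => w1 j + w2 j), (h1 + h2).
rewrite mulrDr addrACA -big_split; congr (_ + _).
by apply: eq_bigr => j _; rewrite scalerDl.
Qed.

Let spanned_sum N (I : eqType) (r : seq I) (F : I -> {mpoly rat[m.+1]}) :
  (forall i, i \in r -> spanned N (F i)) -> spanned N (\sum_(i <- r) F i).
Proof.
move=> sF; rewrite big_seq; elim/big_ind: _ => //; last exact: spannedD.
exists (fun=> 0), 0; rewrite mulr0 addr0 big1 // => j _; exact: scale0r.
Qed.

Let spannedX N u : (mdeg u <= N)%N -> spanned N 'X_[u].
Proof.
elim/(well_founded_ind (@ltom_wf m.+1)): u => u IHu degu.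
have [/mnm_lepP le_gu | /mnm_lepP ngu] := boolP (mlead g <= u)%MM; last first.
  have [i lt_i] : exists i, (u i < mlead g i)%N.
    apply/existsP/contraT => /existsPn nlt; case: ngu => i.
    by rewrite leqNgt; apply: nlt.
  have lt_ia : (u i < a)%N.
    by rewrite (leq_trans lt_i) // /a mdegE (bigD1 i) //= leq_addr.
  have lt_N k : (u k < N.+1)%N.
    by rewrite ltnS (leq_trans _ degu) // mdegE (bigD1 k) //= leq_addr.
  pose j : J N := (i, Ordinal lt_ia, [ffun l => Ordinal (lt_N (lift i l))]).
  have mon_j : mon j = u.
    apply/mnmP => k; rewrite mnmE /=.
    by case: unliftP => [l ->|->] //=; rewrite ffunE.
  exists (fun j' => (j' == j)%:R), 0; rewrite mulr0 addr0 (bigD1 j) //= eqxx.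
  by rewrite mon_j scale1r big1 ?addr0 // => j' /negPf->; rewrite scale0r.
have lc_neq0 : mleadc g != 0 by rewrite mleadc_eq0.
pose v := (u - mlead g)%MM.
have Du : (v + mlead g)%MM = u by rewrite /v submK //; apply/mnm_lepP.
(* Modulo [g], a monomial divisible by the leading one becomes a multiple of the tail [t] times
   ['X_[v]]. Its monomials are smaller, and the order being graded, their degrees do not exceed that
   of [u]. *)
pose t := g - mleadc g *: 'X_[mlead g].
have -> : 'X_[u] = (mleadc g)^-1 *: (g * 'X_[v] + (-1) *: (t * 'X_[v])).
  rewrite scaleN1r -mulrBl opprB addrC subrK -scalerAl scalerA mulVf //.
  by rewrite scale1r -mpolyXD addmC Du.
apply: spannedZ; apply: spannedD.
  exists (fun=> 0), 'X_[v]; rewrite big1 ?add0r // => j _; exact: scale0r.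
apply: spannedZ; rewrite (mpolyE t) mulr_suml; apply: spanned_sum => w w_t.
rewrite -scalerAl -mpolyXD; apply: spannedZ.
have lt_wu : ((w + v)%MM < u)%O.
  rewrite -Du addmC ltmc_add2r; apply: le_lt_trans (msupp_le_mlead w_t) _.
  apply: ltm_mleadD => //; apply: contraTneq w_t.
  by rewrite -/t => ->; rewrite msupp0.
by apply: IHu => //; rewrite (leq_trans _ degu) // lemc_mdeg // ltW.
Qed.

Let spanned_msize N f : (msize f <= N.+1)%N -> spanned N f.
Proof.
move=> degf; rewrite (mpolyE f); apply: spanned_sum => u /msize_mdeg_lt deg_u.
by apply: spannedZ; apply: spannedX; rewrite -ltnS (leq_trans deg_u).
Qed.

(** Pigeonhole: the products of powers of the [U i] with exponents below [d] outnumber the monomials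
    that span them modulo [g], and a linear dependence between them is [p]. One [p] serves all
    fields and all zeros of [g]. *)
Lemma algebraic_dependenceS (U : 'I_m.+1 -> {mpoly rat[m.+1]}) :
  exists2 p : {mpoly rat[m.+1]}, p != 0 &
  forall (F : comNzRingType) (q : {rmorphism rat -> F}) (v : 'I_m.+1 -> F),
    mmap q v g = 0 -> mmap q (fun i => mmap q v (U i)) p = 0.
Proof.
pose D := \max_i msize (U i).
(* Since [N + 1 <= d ((m + 1) D + 1)], the indices number at most [(m + 1) a ((m + 1) D + 1)^m d^m],
   which is [(d - 1) d^m], while [E] has [d^(m + 1)] elements. *)
pose d := (m.+1 * a * (m.+1 * D).+1 ^ m).+1.
pose N := (d * (m.+1 * D))%N.
pose E := {ffun 'I_m.+1 -> 'I_d}.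
pose mm (e : E) : 'X_{1..m.+1} := [multinom (e i : nat) | i < m.+1].
pose UE (e : E) := mmap (@mpolyC m.+1 rat) U 'X_[mm e].
have degU e : (msize (UE e) <= N.+1)%N.
  have degM (f1 f2 : {mpoly rat[m.+1]}) k1 k2 :
      (msize f1 <= k1.+1)%N -> (msize f2 <= k2.+1)%N ->
      (msize (f1 * f2) <= (k1 + k2).+1)%N.
    move=> le1 le2; have [->|f1_0] := eqVneq f1 0; first by rewrite mul0r msize0.
    have [->|f2_0] := eqVneq f2 0; first by rewrite mulr0 msize0.
    rewrite (msizeM f1_0 f2_0); move: (msize f1) (msize f2) le1 le2 => *; lia.
  have degX (f : {mpoly rat[m.+1]}) k1 k : (msize f <= k1.+1)%N ->
      (msize (f ^+ k) <= (k * k1).+1)%N.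
    move=> le1; elim: k => [|k IHk]; first by rewrite expr0 msizeC.
    by rewrite exprS mulSn degM.
  rewrite /UE mmapX /mmap1.
  have -> : N = (\sum_(i < m.+1) (d * D))%N by rewrite sum_nat_const card_ord mulnCA.
  elim/big_rec2: _ => [|i k f _ IH]; first by rewrite msizeC.
  apply: degM => //; rewrite (leq_trans (degX _ D _ _)) //.
    exact: leqW (leq_bigmax (F := fun k => msize (U k)) i).
  by rewrite ltnS leq_mul // mnmE ltnW.
have sp e := spanned_msize (degU e).
have [w /= Dw] : exists w : E -> J N -> rat, forall e,
    exists h, UE e = \sum_j w e j *: 'X_[mon j] + g * h.
  pose P e (w : {ffun J N -> rat}) := exists h, UE e = \sum_j w j *: 'X_[mon j] + g * h.
  have [//|w Dw] := @fin_all_exists E (fun=> {ffun J N -> rat}) P.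
    move=> e; have [w [h Dh]] := sp e; exists (finfun w), h.
    by rewrite Dh; congr (_ + _); apply: eq_bigr => j _; rewrite ffunE.
  by exists w.
pose W := \matrix_(i < #|{: E}|, j < #|{: J N}|) w (enum_val i) (enum_val j).
have lt_JE : (#|{: J N}| < #|{: E}|)%N.
  rewrite !card_prod !card_ffun !card_ord expnSr.
  have -> : N.+1 = (d * (m.+1 * D)).+1 by [].
  have le_N : ((d * (m.+1 * D)).+1 <= d * (m.+1 * D).+1)%N by rewrite [in leqRHS]mulnS; move: (d * _)%N => k; rewrite -add1n leq_add2r.
  have : ((d * (m.+1 * D)).+1 ^ m <= d ^ m * (m.+1 * D).+1 ^ m)%N.
    by rewrite -expnMn; have [->|m_gt0] := posnP m; rewrite ?expn0 ?leq_exp2r.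
  move=> le_Nm; rewrite (leq_ltn_trans (leq_mul (leqnn _) le_Nm)) //.
  by rewrite mulnCA [ltnRHS]mulnC mulnC ltn_pmul2r ?expn_gt0 // mulnC.
have : kermx W != 0.
  by rewrite -mxrank_eq0 mxrank_ker subn_eq0 -ltnNge (leq_ltn_trans (rank_leq_col _)).
case/rowV0Pn=> u /sub_kermxP uW u_neq0.
exists (\sum_(i < #|{: E}|) u 0 i *: 'X_[mm (enum_val i)]).
  have mm_inj : injective mm.
    move=> e1 e2 /mnmP eq_e; apply/ffunP => i; apply/val_inj.
    by have := eq_e i; rewrite !mnmE.
  have /rV0Pn[i ui] := u_neq0.
  apply: contraNneq ui => /(congr1 (mcoeff (mm (enum_val i)))).
  rewrite mcoeff0 raddf_sum (bigD1 i) //= mcoeffZ mcoeffX eqxx mulr1 big1 ?addr0.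
    by move->.
  move=> k ne_ki; rewrite mcoeffZ mcoeffX (inj_eq mm_inj) (inj_eq enum_val_inj).
  by rewrite (negPf ne_ki) mulr0.
move=> F q v gv0; rewrite -mmap_comp.
suff [h ->] : exists h, mmap (@mpolyC m.+1 rat) U
   (\sum_i u 0 i *: 'X_[mm (enum_val i)]) = g * h by rewrite rmorphM /= gv0 mul0r.
have Dh i := Dw (@enum_val E predT i).
have [h {}Dh] := fin_all_exists Dh.
exists (\sum_i u 0 i *: h i); rewrite raddf_sum mulr_sumr /=.
transitivity (\sum_i (\sum_j (u 0 i * w (enum_val i) j) *: 'X_[mon j]
                 + g * (u 0 i *: h i))).
  apply: eq_bigr => i _; rewrite mmapZ -/(UE _) Dh mul_mpolyC scalerDr scalerAr.
  by congr (_ + _); rewrite scaler_sumr; apply: eq_bigr => j _; rewrite scalerA.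
rewrite big_split exchange_big /= big1 ?add0r // => j _.
rewrite -scaler_suml.
have /rowP/(_ (enum_rank j)) := uW; rewrite !mxE => uWj.
rewrite -[RHS](scale0r 'X_[mon j]); congr (_ *: _); rewrite -[RHS]uWj.
by apply: eq_bigr => i _; rewrite mxE enum_rankK.
Qed.

End AlgebraicDependence.

Lemma algebraic_dependence (m : nat) (g : {mpoly rat[m]})
    (U : 'I_m -> {mpoly rat[m]}) : g != 0 ->
  exists2 p : {mpoly rat[m]}, p != 0 &
  forall (F : comNzRingType) (q : {rmorphism rat -> F}) (v : 'I_m -> F),
    mmap q v g = 0 -> mmap q (fun i => mmap q v (U i)) p = 0.
Proof.
case: m g U => [|m] g U g_neq0; last exact: algebraic_dependenceS.
(* Without variables, [g] is a nonzero constant and has no zero. *)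
exists 1 => [|F q v]; first exact: oner_neq0.
move: g_neq0; rewrite (nvar0_mpolyC g) mpolyC_eq0 mmapC => c_neq0 qc0.
by have := oner_eq0 F; rewrite -(rmorph1 q) -(mulfV c_neq0) rmorphM qc0 mul0r eqxx.
Qed.

Section Relations.

Variables (K F : fieldType) (kappa : {rmorphism K -> F}).

Lemma min_annihilator (x : F) : algebraicOver kappa x ->
  exists m : {poly K}, irreducible_poly m /\ root (map_poly kappa m) x.
Proof.
case=> p p_neq0 px0.
suff [m [m_neq0 mx0 min_m]] : exists m : {poly K}, [/\ m != 0,
    root (map_poly kappa m) x &
    forall q, root (map_poly kappa q) x -> q != 0 -> (size m <= size q)%N].
  by exists m; split=> //; apply/(subfx_irreducibleP mx0 m_neq0).
elim: {p}_.+1 {-2}p (ltnSn (size p)) p_neq0 px0 => // s IHs p lt_s p_neq0 px0.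
have [[m [m_neq0 mx0 lt_m]] | no_m] := boolp.EM (exists m : {poly K},
    [/\ m != 0, root (map_poly kappa m) x & (size m < size p)%N]).
  by apply: (IHs m) => //; apply: leq_trans lt_m _; rewrite -ltnS.
exists p; split=> // q qx0 q_neq0; rewrite leqNgt; apply/negP => lt_qp.
by case: no_m; exists q.
Qed.

Lemma irreducible_root_dvdp (m q : {poly K}) (x : F) :
  irreducible_poly m -> root (map_poly kappa m) x ->
  root (map_poly kappa q) x = (m %| q).
Proof.
move=> irr_m mx0; apply/idP/idP => [qx0 | /dvdpP[r ->]]; last first.
  by rewrite rmorphM rootM mx0 orbT.
have [co_mq | nco_mq] := eqVneq (size (gcdp m q)) 1%N; last first.
  rewrite -(eqp_dvdl _ (irr_m.2 _ nco_mq (dvdp_gcdl _ _))).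
  exact: dvdp_gcdr.
have /Bezout_eq1_coprimepP[[u v] /= uv1] : coprimep m q by rewrite /coprimep co_mq.
have := congr1 (fun p => (map_poly kappa p).[x]) uv1.
rewrite rmorphD !rmorphM rmorph1 /= !hornerE (eqP mx0) (eqP qx0) !mulr0 addr0.
by move/esym/eqP; rewrite oner_eq0.
Qed.

Lemma horner_mmap (r : nat) (p : 'I_r -> {poly K}) (f : {mpoly K[r]}) (x : F) :
  (map_poly kappa (mmap (@polyC K) p f)).[x] =
  mmap kappa (fun i => (map_poly kappa (p i)).[x]) f.
Proof.
have -> q : (map_poly kappa q).[x] = horner_eval x (map_poly kappa q) by [].
rewrite [map_poly _ _]rmorph_mmap rmorph_mmap; apply: eq_bigr => m _ /=.
by rewrite map_polyC /= /horner_eval hornerC.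
Qed.

Lemma mmap_horner (r : nat) (x : 'I_r -> F) (p : {poly K}) (t : {mpoly K[r]}) :
  mmap kappa x (map_poly (@mpolyC r K) p).[t] =
  (map_poly kappa p).[mmap kappa x t].
Proof.
rewrite -horner_map -map_poly_comp /=; congr _.[_].
by apply: eq_map_poly => c /=; rewrite mmapC.
Qed.

End Relations.

Section PrimitiveElement.

Variables (K F : fieldType) (kappa : {rmorphism K -> F}).
Hypothesis charK : [pchar K] =i pred0.

(** The primitive element is kept as a polynomial [t] in the [x i], so that it can be evaluated at
    any other family satisfying the same relations. *)
Lemma primitive_polynomials (r : nat) (x : 'I_r -> F) :
  (forall i, algebraicOver kappa (x i)) ->
  exists (t : {mpoly K[r]}) (p : 'I_r -> {poly K}),
    algebraicOver kappa (mmap kappa x t) /\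
    forall i, x i = (map_poly kappa (p i)).[mmap kappa x t].
Proof.
move=> alg_x.
suff [t [alg_t tP]] : exists t : {mpoly K[r]},
    algebraicOver kappa (mmap kappa x t) /\
    forall i, i \in enum 'I_r ->
      exists p : {poly K}, x i = (map_poly kappa p).[mmap kappa x t].
  have [p Dp] := fin_all_exists (fun i => tP i (mem_enum 'I_r i)).
  by exists t, p.
elim: (enum _) => [|i s [t [alg_t tP]]].
  by exists 0; split=> //; rewrite mmap0; apply: algebraic0.
have [p p_neq0 pt0] := alg_t; have [q q_neq0 qi0] := alg_x i.
have [n [[u Du] [v Dv]]] := pchar0_PET p_neq0 pt0 q_neq0 qi0 charK.
exists ('X_i *+ n - t); rewrite mmapB mmapMn mmapX mmap1U; split.
  apply: algebraic_sub alg_t; rewrite -mulr_natr; apply: algebraic_mul => //.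
  by rewrite -(rmorph_nat kappa); apply: algebraic_id.
move=> j; rewrite inE => /predU1P[->|/tP[w Dw]]; first by exists v.
by exists (w \Po u); rewrite map_comp_poly horner_comp Du -Dw.
Qed.

(** The primitive element is sent to a root in [L] of its minimal polynomial; the resulting
    isomorphism between K(x) and K(y) is seen only through relations. *)
Lemma conjugate_family (L : closedFieldType) (iota : {rmorphism K -> L})
    (r : nat) (x : 'I_r -> F) :
  (forall i, algebraicOver kappa (x i)) ->
  exists y : 'I_r -> L, forall f : {mpoly K[r]},
    mmap kappa x f = 0 <-> mmap iota y f = 0.
Proof.
move=> alg_x; have [t [p [alg_t Dx]]] := primitive_polynomials alg_x.
have [m [irr_m mt0]] := min_annihilator alg_t.
have /closed_rootP[z mz0] : size (map_poly iota m) != 1%N.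
  by rewrite size_map_poly; case: irr_m => + _; case: (size m) => [|[]].
exists (fun i => (map_poly iota (p i)).[z]) => f.
have -> : mmap kappa x f = mmap kappa
    (fun i => (map_poly kappa (p i)).[mmap kappa x t]) f by apply: eq_mmap.
rewrite -horner_mmap -horner_mmap.
set g := mmap _ p f.
by split=> /eqP; rewrite -/(root _ _) (irreducible_root_dvdp g irr_m) // => g0;
  apply/eqP; rewrite -/(root _ _) (irreducible_root_dvdp g irr_m).
Qed.

End PrimitiveElement.

(** The inclusion is applied twice: to the minimal polynomial of the primitive element, which yields
    [g], and to the relations expressing each [y i] in that element, which show that [g] sends [y i]
    to [y' i]. *)
Lemma gal_conjugate_family (K : fieldType) (N : splittingFieldType K) (r : nat)
    (y y' : 'I_r -> N) : [pchar K] =i pred0 ->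
  (forall f : {mpoly K[r]}, mmap (in_alg N) y f = 0 -> mmap (in_alg N) y' f = 0) ->
  exists2 g, g \in 'Gal({:N} / 1%AS)%g & forall i, g (y i) = y' i.
Proof.
move=> charK yy'.
have alg_y i : algebraicOver (in_alg N) (y i).
  have /polyOver1P[p Dp] := minPolyOver 1%AS (y i).
  exists p; last by rewrite -Dp root_minPoly.
  by rewrite -(map_poly_eq0 (in_alg N)) -Dp monic_neq0 ?monic_minPoly.
have [t [p [_ Dy]]] := primitive_polynomials charK alg_y.
have /polyOver1P[m Dm] := minPolyOver 1%AS (mmap (in_alg N) y t).
have mt0 : root (minPoly 1%AS (mmap (in_alg N) y t)) (mmap (in_alg N) y' t).
  rewrite Dm /root -mmap_horner yy' // mmap_horner -Dm.
  by apply/eqP; rewrite -/(root _ _) root_minPoly.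
have [g Gg Dg] := normalField_root_minPoly (sub1v {:N}%AS)
  (normalFieldf 1%AS) (memvf _) mt0.
exists g => // i; rewrite Dy.
have gp (p0 : {poly K}) z : g (map_poly (in_alg N) p0).[z] = (map_poly (in_alg N) p0).[g z].
  rewrite -horner_map -map_poly_comp; congr _.[_]; apply: eq_map_poly => c /=.
  by rewrite rmorph_alg.
rewrite gp Dg; have := yy' ((map_poly (@mpolyC r K) (p i)).[t] - 'X_i).
rewrite !mmapB !mmap_horner !mmapX !mmap1U -Dy subrr => /(_ erefl)/eqP.
by rewrite subr_eq0 => /eqP.
Qed.

(** Galois theory is available for finite extensions, and [L] may be an infinite one. [N] is
    K[X]/(m), where [m] is the minimal polynomial of a primitive element of the roots of [f] in [L],
    and [j] sends the class of X to that element. *)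
Lemma splitting_field_in_closed (K : fieldType) (L : closedFieldType)
    (iota : {rmorphism K -> L}) (f : {poly K}) :
  [pchar K] =i pred0 -> f != 0 ->
  exists (N : splittingFieldType K) (j : {rmorphism N -> L}),
    [/\ forall a : K, j a%:A = iota a,
        splittingFieldFor 1%VS (map_poly (in_alg N) f) {:N}%VS
      & forall z, root (map_poly iota f) z -> exists y, j y = z].
Proof.
move=> charK f_neq0.
have [s Ds] := closed_field_poly_normal (map_poly iota f).
have fi_neq0 : map_poly iota f != 0 by rewrite map_poly_eq0.
have lf_neq0 : lead_coef (map_poly iota f) != 0 by rewrite lead_coef_eq0.
have rs z : (z \in s) = root (map_poly iota f) z.
  by rewrite Ds rootZ // root_prod_XsubC.
pose x (i : 'I_(size s)) := s`_i.
have alg_x i : algebraicOver iota (x i) by exists f; rewrite // -rs mem_nth.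
have [t [p [alg_t Dx]]] := primitive_polynomials charK alg_x.
have [m [irr_m mt0]] := min_annihilator alg_t.
pose N := SubFieldExtType mt0 irr_m.
pose j := [the {rmorphism N -> L} of @subfx_inj _ _ iota (mmap iota x t) m].
have jA a : j a%:A = iota a := subfx_inj_base mt0 (irredp_neq0 irr_m) a.
pose th := subfx_root iota (mmap iota x t) m : N.
have jth : j th = mmap iota x t := subfx_inj_root mt0 (irredp_neq0 irr_m).
pose y i : N := (map_poly (in_alg N) (p i)).[th].
have jy i : j (y i) = x i.
  rewrite Dx -horner_map -map_poly_comp jth; congr _.[_].
  by apply: eq_map_poly => c; apply: jA.
have split_f : splittingFieldFor 1%VS (map_poly (in_alg N) f) {:N}%VS.
  exists [seq y i | i <- enum 'I_(size s)].
    rewrite -(eqp_map j) -map_poly_comp (eq_map_poly jA) Ds.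
    rewrite (eqp_trans (eqp_scale _ _)) // rmorph_prod big_map big_enum /=.
    rewrite (big_nth 0) big_mkord; under [X in _ %= X]eq_bigr => i _.
      rewrite rmorphB /= map_polyX map_polyC /= jy; over.
    exact: eqpxx.
  apply/eqP; rewrite eqEsubv subvf /=; apply/subvP => z _.
  have [q ->] := subfxEroot mt0 (irredp_neq0 irr_m) z.
  pose E : {subfield N} := <<1 & [seq y i | i <- enum 'I_(size s)]>>%AS.
  change (is_true ((map_poly (in_alg N) q).[th] \in E)).
  have inE1 c : in_alg N c \in E by rewrite rpredZ // mem1v.
  have thE : th \in E.
    have -> : th = mmap (in_alg N) y t.
      apply: (fmorph_inj j); rewrite jth rmorph_mmap; apply: eq_mmap => [c|i] /=.
        by rewrite jA.
      by rewrite jy.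
    rewrite /mmap rpred_sum // => u _; rewrite rpredM //.
    rewrite rpred_prod // => i _; rewrite rpredX //; apply: seqv_sub_adjoin.
    by apply: map_f; rewrite mem_enum.
  rewrite rpred_horner //; apply/polyOverP => i; rewrite coef_map.
  exact: inE1.
have FN : splitting_field_axiom N.
  by exists (map_poly (in_alg N) f); first exact: alg_polyOver.
pose Nm := FieldExt_isSplittingField.Build _ N FN.
pose N' : splittingFieldType K := HB.pack N Nm.
exists N', j; split=> // z; rewrite -rs => /(nthP 0)[i lt_i <-].
by exists (y (Ordinal lt_i)); rewrite jy.
Qed.

(** * Power series *)

(** [K] is treated as the fraction field of the image of [alpha]: [kappa] is computed on a chosen
    numerator and denominator, and [kE] shows that the choice does not matter. It serves to map [K]
    into the fractions of power series, and to extend to these fractions an endomorphism of the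
    series. *)
Lemma quotient_morphism (R : comNzRingType) (K P : fieldType)
    (alpha : {rmorphism R -> K}) (beta : {rmorphism R -> P}) :
  (forall r, alpha r = 0 -> beta r = 0) -> (forall r, beta r = 0 -> r = 0) ->
  (forall x, exists p r, alpha r != 0 /\ x = alpha p / alpha r) ->
  exists kappa : {rmorphism K -> P}, forall r, kappa (alpha r) = beta r.
Proof.
move=> ab0 b0 frac.
have ex_frac x : exists pr : R * R, (alpha pr.2 != 0) && (x * alpha pr.2 == alpha pr.1).
  by have [p [r [r0 ->]]] := frac x; exists (p, r); rewrite /= divfK r0 /=.
pose num x := (xchoose (ex_frac x)).1; pose den x := (xchoose (ex_frac x)).2.
have den_neq0 x : alpha (den x) != 0 by case/andP: (xchooseP (ex_frac x)).
have Dnum x : x * alpha (den x) = alpha (num x).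
  by case/andP: (xchooseP (ex_frac x)) => _ /eqP.
have bdn r : alpha r != 0 -> beta r != 0.
  by apply: contraNneq => /b0->; rewrite rmorph0.
pose k x := beta (num x) / beta (den x).
have kE x p r : alpha r != 0 -> x * alpha r = alpha p -> k x = beta p / beta r.
  move=> r0 Dx; apply/eqP; rewrite eqr_div ?bdn // -!rmorphM -subr_eq0 -rmorphB.
  apply/eqP/ab0; rewrite rmorphB !rmorphM -Dnum -Dx /=; ring.
have kB : zmod_morphism k.
  move=> x y; rewrite (kE (x - y) (num x * den y - num y * den x) (den x * den y)).
  - rewrite rmorphB !rmorphM /= /k.
    by field; apply/andP; split; apply: bdn; apply: den_neq0.
  - by rewrite rmorphM mulf_neq0.
  by rewrite rmorphB !rmorphM /= -!Dnum; ring.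
have kM : monoid_morphism k.
  split=> [|x y].
    by rewrite (kE 1 1 1) ?rmorph1 ?mulr1 ?invr1 ?oner_neq0 ?divr1 ?mul1r.
  rewrite (kE (x * y) (num x * num y) (den x * den y)).
  - rewrite !rmorphM /= /k; by field; apply/andP; split; apply: bdn; apply: den_neq0.
  - by rewrite rmorphM mulf_neq0.
  by rewrite !rmorphM /= -!Dnum; ring.
pose kappa : {rmorphism K -> P} := HB.pack k
  (GRing.isZmodMorphism.Build K P k kB) (GRing.isMonoidMorphism.Build K P k kM).
exists kappa => r; rewrite /= (kE _ r 1) ?rmorph1 ?oner_neq0 ?mulr1 //.
by rewrite invr1 mulr1.
Qed.

Definition fps (A : Type) := nat -> A.

HB.instance Definition _ (A : Type) := boolp.gen_eqMixin (fps A).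
HB.instance Definition _ (A : Type) := boolp.gen_choiceMixin (fps A).

Section FpsRing.

Variable A : comNzRingType.
Implicit Types f g h : fps A.

Definition fps_of_poly (p : {poly A}) : fps A := fun n => p`_n.

Definition fps_trunc n f : {poly A} := \poly_(i < n.+1) f i.

Lemma coef_fps_trunc n f i : (i <= n)%N -> (fps_trunc n f)`_i = f i.
Proof. by move=> le_in; rewrite coef_poly ltnS le_in. Qed.

Lemma fpsP f g : (forall n, f n = g n) -> f = g.
Proof. exact: boolp.functional_extensionality_dep. Qed.

Definition fps_add f g : fps A := fun n => f n + g n.
Definition fps_opp f : fps A := fun n => - f n.
(** Reading each coefficient on truncations reduces the ring laws to those of polynomials. *)
Definition fps_mul f g : fps A := fun n => (fps_trunc n f * fps_trunc n g)`_n.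

Lemma coef_mul_trunc (p p' q q' : {poly A}) n :
  (forall i, (i <= n)%N -> p`_i = p'`_i) -> (forall i, (i <= n)%N -> q`_i = q'`_i) ->
  (p * q)`_n = (p' * q')`_n.
Proof.
move=> pp' qq'; rewrite !coefM; apply: eq_bigr => i _.
by rewrite pp' ?qq' ?leq_subr // -ltnS.
Qed.

Lemma fps_mulE f g (p q : {poly A}) n :
  (forall i, (i <= n)%N -> p`_i = f i) -> (forall i, (i <= n)%N -> q`_i = g i) ->
  fps_mul f g n = (p * q)`_n.
Proof.
move=> pf qg; apply: coef_mul_trunc => i le_in.
  by rewrite coef_fps_trunc ?pf.
by rewrite coef_fps_trunc ?qg.
Qed.

Lemma fps_addA : associative fps_add.
Proof. by move=> f g h; apply: fpsP => n; apply: addrA. Qed.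

Lemma fps_addC : commutative fps_add.
Proof. by move=> f g; apply: fpsP => n; apply: addrC. Qed.

Lemma fps_add0 : left_id (fps_of_poly 0) fps_add.
Proof. by move=> f; apply: fpsP => n; rewrite /fps_add /fps_of_poly coef0 add0r. Qed.

Lemma fps_addN : left_inverse (fps_of_poly 0) fps_opp fps_add.
Proof. by move=> f; apply: fpsP => n; rewrite /fps_add /fps_of_poly coef0 addNr. Qed.

HB.instance Definition _ :=
  GRing.isZmodule.Build (fps A) fps_addA fps_addC fps_add0 fps_addN.

Lemma fps_mulA : associative fps_mul.
Proof.
move=> f g h; apply: fpsP => n.
have E k l (u v : fps A) : (k <= l)%N ->
    (fps_trunc l u * fps_trunc l v)`_k = fps_mul u v k.
  move=> le_kl; symmetry; apply: fps_mulE => i le_ik;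
    by rewrite coef_fps_trunc // (leq_trans le_ik).
rewrite (fps_mulE (p := fps_trunc n f) (q := fps_trunc n g * fps_trunc n h)).
- rewrite (fps_mulE (p := fps_trunc n f * fps_trunc n g) (q := fps_trunc n h)).
  + by rewrite mulrA.
  + by move=> i; apply: E.
  by move=> i; apply: coef_fps_trunc.
- by move=> i; apply: coef_fps_trunc.
by move=> i; apply: E.
Qed.

Lemma fps_mulC : commutative fps_mul.
Proof. by move=> f g; apply: fpsP => n; rewrite /fps_mul mulrC. Qed.

Lemma fps_of_polyE (p : {poly A}) n f :
  fps_mul (fps_of_poly p) f n = (p * fps_trunc n f)`_n.
Proof. by apply: fps_mulE => // i; apply: coef_fps_trunc. Qed.

Lemma fps_mul1 : left_id (fps_of_poly 1) fps_mul.
Proof. by move=> f; apply: fpsP => n; rewrite fps_of_polyE mul1r coef_fps_trunc. Qed.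

Lemma fps_mulDl : left_distributive fps_mul fps_add.
Proof.
move=> f g h; apply: fpsP => n.
rewrite (fps_mulE (p := fps_trunc n f + fps_trunc n g) (q := fps_trunc n h)).
- by rewrite mulrDl coefD.
- by move=> i le_in; rewrite coefD !coef_fps_trunc.
by move=> i; apply: coef_fps_trunc.
Qed.

Lemma fps_one_neq0 : fps_of_poly 1 != fps_of_poly 0.
Proof.
apply/eqP => /(congr1 (fun f => f 0%N)).
by rewrite /fps_of_poly coef0 coef1 => /eqP; rewrite oner_eq0.
Qed.

HB.instance Definition _ :=
  GRing.Zmodule_isComNzRing.Build (fps A) fps_mulA fps_mulC fps_mul1 fps_mulDl fps_one_neq0.

Lemma fpsB f g n : (f - g) n = f n - g n. Proof. by []. Qed.

Lemma fps0 n : (0 : fps A) n = 0.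
Proof. exact: coef0. Qed.

Lemma fpsM f g n : (f * g) n = \sum_(i < n.+1) f i * g (n - i)%N.
Proof.
rewrite [LHS](fps_mulE (p := fps_trunc n f) (q := fps_trunc n g)) ?coefM.
- apply: eq_bigr => i _.
  by rewrite !coef_fps_trunc ?leq_subr // -ltnS.
- by move=> i; apply: coef_fps_trunc.
by move=> i; apply: coef_fps_trunc.
Qed.

Lemma fps_sum (I : Type) (r : seq I) (Q : pred I) (F : I -> fps A) n :
  (\sum_(i <- r | Q i) F i) n = \sum_(i <- r | Q i) F i n.
Proof. by elim/big_rec2: _ => [|i y f _ <-]; rewrite ?fps0. Qed.

Lemma fps_of_poly_is_zmod_morphism : zmod_morphism fps_of_poly.
Proof. by move=> p q; apply: fpsP => n; rewrite /fps_of_poly coefB. Qed.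

Lemma fps_of_poly_is_monoid_morphism : monoid_morphism fps_of_poly.
Proof. by split=> // p q; apply: fpsP => n; rewrite fpsM /fps_of_poly coefM. Qed.

HB.instance Definition _ := GRing.isZmodMorphism.Build {poly A} (fps A) fps_of_poly
  fps_of_poly_is_zmod_morphism.
HB.instance Definition _ := GRing.isMonoidMorphism.Build {poly A} (fps A) fps_of_poly
  fps_of_poly_is_monoid_morphism.

Lemma fps_of_poly_inj : injective fps_of_poly.
Proof. by move=> p q pq; apply/polyP => n; apply: (congr1 (fun f => f n) pq). Qed.

(** Units are decided classically; a unit structure is a prerequisite of the integral domain
    structure, hence of the fraction field. *)
Definition fps_unit : {pred fps A} := fun f => boolp.asbool (exists g, g * f = 1).

Definition fps_inv f : fps A :=
  if boolp.pselect (exists g, g * f = 1) is left ex_g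
  then projT1 (boolp.cid ex_g) else f.

Lemma fps_mulVx : {in fps_unit, left_inverse 1 fps_inv *%R}.
Proof.
move=> f /boolp.asboolP f_unit; rewrite /fps_inv.
by case: boolp.pselect => // ex_g; case: boolp.cid.
Qed.

Lemma fps_unitPl f g : g * f = 1 -> fps_unit f.
Proof. by move=> gf; apply/boolp.asboolP; exists g. Qed.

Lemma fps_invr_out : {in [predC fps_unit], fps_inv =1 id}.
Proof.
move=> f /boolp.asboolP not_unit; rewrite /fps_inv.
by case: boolp.pselect.
Qed.

HB.instance Definition _ :=
  GRing.ComNzRing_hasMulInverse.Build (fps A) fps_mulVx fps_unitPl fps_invr_out.

End FpsRing.

(** If [a] and [b] are the orders of two nonzero series, the coefficient of order [a + b] of their
    product is the product of their lowest coefficients. *)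
Lemma fps_integral (A : idomainType) : GRing.integral_domain_axiom (fps A).
Proof.
move=> f g fg0; apply: contraT => /norP[f0 g0].
have ex_coef (h : fps A) : h != 0 -> exists n, h n != 0.
  move=> h0; apply: boolp.contrapT => no_n; case/eqP: h0; apply: fpsP => n.
  by rewrite fps0; apply/eqP/contraT => hn; case: no_n; exists n.
have [a fa min_a] := ex_minnP (ex_coef f f0).
have [b gb min_b] := ex_minnP (ex_coef g g0).
have := congr1 (fun h : fps A => h (a + b)%N) fg0; rewrite fpsM fps0.
have lt_a : (a < (a + b).+1)%N by rewrite ltnS leq_addr.
rewrite (bigD1 (Ordinal lt_a)) //= addKn big1 ?addr0.
  by move/eqP; rewrite mulf_eq0 (negPf fa) (negPf gb).
move=> i ne_ia; have [lt_ia | lt_ai | eq_ia] := ltngtP i a.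
- by have [->|/min_a] := eqVneq (f i) 0; rewrite ?mul0r // leqNgt lt_ia.
- have [->|/min_b] := eqVneq (g (a + b - i)%N) 0; rewrite ?mulr0 //.
  by rewrite leqNgt ltn_subLR ?ltn_add2r ?lt_ai // -ltnS.
by case/eqP: ne_ia; apply: val_inj.
Qed.

HB.instance Definition _ (A : idomainType) :=
  GRing.ComUnitRing_isIntegral.Build (fps A) (@fps_integral A).

Section FpsMap.

Variables (A A' : comNzRingType) (tau : {rmorphism A -> A'}).

Definition fps_map (f : fps A) : fps A' := fun n => tau (f n).

Lemma fps_map_is_zmod_morphism : zmod_morphism fps_map.
Proof. by move=> f g; apply: fpsP => n; rewrite /fps_map fpsB rmorphB. Qed.

Lemma fps_map_is_monoid_morphism : monoid_morphism fps_map.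
Proof.
split=> [|f g]; apply: fpsP => n; rewrite /fps_map.
  by rewrite /GRing.one /= /fps_of_poly !coef1 rmorph_nat.
by rewrite !fpsM rmorph_sum; apply: eq_bigr => i _; rewrite rmorphM.
Qed.

HB.instance Definition _ := GRing.isZmodMorphism.Build (fps A) (fps A') fps_map
  fps_map_is_zmod_morphism.
HB.instance Definition _ := GRing.isMonoidMorphism.Build (fps A) (fps A') fps_map
  fps_map_is_monoid_morphism.

End FpsMap.

(** * Genericity of the solutions *)

Lemma fraction_quotient (R : idomainType) (x : {fraction R}) :
  exists p r : R, FracField.tofrac r != 0 /\ x = FracField.tofrac p / FracField.tofrac r.
Proof.
elim/quotW: x => y; exists \n_y, \d_y; rewrite tofrac_eq0 denom_ratioP; split=> //.
have d0 : FracField.tofrac \d_y != 0 by rewrite tofrac_eq0 denom_ratioP.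
apply: (mulIf d0); rewrite divfK //; unlock FracField.tofrac.
rewrite -[LHS]FracField.pi_mul; apply/eqmodP => /=.
rewrite FracField.equivfE /FracField.mulf !numden_Ratio ?mulf_neq0 ?oner_eq0 ?denom_ratioP //.
by rewrite !mulr1 mulrC.
Qed.

Section EntryVectors.

Variables (n : nat).

Definition pair_entries (R : Type) (B C : 'M[R]_n) : 'I_(n * n + n * n) -> R :=
  row_mx (mxvec B) (mxvec C) 0.

Definition family_entries (R : Type) (r : nat) (Y : 'I_r -> 'M[R]_n) :
    'I_(r * (n * n)) -> R :=
  mxvec (\matrix_i mxvec (Y i)) 0.

Definition family_of_entries (R : Type) (r : nat) (y : 'I_(r * (n * n)) -> R)
    (i : 'I_r) : 'M[R]_n := vec_mx (row i (vec_mx (\row_v y v))).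

Lemma family_entriesK (R : Type) (r : nat) (Y : 'I_r -> 'M[R]_n) :
  family_of_entries (family_entries Y) =1 Y.
Proof.
move=> i; rewrite /family_of_entries; have -> : \row_v family_entries Y v = mxvec (\matrix_i mxvec (Y i)).
  by apply/rowP => v; rewrite mxE.
by rewrite mxvecK rowK mxvecK.
Qed.

Lemma family_of_entriesK (R : Type) (r : nat) (y : 'I_(r * (n * n)) -> R) :
  family_entries (family_of_entries y) =1 y.
Proof.
move=> v; case/mxvec_indexP: v => i w; case/mxvec_indexP: w => a b.
by rewrite /family_entries mxvecE mxE mxvecE !mxE.
Qed.

Lemma map_family_of_entries (R S : Type) (f : R -> S) (r : nat)
    (y : 'I_(r * (n * n)) -> R) i :
  map_mx f (family_of_entries y i) = family_of_entries (f \o y) i.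
Proof. by apply/matrixP => a b; rewrite !mxE. Qed.

Lemma map_family_entries (R S : Type) (f : R -> S) (r : nat)
    (Y : 'I_r -> 'M[R]_n) v :
  f (family_entries Y v) = family_entries (fun i => map_mx f (Y i)) v.
Proof.
case/mxvec_indexP: v => i w; case/mxvec_indexP: w => a b.
by rewrite /family_entries !mxvecE !mxE !mxvecE !mxE.
Qed.

Lemma eq_family_entries (R : Type) (r : nat) (Y Z : 'I_r -> 'M[R]_n) :
  Y =1 Z -> family_entries Y =1 family_entries Z.
Proof.
move=> YZ v; case/mxvec_indexP: v => i w.
by rewrite /family_entries !mxvecE !mxE YZ.
Qed.

Lemma map_pair_entries (R S : Type) (f : R -> S) (B C : 'M[R]_n) v :
  f (pair_entries B C v) = pair_entries (map_mx f B) (map_mx f C) v.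
Proof.
rewrite /pair_entries -!map_mxvec -map_row_mx.
by rewrite [RHS]mxE.
Qed.

Definition fst_matrix (R : Type) (w : 'I_(n * n + n * n) -> R) : 'M[R]_n :=
  vec_mx (lsubmx (\row_v w v)).

Definition snd_matrix (R : Type) (w : 'I_(n * n + n * n) -> R) : 'M[R]_n :=
  vec_mx (rsubmx (\row_v w v)).

Lemma fst_matrixK (R : Type) (B C : 'M[R]_n) : fst_matrix (pair_entries B C) = B.
Proof.
rewrite /fst_matrix; have -> : \row_v pair_entries B C v = row_mx (mxvec B) (mxvec C).
  by apply/rowP => v; rewrite mxE.
by rewrite row_mxKl mxvecK.
Qed.

Lemma snd_matrixK (R : Type) (B C : 'M[R]_n) : snd_matrix (pair_entries B C) = C.
Proof.
rewrite /snd_matrix; have -> : \row_v pair_entries B C v = row_mx (mxvec B) (mxvec C).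
  by apply/rowP => v; rewrite mxE.
by rewrite row_mxKr mxvecK.
Qed.

Lemma map_fst_matrix (R S : Type) (f : R -> S) w :
  map_mx f (fst_matrix w) = fst_matrix (f \o w).
Proof. by apply/matrixP => a b; rewrite !mxE. Qed.

Lemma map_snd_matrix (R S : Type) (f : R -> S) w :
  map_mx f (snd_matrix w) = snd_matrix (f \o w).
Proof. by apply/matrixP => a b; rewrite !mxE. Qed.

Lemma eq_fst_matrix (R : Type) (w w' : 'I_(n * n + n * n) -> R) :
  w =1 w' -> fst_matrix w = fst_matrix w'.
Proof. by move=> ww'; apply/matrixP => a b; rewrite !mxE ww'. Qed.

Lemma eq_snd_matrix (R : Type) (w w' : 'I_(n * n + n * n) -> R) :
  w =1 w' -> snd_matrix w = snd_matrix w'.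
Proof. by move=> ww'; apply/matrixP => a b; rewrite !mxE ww'. Qed.

Lemma pair_entries_fst (R : Type) (B C : 'M[R]_n) i j :
  pair_entries B C (lshift _ (mxvec_index i j)) = B i j.
Proof. by rewrite /pair_entries row_mxEl mxvecE. Qed.

Lemma pair_entries_snd (R : Type) (B C : 'M[R]_n) i j :
  pair_entries B C (rshift _ (mxvec_index i j)) = C i j.
Proof. by rewrite /pair_entries row_mxEr mxvecE. Qed.

Lemma map_quad_lhs (R S : comNzRingType) (f : {rmorphism R -> S}) (B C X : 'M[R]_n) :
  map_mx f (quad_lhs B C X) = quad_lhs (map_mx f B) (map_mx f C) (map_mx f X).
Proof. by rewrite /quad_lhs !map_mxD !map_mxM. Qed.

Lemma map_mx_comp_eq (R S T : Type) (f : R -> S) (g : S -> T) (h : R -> T)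
    (M : 'M[R]_n) : (forall x, g (f x) = h x) -> map_mx g (map_mx f M) = map_mx h M.
Proof. by move=> gf; apply/matrixP => i j; rewrite !mxE. Qed.

(* The right-hand side of [C = - (X ^ 2 + B X B)], with indeterminates for the
   entries of [B] and of [X]. *)
Definition quad_constant (R : comNzRingType) (B X : 'M[R]_n) : 'M[R]_n :=
  - (X *m X + B *m X *m B).

Lemma quad_lhs_eq0 (R : comNzRingType) (B C X : 'M[R]_n) :
  quad_lhs B C X = 0 <-> C = quad_constant B X.
Proof.
rewrite /quad_lhs /quad_constant; split=> [/eqP | ->]; last by rewrite addrN.
by rewrite addr_eq0 => /eqP->; rewrite opprK.
Qed.

Lemma map_quad_constant (R S : comNzRingType) (f : {rmorphism R -> S}) (B X : 'M[R]_n) :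
  map_mx f (quad_constant B X) = quad_constant (map_mx f B) (map_mx f X).
Proof. by rewrite /quad_constant map_mxN map_mxD !map_mxM. Qed.

End EntryVectors.

Section Generic.

Variables (n : nat) (K : fieldType) (q : {rmorphism rat -> K}) (B C : 'M[K]_n).
Hypothesis BC_generic : generic_matrices q B C.

Lemma generic_mmap_eq0 (p : {mpoly rat[n * n + n * n]}) :
  mmap q (pair_entries B C) p = 0 -> p = 0.
Proof. by move=> p0; apply: BC_generic; rewrite map_mpoly_meval. Qed.

Lemma generated_fraction : generated_by_entries q B C ->
  forall x : K, exists p r, mmap q (pair_entries B C) r != 0 /\
    x = mmap q (pair_entries B C) p / mmap q (pair_entries B C) r.
Proof.
move=> K_generated x; set ev := mmap q _.
have fracE p : exists p' r, ev r != 0 /\ ev p = ev p' / ev r.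
  by exists p, 1; rewrite /ev rmorph1 oner_neq0 divr1.
have fracX v : exists p' r, ev r != 0 /\ pair_entries B C v = ev p' / ev r.
  by have := fracE 'X_v; rewrite {2}/ev mmapX mmap1U.
elim: {x}(K_generated x) => [a|x Bx|x y _ [p1 [r1 [r10 ->]]] _ [p2 [r2 [r20 ->]]]
                            |x y _ [p1 [r1 [r10 ->]]] _ [p2 [r2 [r20 ->]]]].
- by rewrite -(mmapC (pair_entries B C) q); apply: fracE.
- case: Bx => [] [i [j ->]].
    by rewrite -(pair_entries_fst _ C).
  by rewrite -(pair_entries_snd B).
- exists (p1 * r2 - p2 * r1), (r1 * r2); split; first by rewrite /ev rmorphM mulf_neq0.
  by rewrite /ev rmorphB !rmorphM /=; field; apply/andP; split.
(* [adjoin] allows division by zero, whose value is zero. *)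
have [p20|p20] := eqVneq (ev p2) 0.
  rewrite p20 mul0r invr0 mulr0; exists 0, 1.
  by rewrite /ev rmorph1 rmorph0 oner_neq0 mul0r.
exists (p1 * r2), (r1 * p2); split; first by rewrite /ev rmorphM mulf_neq0.
by rewrite /ev !rmorphM /=; field; apply/and3P; split.
Qed.

Definition genB : 'M[{mpoly rat[n * n + n * n]}]_n := fst_matrix (fun v => 'X_v).
Definition genX : 'M[{mpoly rat[n * n + n * n]}]_n := snd_matrix (fun v => 'X_v).
Definition genC := quad_constant genB genX.

Lemma map_genB (F : comNzRingType) (qF : {rmorphism rat -> F}) (B' X' : 'M[F]_n) :
  map_mx (mmap qF (pair_entries B' X')) genB = B'.
Proof.
rewrite /genB map_fst_matrix -[RHS](fst_matrixK B' X'); apply: eq_fst_matrix => v /=.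
by rewrite mmapX mmap1U.
Qed.

Lemma map_genX (F : comNzRingType) (qF : {rmorphism rat -> F}) (B' X' : 'M[F]_n) :
  map_mx (mmap qF (pair_entries B' X')) genX = X'.
Proof.
rewrite /genX map_snd_matrix -[RHS](snd_matrixK B' X'); apply: eq_snd_matrix => v /=.
by rewrite mmapX mmap1U.
Qed.

Lemma map_genC (F : comNzRingType) (qF : {rmorphism rat -> F}) (B' X' : 'M[F]_n) :
  map_mx (mmap qF (pair_entries B' X')) genC = quad_constant B' X'.
Proof. by rewrite map_quad_constant map_genB map_genX. Qed.

(** The dimension count: the entries of [B] and [C] are as many polynomials in the entries of [B]
    and [X] as there are such entries, so a relation between the latter would force one between the
    former. *)
Lemma solution_generic (F : fieldType) (kappa : {rmorphism K -> F}) (X : 'M[F]_n)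
    (p : {mpoly rat[n * n + n * n]}) :
  quad_lhs (map_mx kappa B) (map_mx kappa C) X = 0 ->
  mmap (kappa \o q) (pair_entries (map_mx kappa B) X) p = 0 -> p = 0.
Proof.
move=> /quad_lhs_eq0 DC pX0; apply/eqP/contraT => p_neq0.
have [r r_neq0 rP] := algebraic_dependence (pair_entries genB genC) p_neq0.
have := rP _ _ _ pX0; rewrite (@eq_mmap _ _ _ (kappa \o q) (kappa \o q)
  _ (kappa \o pair_entries B C)) //; last first.
  by move=> v; rewrite [LHS]map_pair_entries map_genB map_genC -DC [RHS]map_pair_entries.
rewrite -rmorph_mmap => /eqP; rewrite fmorph_eq0 => /eqP/generic_mmap_eq0 r0.
by rewrite r0 eqxx in r_neq0.
Qed.

(** [P] is chosen before [F], so that it applies in [L] and in the power series field alike. *)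
Lemma solution_entry_algebraic (i j : 'I_n) : exists2 P : {poly K}, P != 0 &
  forall (F : fieldType) (kappa : {rmorphism K -> F}) (X : 'M[F]_n),
    quad_lhs (map_mx kappa B) (map_mx kappa C) X = 0 ->
    root (map_poly kappa P) (X i j).
Proof.
pose M := (n * n + n * n)%N.
pose Wd : {rmorphism {mpoly rat[M]} -> {mpoly rat[M.+1]}} :=
  mmap (@mpolyC M.+1 rat) (fun k => 'X_(lift ord_max k)).
(* These are [M + 1] polynomials in [M] variables. A dummy variable of index [ord_max] equalizes the
   numbers, and the relation imposed on the variables is that the dummy one vanishes. *)
pose U (k : 'I_M.+1) : {mpoly rat[M.+1]} :=
  if unlift ord_max k is Some k' then Wd (pair_entries genB genC k') else Wd (genX i j).
have X_neq0 : 'X_ord_max != 0 :> {mpoly rat[M.+1]} by rewrite -msize_poly_eq0 msizeX.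
have [p p_neq0 pP] := algebraic_dependence U X_neq0.
pose gen (R : comNzRingType) (b : 'I_M -> R) : 'I_M.+1 -> {poly R} :=
  fun k => if unlift ord_max k is Some k' then (b k')%:P else 'X.
pose Th : {rmorphism {mpoly rat[M.+1]} -> {poly {mpoly rat[M]}}} :=
  mmap (polyC \o @mpolyC M rat) (gen _ (fun k => 'X_k)).
pose Ps (Q : {poly {mpoly rat[M]}}) : {mpoly rat[M.+1]} := (map_poly Wd Q).['X_ord_max].
pose PsM : {rmorphism {poly {mpoly rat[M]}} -> {mpoly rat[M.+1]}} :=
  [the {rmorphism _ -> _} of horner_eval ('X_ord_max : {mpoly rat[M.+1]}) \o map_poly Wd].
have ThK p0 : PsM (Th p0) = p0.
  apply: (mpoly_morph_ext (f := [the {rmorphism _ -> _} of PsM \o Th]) (g := idfun)).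
    move=> c /=; rewrite mmapC /= map_polyC /horner_eval hornerC.
    by rewrite [LHS]mmapC.
  move=> k /=; rewrite mmapX mmap1U /gen /horner_eval.
  case: unliftP => [k' ->|->]; last by rewrite map_polyX hornerX.
  by rewrite map_polyC hornerC [LHS]mmapX mmap1U.
(* The dependence [p] becomes univariate in its last variable, which stands for the entry of [X];
   genericity of [B] and [C] keeps some coefficient nonzero. *)
exists (map_poly (mmap q (pair_entries B C)) (Th p)).
  apply: contraNneq p_neq0 => P0; rewrite -(ThK p).
  suff -> : Th p = 0 by rewrite rmorph0.
  apply/polyP => k; rewrite coef0; apply: generic_mmap_eq0.
  by rewrite -coef_map P0 coef0.
move=> F kappa X DX; have DC := (quad_lhs_eq0 _ _ _).1 DX.
pose vF (k : 'I_M.+1) : F := if unlift ord_max k is Some k'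
  then pair_entries (map_mx kappa B) X k' else 0.
have XF0 : mmap (kappa \o q) vF 'X_ord_max = 0.
  by rewrite mmapX mmap1U /vF unlift_none.
have := pP _ _ _ XF0; rewrite /root => pv0; apply/eqP.
pose EvF : {rmorphism {mpoly rat[M.+1]} -> F} := [the {rmorphism _ -> _} of
   horner_eval (X i j) \o map_poly kappa \o map_poly (mmap q (pair_entries B C)) \o Th].
have -> : (map_poly kappa (map_poly (mmap q (pair_entries B C)) (Th p))).[X i j]
    = EvF p by [].
rewrite -[RHS]pv0; apply: mpoly_morph_ext => [c|k] /=.
  by rewrite !mmapC /= !map_polyC /= mmapC /horner_eval hornerC.
have WdE f : mmap (kappa \o q) vF (Wd f) = mmap (kappa \o q) (pair_entries (map_mx kappa B) X) f.
  rewrite mmap_comp; apply: eq_mmap => // l.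
  by rewrite mmapX mmap1U /vF liftK.
rewrite !mmapX !mmap1U /gen /U /horner_eval; case: unliftP => [k' _|_].
  rewrite !map_polyC hornerC /= mmapX mmap1U WdE [LHS]map_pair_entries.
  by rewrite [RHS]map_pair_entries map_genB map_genC -DC.
rewrite !map_polyX hornerX WdE.
by move/matrixP/(_ i j): (map_genX (kappa \o q) (map_mx kappa B) X); rewrite mxE => ->.
Qed.

Lemma finite_solutions (L : closedFieldType) (iota : {rmorphism K -> L}) :
  finitely_many_solutions (quad_solution iota B C).
Proof.
have ex_s i j : exists s : seq L, forall X, quad_solution iota B C X -> X i j \in s.
  have [P P_neq0 rootP] := solution_entry_algebraic i j.
  have [s Ds] := closed_field_poly_normal (map_poly iota P).
  exists s => X /rootP; rewrite Ds rootZ ?root_prod_XsubC //.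
  by rewrite lead_coef_eq0 map_poly_eq0.
have [s sP] := fin_all_exists (fun ij : 'I_n * 'I_n => ex_s ij.1 ij.2).
pose S := flatten [seq s ij | ij <- enum {: 'I_n * 'I_n}].
pose mxS (f : {ffun 'I_n * 'I_n -> seq_sub S}) : 'M[L]_n := \matrix_(i, j) val (f (i, j)).
pose sol := [seq X <- undup [seq mxS f | f <- enum {: {ffun 'I_n * 'I_n -> seq_sub S}}]
            | quad_lhs (map_mx iota B) (map_mx iota C) X == 0].
exists (size sol), sol; split=> //; first by rewrite filter_uniq ?undup_uniq.
move=> X; rewrite mem_filter mem_undup; split=> [X_sol | /andP[/eqP//]].
rewrite [quad_lhs _ _ _]X_sol eqxx.
have XS ij : X ij.1 ij.2 \in S.
  by apply/flatten_mapP; exists ij; rewrite ?mem_enum ?sP.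
apply/mapP; exists [ffun ij => SeqSub (XS ij)]; rewrite ?mem_enum //.
by apply/matrixP => i j; rewrite mxE ffunE.
Qed.

End Generic.

(** * Lifting solutions *)

Definition quad_derivative (R : comNzRingType) (n : nat) (B X H : 'M[R]_n) : 'M[R]_n :=
  X *m H + H *m X + B *m H *m B.

Section Hensel.

Variables (A : comNzRingType) (n : nat).
Local Notation S := (fps A).
Implicit Types (X Y Z B C : 'M[S]_n).

Definition mx_coef (k : nat) (Z : 'M[S]_n) : 'M[A]_n := map_mx (fun f : S => f k) Z.

Definition mx_monomial (k : nat) (H : 'M[A]_n) : 'M[S]_n :=
  map_mx (fun a => fps_of_poly (a *: 'X^k)) H.

Lemma mx_coefD k Y Z : mx_coef k (Y + Z) = mx_coef k Y + mx_coef k Z.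
Proof. by apply/matrixP => i j; rewrite !mxE. Qed.

Lemma mx_coefB k Y Z : mx_coef k (Y - Z) = mx_coef k Y - mx_coef k Z.
Proof. by apply/matrixP => i j; rewrite !mxE. Qed.

Lemma mx_coef0 k : mx_coef k 0 = 0.
Proof. by apply/matrixP => i j; rewrite !mxE fps0. Qed.

Lemma mx_coefM k Y Z :
  mx_coef k (Y *m Z) = \sum_(i < k.+1) mx_coef i Y *m mx_coef (k - i) Z.
Proof.
apply/matrixP => a b; rewrite !mxE fps_sum summxE.
under eq_bigr do rewrite fpsM; rewrite exchange_big /=.
apply: eq_bigr => i _; rewrite mxE; apply: eq_bigr => c _; by rewrite !mxE.
Qed.

Lemma mx_coef_monomial k l H : mx_coef k (mx_monomial l H) = H *+ (k == l).
Proof.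
apply/matrixP => a b; rewrite !mxE /fps_of_poly coefZ coefXn mulr_natr.
by case: eqP => _; rewrite ?mulr1n // !mulr0n mxE.
Qed.

Lemma mx_coefM_monomial k Y H : mx_coef k (Y *m mx_monomial k H) = mx_coef 0 Y *m H.
Proof.
rewrite mx_coefM big_ord_recl subn0 mx_coef_monomial eqxx mulr1n big1 ?addr0 //.
move=> i _; rewrite mx_coef_monomial; case: eqP => [|_]; last by rewrite mulr0n mulmx0.
by rewrite /= /bump /=; have := ltn_ord i; lia.
Qed.

Lemma mx_coef_monomialM k Y H : mx_coef k (mx_monomial k H *m Y) = H *m mx_coef 0 Y.
Proof.
rewrite mx_coefM big_ord_recr /= subnn mx_coef_monomial eqxx mulr1n big1 ?add0r //.
move=> i _; rewrite mx_coef_monomial; case: eqP => [|_]; last by rewrite mulr0n mul0mx.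
by have := ltn_ord i; lia.
Qed.

Lemma mx_coefM_ext k Y Y' Z Z' :
  (forall i, (i <= k)%N -> mx_coef i Y = mx_coef i Y') ->
  (forall i, (i <= k)%N -> mx_coef i Z = mx_coef i Z') ->
  forall i, (i <= k)%N -> mx_coef i (Y *m Z) = mx_coef i (Y' *m Z').
Proof.
move=> YY' ZZ' i le_ik; rewrite !mx_coefM; apply: eq_bigr => l _.
by have := ltn_ord l => lt_l; rewrite YY' ?ZZ' //; lia.
Qed.

Lemma mx_coef_quad_ext k B C X X' :
  (forall i, (i <= k)%N -> mx_coef i X = mx_coef i X') ->
  mx_coef k (quad_lhs B C X) = mx_coef k (quad_lhs B C X').
Proof.
move=> XX'.
have D Z : mx_coef k (quad_lhs B C Z) =
    mx_coef k (Z *m Z) + mx_coef k (B *m Z *m B) + mx_coef k C.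
  by rewrite -(mx_coefD k (Z *m Z)) -(mx_coefD k _ C).
have E1 : mx_coef k (X *m X) = mx_coef k (X' *m X') by apply: mx_coefM_ext (leqnn k).
have E2 : mx_coef k (B *m X *m B) = mx_coef k (B *m X' *m B).
  by apply: (mx_coefM_ext (k := k)) => // i le_ik; apply: mx_coefM_ext le_ik.
exact: etrans (D X) (etrans (congr2 (fun a b => a + b + mx_coef k C) E1 E2) (esym (D X'))).
Qed.

(** The solution is built one order at a time: a correction of order [k + 1] changes the coefficient
    of that order by the derivative at [X0], because its square starts at order [2 k + 2]. *)
Lemma hensel (B C : 'M[S]_n) (X0 : 'M[A]_n) :
  quad_lhs (mx_coef 0 B) (mx_coef 0 C) X0 = 0 ->
  (forall R, exists H, quad_derivative (mx_coef 0 B) X0 H = R) ->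
  exists X : 'M[S]_n, quad_lhs B C X = 0 /\ mx_coef 0 X = X0.
Proof.
move=> sol0 surj; pose next k (W : 'M[S]_n) : 'M[S]_n :=
  W + mx_monomial k.+1 (projT1 (boolp.cid (surj (- mx_coef k.+1 (quad_lhs B C W))))).
pose W := fix W k : 'M[S]_n :=
  if k is k'.+1 then next k' (W k') else mx_monomial 0 X0.
have coefWS k i : i != k.+1 -> mx_coef i (W k.+1) = mx_coef i (W k).
  by move=> ne_ik; rewrite mx_coefD mx_coef_monomial (negPf ne_ik) mulr0n addr0.
have coefW k l i : (i <= k <= l)%N -> mx_coef i (W l) = mx_coef i (W k).
  case/andP=> le_ik; elim: l => [|l IHl]; first by rewrite leqn0 => /eqP->.
  rewrite leq_eqVlt => /predU1P[-> //|]; rewrite ltnS => le_kl.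
  by rewrite coefWS ?IHl //; apply: contraTneq le_ik => ->; rewrite -ltnNge ltnS.
have W00 k : mx_coef 0 (W k) = X0.
  by rewrite (coefW 0%N) // mx_coef_monomial mulr1n.
have quadW k : mx_coef k (quad_lhs B C (W k)) = 0.
  case: k => [|k].
    rewrite /quad_lhs !mx_coefD !mx_coefM !big_ord1 !mx_coefM !big_ord1.
    by rewrite [mx_coef 0 (W 0)]mx_coef_monomial mulr1n.
  rewrite [W _]/= /next; case: boolp.cid => H /= DH; set D := mx_monomial k.+1 H.
  have -> : quad_lhs B C (W k + D) =
      quad_lhs B C (W k) + (W k *m D + D *m W k + B *m D *m B) + D *m D.
    rewrite /quad_lhs mulmxDl !mulmxDr mulmxDl.
    by rewrite [LHS](AC ((2*2)*2*1) (1*5*7*(2*3*6)*4)).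
  have DD0 : mx_coef k.+1 (D *m D) = 0.
    rewrite mx_coefM big1 // => i _; rewrite !mx_coef_monomial.
    case: eqP => [->|_]; last by rewrite mulr0n mul0mx.
    by rewrite subnn mulr0n mulmx0.
  move: (quad_lhs B C (W k)) DH => Q DH.
  rewrite 2!mx_coefD DD0 addr0 !mx_coefD mx_coefM_monomial mx_coef_monomialM W00.
  have -> : mx_coef k.+1 (B *m D *m B) = mx_coef 0 B *m H *m mx_coef 0 B.
    have BD i : (i <= k.+1)%N ->
        mx_coef i (B *m D) = mx_coef i (mx_monomial k.+1 (mx_coef 0 B *m H)).
      rewrite leq_eqVlt => /predU1P[->|lt_ik].
        by rewrite mx_coefM_monomial mx_coef_monomial eqxx.
      rewrite mx_coef_monomial (ltn_eqF lt_ik) mulr0n mx_coefM big1 // => l _.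
      rewrite mx_coef_monomial ltn_eqF ?mulr0n ?mulmx0 //.
      by rewrite (leq_ltn_trans (leq_subr _ _)).
    by rewrite (mx_coefM_ext BD (Z' := B)) // mx_coef_monomialM.
  by move: DH; rewrite /quad_derivative => ->; rewrite addrN.
(* The coefficient of order [k] is final from step [k] on, so the limit is read on the diagonal. *)
pose X : 'M[S]_n := \matrix_(i, j) (fun k => W k i j k).
have coefX k : mx_coef k X = mx_coef k (W k) by apply/matrixP => i j; rewrite !mxE.
exists X; split; last by rewrite coefX W00.
apply/matrixP => i j; rewrite [RHS]mxE; apply: fpsP => k; rewrite fps0.
have E l : (l <= k)%N -> mx_coef l X = mx_coef l (W k).
  by move=> le_lk; rewrite coefX (coefW l k) // leqnn.
have := quadW k; rewrite -(mx_coef_quad_ext B C E) => /matrixP/(_ i j).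
by rewrite [LHS]mxE [RHS]mxE.
Qed.

Lemma quad_derivative_sub (B C X X' : 'M[S]_n) :
  quad_lhs B C X - quad_lhs B C X' =
  X *m (X - X') + (X - X') *m X' + B *m (X - X') *m B.
Proof.
rewrite /quad_lhs !mulmxBr !mulmxBl.
move: (X *m X) (X' *m X') (X *m X') (B *m X *m B) (B *m X' *m B) => a b c d e.
by rewrite opprD addrACA subrr addr0 opprD addrACA; congr (_ + _); rewrite addrA subrK.
Qed.

(** The difference D of the solutions satisfies [X D + D X' + B D B = 0]; the lowest coefficient of
    D is then killed by the derivative at the common constant term. *)
Lemma hensel_unique (B C X X' : 'M[S]_n) :
  quad_lhs B C X = 0 -> quad_lhs B C X' = 0 -> mx_coef 0 X = mx_coef 0 X' ->
  (forall H, quad_derivative (mx_coef 0 B) (mx_coef 0 X) H = 0 -> H = 0) ->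
  X = X'.
Proof.
move=> sol sol' XX'0 inj; apply/eqP; rewrite -subr_eq0; apply/eqP.
have := quad_derivative_sub B C X X'; rewrite sol sol' subrr.
have : mx_coef 0 (X - X') = 0 by rewrite mx_coefB XX'0 subrr.
move: (X - X') => D D00 /esym D0.
suff Dk k : forall i, (i <= k)%N -> mx_coef i D = 0.
  apply/matrixP => i j; apply: fpsP => k; have /matrixP/(_ i j) := Dk k k (leqnn k).
  by rewrite mxE => ->; rewrite !mxE fps0.
elim: k => [|k IHk] i; first by rewrite leqn0 => /eqP->.
rewrite leq_eqVlt ltnS => /predU1P[->|]; last exact: IHk.
have Dm l : (l <= k.+1)%N -> mx_coef l D = mx_coef l (mx_monomial k.+1 (mx_coef k.+1 D)).
  rewrite leq_eqVlt ltnS => /predU1P[->|le_lk].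
    by rewrite mx_coef_monomial eqxx.
  by rewrite IHk // mx_coef_monomial ltn_eqF ?mulr0n // ltnS.
have E Y l : (l <= k.+1)%N -> mx_coef l Y = mx_coef l Y by [].
apply: inj; have := congr1 (mx_coef k.+1) D0; rewrite mx_coef0 !mx_coefD => <-.
rewrite /quad_derivative; congr (_ + _ + _).
- by rewrite (mx_coefM_ext (E X) Dm) // mx_coefM_monomial.
- by rewrite (mx_coefM_ext Dm (E X')) // mx_coef_monomialM XX'0.
have BD l : (l <= k.+1)%N -> mx_coef l (B *m D) =
    mx_coef l (mx_monomial k.+1 (mx_coef 0 B *m mx_coef k.+1 D)).
  move=> le_l; rewrite (mx_coefM_ext (E B) Dm) //.
  move: le_l; rewrite leq_eqVlt => /predU1P[->|lt_lk].
    by rewrite mx_coefM_monomial mx_coef_monomial eqxx.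
  rewrite mx_coef_monomial (ltn_eqF lt_lk) mulr0n mx_coefM big1 // => u _.
  rewrite mx_coef_monomial ltn_eqF ?mulr0n ?mulmx0 //.
  by rewrite (leq_ltn_trans (leq_subr _ _)).
by rewrite (mx_coefM_ext BD (E B)) // mx_coef_monomialM.
Qed.

End Hensel.

Section Nondegenerate.

Variables (k : fieldType) (n M : nat) (B X : 'M[k]_n).
Hypothesis inj : forall H, quad_derivative B X H = 0 -> H = 0.

Local Notation C := (map_mx (@mpolyC M k)).

Lemma quad_derivative_surj R : exists H, quad_derivative B X H = R.
Proof.
pose f : {linear 'M[k]_n -> 'M[k]_n} :=
  [the {linear _ -> _} of (mulmx X \+ mulmxr X) \+ (mulmxr B \o mulmx B)].
have fE H : f H = quad_derivative B X H by [].
have f_unit : lin_mx f \in unitmx.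
  rewrite -row_free_unit -kermx_eq0; apply: contraT => /rowV0Pn[u /sub_kermxP uf0].
  rewrite -[u]vec_mxK mul_vec_lin fE in uf0 *.
  have /inj -> : quad_derivative B X (vec_mx u) = 0.
    by apply: (can_inj mxvecK); rewrite uf0 linear0.
  by rewrite linear0 eqxx.
exists (vec_mx (mxvec R *m invmx (lin_mx f))).
rewrite -fE; apply: (can_inj mxvecK).
by rewrite -mul_vec_lin vec_mxK mulmxKV.
Qed.

(** With constant [B] and [X], the derivative acts on each coefficient separately; this is what lets
    nondegeneracy over the field [k] pass to the polynomial ring. *)
Lemma mcoeff_quad_derivative u (H : 'M[{mpoly k[M]}]_n) :
  map_mx (mcoeff u) (quad_derivative (C B) (C X) H) =
  quad_derivative B X (map_mx (mcoeff u) H).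
Proof.
have mulCl (Y : 'M[k]_n) (Z : 'M[{mpoly k[M]}]_n) :
    map_mx (mcoeff u) (C Y *m Z) = Y *m map_mx (mcoeff u) Z.
  apply/matrixP => i j; rewrite !mxE raddf_sum; apply: eq_bigr => l _.
  by rewrite !mxE /= mcoeffCM.
have mulCr (Y : 'M[k]_n) (Z : 'M[{mpoly k[M]}]_n) :
    map_mx (mcoeff u) (Z *m C Y) = map_mx (mcoeff u) Z *m Y.
  apply/matrixP => i j; rewrite !mxE raddf_sum; apply: eq_bigr => l _.
  by rewrite !mxE /= mulrC mcoeffCM mulrC.
by rewrite /quad_derivative !map_mxD !mulCr !mulCl.
Qed.

Lemma quad_derivative_inj_mpoly (H : 'M[{mpoly k[M]}]_n) :
  quad_derivative (C B) (C X) H = 0 -> H = 0.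
Proof.
move=> H0; apply/matrixP => i j; apply/mpolyP => u.
have := mcoeff_quad_derivative u H; rewrite H0 map_mx0 => /esym/inj/matrixP/(_ i j).
by rewrite !mxE mcoeff0.
Qed.

Lemma quad_derivative_surj_mpoly (R : 'M[{mpoly k[M]}]_n) :
  exists H, quad_derivative (C B) (C X) H = R.
Proof.
have surjZ a H : quad_derivative (C B) (C X) (a *: H) =
    a *: quad_derivative (C B) (C X) H.
  by rewrite /quad_derivative -!scalemxAr -!scalemxAl !scalerDr.
rewrite (matrix_sum_delta R); elim/big_rec: _ => [|i R1 _ [H1 <-]].
  by exists 0; rewrite /quad_derivative !mulmx0 !mul0mx !addr0.
have addE H H' : quad_derivative (C B) (C X) (H + H') =
    quad_derivative (C B) (C X) H + quad_derivative (C B) (C X) H'.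
  rewrite /quad_derivative !mulmxDr !mulmxDl.
  by rewrite [LHS](AC (2*2*2) ((1*3*5)*(2*4*6))).
suff [H2 <-] : exists H2, quad_derivative (C B) (C X) H2 =
    \sum_j R i j *: delta_mx i j by exists (H2 + H1).
elim/big_rec: _ => [|j R2 _ [H2 <-]].
  by exists 0; rewrite /quad_derivative !mulmx0 !mul0mx !addr0.
have [H DH] := quad_derivative_surj (delta_mx i j).
exists (R i j *: C H + H2); rewrite addE surjZ; congr (_ *: _ + _).
rewrite /quad_derivative -!map_mxM -!map_mxD -[_ + _]/(quad_derivative B X H) DH.
by rewrite map_delta_mx.
Qed.

End Nondegenerate.

(* Over the power series in [eta], the matrices [B0 + eta Y] and [C0 + eta Z] with
   [Y] and [Z] generic are again generic, and each nondegenerate solution for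
   [(B0, C0)] lifts uniquely. *)
Lemma specialization (n : nat) (K : fieldType) (q : {rmorphism rat -> K})
    (B C : 'M[K]_n) (L : closedFieldType) (iota : {rmorphism K -> L})
    (k : fieldType) (qk : {rmorphism rat -> k}) (B0 C0 : 'M[k]_n) (r : nat)
    (X0 : 'I_r -> 'M[k]_n) :
  generic_matrices q B C -> generated_by_entries q B C ->
  (forall i, quad_lhs B0 C0 (X0 i) = 0) ->
  (forall i H, quad_derivative B0 (X0 i) H = 0 -> H = 0) ->
  exists Y : 'I_r -> 'M[L]_n,
    [/\ forall i, quad_solution iota B C (Y i),
        injective X0 -> injective Y
      & forall (tau : {rmorphism k -> k}) (s : 'I_r -> 'I_r),
          map_mx tau B0 = B0 -> map_mx tau C0 = C0 ->
          (forall i, map_mx tau (X0 i) = X0 (s i)) ->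
          forall f : {mpoly K[r * (n * n)]},
            mmap iota (family_entries Y) f = 0 ->
            mmap iota (family_entries (Y \o s)) f = 0].
Proof.
move=> BC_generic K_generated sol0 nondeg.
pose M := (n * n + n * n)%N; pose A : idomainType := {mpoly k[M]}.
pose S : idomainType := fps A; pose P : fieldType := {fraction S}.
pose constA : {rmorphism k -> A} := @mpolyC M k.
pose pert (v : 'I_M) : {poly A} :=
  (constA (pair_entries B0 C0 v))%:P + 'X * ('X_v : A)%:P.
pose toS : {rmorphism {poly A} -> S} := @fps_of_poly A.
pose toP : {rmorphism S -> P} := @FracField.tofrac S.
pose toPA : {rmorphism rat -> {poly A}} := polyC \o constA \o qk.
pose B1 : 'M[S]_n := fst_matrix (toS \o pert).
pose C1 : 'M[S]_n := snd_matrix (toS \o pert).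
pose alpha : {rmorphism {mpoly rat[M]} -> K} := mmap q (pair_entries B C).
pose beta : {rmorphism {mpoly rat[M]} -> P} :=
  mmap (toP \o toS \o toPA) (toP \o toS \o pert).
have beta0 p : beta p = 0 -> p = 0.
  rewrite /beta /=; have -> : mmap (toP \o toS \o toPA) (toP \o toS \o pert) p
      = toP (toS (mmap toPA pert p)) by rewrite !rmorph_mmap.
  move/eqP; rewrite tofrac_eq0 => /eqP.
  rewrite -[RHS](rmorph0 toS) => /fps_of_poly_inj p0.
  (* Setting [eta = 1] and translating the indeterminates by the entries of [B0] and [C0] undoes the
     perturbation and gives back [p]. *)
  pose w (v : 'I_M) : A := 'X_v - constA (pair_entries B0 C0 v).
  pose eval1 : {rmorphism {poly A} -> A} := horner_eval (1 : A).
  pose shift : {rmorphism A -> A} := mmap constA w.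
  pose ev : {rmorphism {mpoly rat[M]} -> {poly A}} := mmap toPA pert.
  pose mapq : {rmorphism {mpoly rat[M]} -> A} := map_mpoly qk.
  have {}p0 : mapq p = 0.
    have <- : shift (eval1 (ev p)) = 0 by rewrite [ev p]p0 !rmorph0.
    apply: (mpoly_morph_ext (f := mapq) (g := shift \o (eval1 \o ev))) => [c|v].
      rewrite /= [LHS]map_mpolyC [X in eval1 X]mmapC /= /horner_eval hornerC.
      by rewrite [RHS]mmapC.
    rewrite /= [LHS]map_mpolyX [X in eval1 X]mmapX mmap1U /= /horner_eval !hornerE.
    rewrite rmorphD [X in X + _]mmapC [X in _ + X]mmapX mmap1U /w addrC subrK.
    by [].
  apply/mpolyP => u; apply: (fmorph_inj qk).
  by rewrite -mcoeff_map_mpoly [map_mpoly _ _]p0 !mcoeff0 rmorph0.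
have [kappa kappaE] := quotient_morphism (alpha := alpha) (beta := beta)
  (fun p p0 => etrans (congr1 beta (generic_mmap_eq0 BC_generic p0)) (rmorph0 beta))
  beta0 (generated_fraction K_generated).
have kappaBC v : kappa (pair_entries B C v) = toP (toS (pert v)).
  have := kappaE 'X_v; rewrite /alpha /beta /=.
  by rewrite mmapX mmap1U => ->; rewrite mmapX mmap1U.
have kappaB : map_mx kappa B = map_mx toP B1.
  rewrite -(fst_matrixK B C) !map_fst_matrix; apply: eq_fst_matrix => v /=.
  exact: kappaBC.
have kappaC : map_mx kappa C = map_mx toP C1.
  rewrite -(snd_matrixK B C) !map_snd_matrix; apply: eq_snd_matrix => v /=.
  exact: kappaBC.
have pert0 v : toS (pert v) 0%N = constA (pair_entries B0 C0 v).
  by rewrite /= /fps_of_poly coefD coefC coefXM addr0.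
have B10 : mx_coef 0 B1 = map_mx constA B0.
  rewrite -(fst_matrixK B0 C0) /mx_coef !map_fst_matrix; exact: eq_fst_matrix.
have C10 : mx_coef 0 C1 = map_mx constA C0.
  rewrite -(snd_matrixK B0 C0) /mx_coef !map_snd_matrix; exact: eq_snd_matrix.
have lift i : exists X : 'M[S]_n, quad_lhs B1 C1 X = 0 /\ mx_coef 0 X = map_mx constA (X0 i).
  apply: hensel; rewrite B10; last exact: quad_derivative_surj_mpoly (nondeg i).
  by rewrite C10 -map_quad_lhs sol0 map_mx0.
have {lift}[X1 X1P] := fin_all_exists lift.
pose x : 'I_(r * (n * n)) -> P := family_entries (fun i => map_mx toP (X1 i)).
have solP i : quad_lhs (map_mx kappa B) (map_mx kappa C) (map_mx toP (X1 i)) = 0.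
  by rewrite kappaB kappaC -map_quad_lhs (X1P i).1 map_mx0.
have alg_x v : algebraicOver kappa (x v).
  rewrite /x; case/mxvec_indexP: v => i w; case/mxvec_indexP: w => a b.
  rewrite /family_entries mxvecE mxE mxvecE.
  have [p p0 pP] := solution_entry_algebraic BC_generic a b.
  by exists p => //; apply: pP (solP i).
have charK : [pchar K] =i pred0.
  by move=> p; rewrite (fmorph_pchar q) pchar_num.
have [y xy] := conjugate_family charK iota alg_x.
have xE i : family_of_entries x i = map_mx toP (X1 i) := family_entriesK _ i.
pose V i : 'M[{mpoly K[r * (n * n)]}]_n := family_of_entries (fun v => 'X_v) i.
have evV (F : comNzRingType) (kF : {rmorphism K -> F}) z i :
    map_mx (mmap kF z) (V i) = family_of_entries z i.
  rewrite map_family_of_entries; apply/matrixP => a b; rewrite !mxE /=.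
  by rewrite mmapX mmap1U.
have yE : family_entries (family_of_entries y) =1 y := family_of_entriesK y.
exists (family_of_entries y); split=> [i|X0_inj i j Yij|tau s tauB tauC tauX f].
- pose E := quad_lhs (map_mx (@mpolyC _ K) B) (map_mx (@mpolyC _ K) C) (V i).
  have evE (F : comNzRingType) (kF : {rmorphism K -> F}) z :
      map_mx (mmap kF z) E = quad_lhs (map_mx kF B) (map_mx kF C) (family_of_entries z i).
    rewrite map_quad_lhs evV -!(map_mx_comp_eq (f := @mpolyC (r * (n * n)) K) (g := mmap kF z) (h := kF)) // => c;
      by rewrite mmapC.
  rewrite /quad_solution -evE; apply/matrixP => a b; rewrite !mxE; apply/xy.
  by have := evE _ kappa x; rewrite xE solP => /matrixP/(_ a b); rewrite !mxE.
- have XPij : map_mx toP (X1 i) = map_mx toP (X1 j).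
    rewrite -!xE; apply/matrixP => a b; apply/eqP; rewrite -subr_eq0 -!(evV _ kappa).
    rewrite ![map_mx _ _ _ _]mxE -rmorphB; apply/eqP/xy; rewrite rmorphB /=.
    have := congr1 (fun Z : 'M__ => Z a b) Yij; rewrite -!(evV _ iota) ![map_mx _ _ _ _]mxE => ->.
    by rewrite subrr.
  have X1ij : X1 i = X1 j.
    apply/matrixP => a b; move/matrixP/(_ a b): XPij.
    by rewrite !mxE => /eqP; rewrite tofrac_eq => /eqP.
  apply: X0_inj; apply/matrixP => a b; apply: (can_inj (@mpolyCK M k)).
  have := (X1P i).2; rewrite X1ij (X1P j).2 => /matrixP/(_ a b).
  by rewrite [LHS]mxE [RHS]mxE => ->.
(* [tau] acts on scalars and fixes [eta] and the indeterminates, hence the perturbed matrices and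
   the image of [K]. By uniqueness of the lifts, it permutes the [X1 i] as it permutes the
   [X0 i]. *)
pose tauS : {rmorphism S -> S} := fps_map (map_mpoly tau).
have tauS0 p : tauS p = 0 -> p = 0.
  move=> p0; apply: fpsP => i; rewrite fps0; apply/mpolyP => u; apply: (fmorph_inj tau).
  have := congr1 (fun g : fps A => (g i)@_u) p0.
  by rewrite /= /fps_map mcoeff_map_mpoly fps0 !mcoeff0 rmorph0.
have [tauP tauPE] := quotient_morphism (alpha := toP) (beta := toP \o tauS)
  (fun p p0 => etrans (congr1 (toP \o tauS) (elimT eqP (etrans (esym (tofrac_eq0 p)) (introT eqP p0)))) (rmorph0 _))
  (fun p p0 => tauS0 p (elimT eqP (etrans (esym (tofrac_eq0 _)) (introT eqP p0))))
  (@fraction_quotient S).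
have tauS_const c : tauS (toS (constA c)%:P) = toS (constA (tau c))%:P.
  apply: fpsP => i; rewrite /= /fps_map /fps_of_poly !coefC.
  by case: eqP => _; [apply: map_mpolyC | apply: raddf0].
have tauS_pert v : pair_entries (map_mx tau B0) (map_mx tau C0) v = pair_entries B0 C0 v ->
    tauS (toS (pert v)) = toS (pert v).
  rewrite -map_pair_entries => tau_v; rewrite /pert !rmorphD /= tauS_const tau_v.
  congr (_ + _); apply: fpsP => i; rewrite /= /fps_map /fps_of_poly coefXM coefC.
  by case: i => [|[|i]]; [apply: raddf0 | apply: map_mpolyX | apply: raddf0].
rewrite tauB tauC in tauS_pert.
have tauS1 w : (forall v, w v = toS (pert v)) -> forall v, tauS (w v) = w v.
  by move=> wE v; rewrite wE tauS_pert.
have tauB1 : map_mx tauS B1 = B1.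
  by rewrite map_fst_matrix; apply: eq_fst_matrix => v /=; apply: tauS_pert.
have tauC1 : map_mx tauS C1 = C1.
  by rewrite map_snd_matrix; apply: eq_snd_matrix => v /=; apply: tauS_pert.
have tauX1 i : map_mx tauS (X1 i) = X1 (s i).
  have coef_tau : mx_coef 0 (map_mx tauS (X1 i)) = map_mx constA (X0 (s i)).
    rewrite -tauX; move/matrixP: (X1P i).2 => E; apply/matrixP => a b.
    by have := E a b; rewrite !mxE /= /fps_map => ->; rewrite map_mpolyC.
  apply: (@hensel_unique _ _ B1 C1).
  - by rewrite -[in LHS]tauB1 -[in LHS]tauC1 -map_quad_lhs (X1P i).1 map_mx0.
  - exact: (X1P (s i)).1.
  - by rewrite coef_tau (X1P (s i)).2.
  rewrite B10 coef_tau; exact: quad_derivative_inj_mpoly (nondeg (s i)).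
have tau_kappa c : tauP (kappa c) = kappa c.
  have tau_beta p : tauP (beta p) = beta p.
    apply: (mpoly_morph_ext (f := tauP \o beta) (g := beta)) => [c0|v].
      rewrite /= [X in tauP X]mmapC [RHS]mmapC /= [LHS]tauPE /= tauS_const.
      by rewrite -[tau (qk c0)]/((tau \o qk) c0) !fmorph_eq_rat.
    rewrite /= [X in tauP X]mmapX [RHS]mmapX !mmap1U /= [LHS]tauPE /=.
    by rewrite tauS_pert.
  have [p [d [_ ->]]] := generated_fraction K_generated c.
  by rewrite !fmorph_div !kappaE !tau_beta.
have tau_x v : tauP (x v) = family_entries (fun i => map_mx toP (X1 (s i))) v.
  transitivity (family_entries (fun i => map_mx tauP (map_mx toP (X1 i))) v).
    exact: map_family_entries.
  apply: eq_family_entries => i.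
  apply/matrixP => a b; rewrite -tauX1 !mxE; exact: tauPE.
rewrite (eq_mmap (f := iota) (fun=> erefl) yE) => /xy/(congr1 tauP).
rewrite rmorph0 rmorph_mmap => xs0.
(* [fs] is [f] with its arguments permuted by [s], so that [xy], which concerns the original family,
   also governs the permuted one. *)
pose fs : {mpoly K[r * (n * n)]} := mmap (@mpolyC _ K) (family_entries (V \o s)) f.
have evfs (F : comNzRingType) (kF : {rmorphism K -> F}) z :
    mmap kF z fs = mmap kF (family_entries (family_of_entries z \o s)) f.
  rewrite mmap_comp; apply: eq_mmap => // v; rewrite (map_family_entries (mmap kF z)).
  by apply: eq_family_entries => i; rewrite /= evV.
rewrite -evfs; apply/xy; rewrite evfs -[RHS]xs0; apply: eq_mmap => [c|v] /=.
  by rewrite tau_kappa.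
by rewrite tau_x; apply: eq_family_entries => i; rewrite /= xE.
Qed.

(** * A quintic with symmetric Galois group *)

Definition quintic (R : nzRingType) : {poly R} :=
  Poly [:: 3%:R; 4%:R; - 4%:R; - 3%:R; 2%:R; 1].

Lemma map_quintic (R S : nzRingType) (f : {rmorphism R -> S}) :
  map_poly f (quintic R) = quintic S.
Proof.
apply/polyP => i; rewrite coef_map !coef_Poly.
by case: i => [|[|[|[|[|[|i]]]]]] /=;
  rewrite ?nth_nil ?rmorph0 ?rmorphN ?rmorph1 ?rmorph_nat.
Qed.

Lemma horner_quintic (R : comNzRingType) (x : R) :
  (quintic R).[x] = x ^+ 5 + 2 * x ^+ 4 - 3 * x ^+ 3 - 4 * x ^+ 2 + 4 * x + 3.
Proof. by rewrite horner_Poly /=; ring. Qed.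

Lemma size_quintic (R : nzRingType) : size (quintic R) = 6%N.
Proof. by rewrite (@PolyK _ 0) //= oner_eq0. Qed.

Lemma lead_coef_quintic (R : nzRingType) : lead_coef (quintic R) = 1.
Proof. by rewrite lead_coefE size_quintic coef_Poly. Qed.

Lemma quintic_neq0 (R : nzRingType) : quintic R != 0.
Proof. by rewrite -size_poly_eq0 size_quintic. Qed.

(** Modulo 2 the quintic is X^5 + X^3 + 1, without root. A factor of degree at most 2 is therefore 1
    or X^2 + X + 1, and division by the latter leaves the remainder X + 1. *)
Lemma quintic_F2_factor (d e : {poly 'F_2}) :
  d * e = quintic _ -> (size d <= 3)%N -> size d = 1%N.
Proof.
move=> de le_d3.
have F2 (a : 'F_2) : a = 0 \/ a = 1.
  by case: a => [[|[|m]] lt_m] //; [left | right]; apply: val_inj.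
have Dd : d = Poly [:: d`_0; d`_1; d`_2].
  apply/polyP => i; rewrite coef_Poly; case: i => [|[|[|i]]] //=.
  by rewrite nth_nil nth_default // (leq_trans le_d3).
have dx x : d.[x] != 0.
  apply/eqP => dx0; have /eqP := congr1 (horner^~ x) de.
  by rewrite hornerM dx0 mul0r horner_quintic; have [->|->] := F2 x.
have d0 : d`_0 = 1.
  have [d0|//] := F2 d`_0; case/eqP: (dx 0); by rewrite horner_coef0.
have d12 : d`_1 = d`_2.
  have : d.[1] = d`_2 + d`_1 + 1 by rewrite {1}Dd horner_Poly /= d0 !mulr1 ?mul0r ?add0r.
  move=> d1; have := dx 1; rewrite d1.
  by have [->|->] := F2 d`_2; have [->|->] := F2 d`_1.
have [d2|d2] := F2 d`_2.
  rewrite -[RHS](size_poly1 'F_2); congr (size (polyseq _)); apply/polyP => i.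
  rewrite Dd coef_Poly coef1 d12 d2 d0.
  by case: i => [|[|[|i]]]; rewrite /= ?nth_nil.
have d1 : d`_1 = 1 by rewrite d12.
have two0 : 2%:R = 0 :> {poly 'F_2} by rewrite -polyC_natr; congr _%:P; apply: val_inj.
have {}Dd : d = 'X^2 + 'X + 1.
  apply/polyP => i; rewrite Dd d2 d1 d0 coef_Poly !coefE.
  by case: i => [|[|[|i]]]; rewrite /= ?nth_nil; apply: val_inj.
have Dq : quintic 'F_2 = 'X^5 + 'X^3 + 1.
  apply/polyP => i; rewrite coef_Poly !coefE.
  by case: i => [|[|[|[|[|[|i]]]]]]; rewrite /= ?nth_nil; apply: val_inj.
have := congr1 (fun p => size (p - d * ('X^3 + 'X^2 + 'X))) de.
rewrite -mulrBr {2}Dd Dq.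
have -> : 'X^5 + 'X^3 + 1 - ('X^2 + 'X + 1) * ('X^3 + 'X^2 + 'X) = 'X + 1%:P :> {poly 'F_2}.
  apply/eqP; rewrite -subr_eq0; apply/eqP.
  transitivity (2%:R * (- 'X^4 - 'X^3 - 'X^2 - 'X) : {poly 'F_2}); first by rewrite polyC1; ring.
  by rewrite two0 mul0r.
have sd : size d = 3%N by rewrite Dd -addrA size_polyDl ?size_polyXn // size_XaddC.
have d_neq0 : d != 0 by rewrite -size_poly_eq0 sd.
rewrite size_XaddC; have [->|e_neq0] := eqVneq (e - ('X^3 + 'X^2 + 'X)) 0.
  by rewrite mulr0 size_poly0.
by rewrite size_mul // sd; move: e_neq0; rewrite -size_poly_gt0; case: size.
Qed.

(** By Gauss's lemma the factors can be taken integral; their leading coefficients are invertible,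
    so reduction modulo 2 keeps degrees, and one of the two has degree at most 2. *)
Lemma quintic_irreducible : irreducible_poly (quintic rat).
Proof.
split=> [|d size_d]; first by rewrite size_quintic.
rewrite -(map_quintic intr) => /dvdpP_rat_int[p [a a0 Dd] [r Dq]].
have lead_pr : lead_coef p * lead_coef r = 1.
  by rewrite -lead_coefM -Dq lead_coef_quintic.
have size2 (u : {poly int}) c : lead_coef u * c = 1 ->
    size (map_poly intr u : {poly 'F_2}) = size u.
  move=> uc; rewrite size_map_poly_id0 //; apply: contraTneq isT => u0.
  have := congr1 (intmul (1 : 'F_2)) uc; rewrite rmorphM /= u0 mul0r => /esym/eqP.
  by rewrite oner_eq0.
have sp := size2 p _ lead_pr; have sr := size2 r _ (etrans (mulrC _ _) lead_pr).
have prF2 : map_poly intr p * map_poly intr r = quintic 'F_2.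
  by rewrite -rmorphM -Dq /= map_quintic.
have [p0 r0] : p != 0 /\ r != 0.
  by apply/norP; rewrite -mulf_eq0 -Dq quintic_neq0.
have size_pr : (size p + size r).-1 = 6%N by rewrite -size_mul // -Dq size_quintic.
have [le_p|lt_p] := leqP (size p) 3.
  have := quintic_F2_factor prF2; rewrite sp => /(_ le_p) p1.
  by rewrite Dd size_scale // size_rat_int_poly p1 in size_d.
have := quintic_F2_factor (etrans (mulrC _ _) prF2); rewrite sr => r1.
have /size_poly1P[c c0 Dr] : size r == 1%N by apply/eqP/r1; lia.
rewrite Dd Dq Dr rmorphM /= map_polyC /= mulrC mul_polyC.
by rewrite (eqp_trans (eqp_scale _ a0)) // eqp_sym eqp_scale // intr_eq0.
Qed.

Section Transpositions.

Variables (T : finType) (G : {group {perm T}}).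

Lemma tperm_trans x y z : tperm x y \in G -> tperm y z \in G -> tperm x z \in G.
Proof.
have [->|ne_xz] := eqVneq x z; first by rewrite tperm1.
have [-> //|ne_yz] := eqVneq y z.
move=> Gxy Gyz; have := groupJ Gxy Gyz; rewrite tpermJ tpermL.
by have [->|ne_xy] := eqVneq x y; rewrite ?tpermL ?tpermD // 1?eq_sym.
Qed.

Lemma tpermsT : (forall x y, tperm x y \in G) -> G = [set: {perm T}] :> {set _}.
Proof.
move=> Gt; apply/setP => s; rewrite inE; have [ts -> _] := prod_tpermP s.
by rewrite group_prod // => t _; apply: Gt.
Qed.

(** Being equal or exchanged by a transposition of [G] is an equivalence. [G] permutes its classes
    transitively, so they have the same size, which divides a prime and exceeds 1. *)
Lemma prime_transitive_tperm a b : prime #|T| -> a != b -> tperm a b \in G ->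
  (forall x y, exists2 s, s \in G & s x = y) -> G = [set: {perm T}] :> {set _}.
Proof.
move=> pr_T ne_ab Gab trG; apply: tpermsT.
pose R := [rel x y | tperm x y \in G].
have eqR : {in [set: T] & &, equivalence_rel R}.
  move=> x y z _ _ _ /=; rewrite tperm1 group1; split=> // Rxy.
  by apply/idP/idP; apply: tperm_trans; rewrite // tpermC.
pose P := equivalence_partition R [set: T].
have partP : partition P [set: T] := equivalence_partitionP eqR.
pose cl x := [set y | R x y].
have clP A : A \in P -> exists x, A = cl x.
  by case/imsetP=> x _ ->; exists x; apply/setP => y; rewrite !inE.
have clJ s x : s \in G -> cl (s x) = s @: cl x.
  move=> Gs; apply/setP => y; rewrite inE; apply/idP/imsetP => [Rxy|[z]].
    exists (s^-1%g y); last by rewrite permKV.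
    by rewrite inE /R /= -(groupJr _ Gs) tpermJ permKV.
  by rewrite inE => Rxz ->; rewrite /R /= -tpermJ groupJr.
have card_cl A : A \in P -> #|A| = #|cl a|.
  case/clP=> x ->; have [s Gs <-] := trG a x.
  by rewrite clJ // card_imset //; apply: perm_inj.
have := card_uniform_partition card_cl partP; rewrite cardsT => DT.
have cl_gt1 : (1 < #|cl a|)%N.
  rewrite (cardD1 a) (cardD1 b) !inE /R /= tperm1 group1 Gab.
  by rewrite eq_sym ne_ab.
have cl_T : #|cl a| = #|T|.
  by apply/eqP; move/primeP: pr_T => [_ /(_ #|cl a|)]; rewrite DT dvdn_mull // gtn_eqF // => /(_ isT).
have clT : cl a = [set: T] by apply/eqP; rewrite eqEcard subsetT cardsT -cl_T leqnn.
have Ra x : tperm a x \in G by have := in_setT x; rewrite -clT inE.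
by move=> x y; apply: (tperm_trans (y := a)); rewrite // tpermC.
Qed.

End Transpositions.

(* Laguerre's inequality: [f'(1) ^ 2 - f(1) f''(1)] would be a sum of squares. *)
Lemma quintic_not_real (a : 'I_5 -> algC) :
  quintic algC = \prod_i ('X - (a i)%:P) -> ~ (forall i, a i \is Num.real).
Proof.
move=> Dq a_real.
(* The point 1 is a local minimum with positive value 3, which no polynomial with only real roots
   has; the expression is [0 - 3 * 18]. *)
have D1 : (quintic algC)^`().[1] = 0.
  have -> : (quintic algC)^`() = Poly [:: 4%:R; - 8%:R; - 9%:R; 8%:R; 5%:R].
    apply/polyP => i; rewrite coef_deriv !coef_Poly.
    by case: i => [|[|[|[|[|i]]]]] /=; rewrite ?nth_nil ?mul0rn //; ring.
  by rewrite horner_Poly /=; ring.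
have D2 : (quintic algC)^`()^`().[1] = 18%:R.
  have -> : (quintic algC)^`()^`() = Poly [:: - 8%:R; - 18%:R; 24%:R; 20%:R].
    apply/polyP => i; rewrite !coef_deriv !coef_Poly.
    by case: i => [|[|[|[|i]]]] /=; rewrite ?nth_nil ?mul0rn //; ring.
  by rewrite horner_Poly /=; ring.
have D0 : (quintic algC).[1] = 3%:R by rewrite horner_quintic; ring.
have : (quintic algC)^`().[1] ^+ 2 - (quintic algC).[1] * (quintic algC)^`()^`().[1]
    = - 54%:R by rewrite D0 D1 D2; ring.
rewrite Dq !big_ord_recl big_ord0 mulr1.
set b0 := a _; set b1 := a _; set b2 := a _; set b3 := a _; set b4 := a _.
rewrite !derivE !hornerE => sumsq.
pose c0 := 1 - b0; pose c1 := 1 - b1; pose c2 := 1 - b2; pose c3 := 1 - b3; pose c4 := 1 - b4.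
have : (c1 * c2 * c3 * c4) ^+ 2 + (c0 * c2 * c3 * c4) ^+ 2 + (c0 * c1 * c3 * c4) ^+ 2
  + (c0 * c1 * c2 * c4) ^+ 2 + (c0 * c1 * c2 * c3) ^+ 2 = - 54%:R.
  by rewrite -sumsq /= /c0 /c1 /c2 /c3 /c4; ring.
have sq_ge0 (x y z t : algC) : x \is Num.real -> y \is Num.real -> z \is Num.real ->
    t \is Num.real -> 0 <= (x * y * z * t) ^+ 2.
  move=> xr yr zr tr; apply: real_exprn_even_ge0 => //.
  exact: realM (realM (realM xr yr) zr) tr.
have c_real i : 1 - a i \is Num.real by rewrite realB ?real1.
move=> neg; have : 0 <= - 54%:R :> algC.
  by rewrite -neg; do ?[apply: addr_ge0]; apply: sq_ge0; apply: c_real.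
by rewrite oppr_ge0 lern0.
Qed.

Lemma quintic_separable : separable_poly (quintic rat).
Proof.
have irr := quintic_irreducible; rewrite separable_poly.unlock /coprimep.
apply: contraT => gcd1; have := irr.2 _ gcd1 (dvdp_gcdl _ _).
move/eqp_dvdl => dv; have : quintic rat %| (quintic rat)^`() by rewrite -dv dvdp_gcdr.
move/dvdp_leq => le_q; have : (size (quintic rat)^`() = 5)%N.
  have -> : (quintic rat)^`() = Poly [:: 4%:R; - 8%:R; - 9%:R; 8%:R; 5%:R].
    apply/polyP => i; rewrite coef_deriv !coef_Poly.
    by case: i => [|[|[|[|[|i]]]]] //=; rewrite ?nth_nil ?mul0rn.
  by rewrite (@PolyK _ 0).
move=> sz; have := le_q; rewrite -size_poly_gt0 sz size_quintic.
by move/(_ isT).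
Qed.

(* Complex conjugation permutes the five roots.  It moves some root, and it does
   not move four: the quintic would then have the sign of [x - z], where [z] is
   the fixed root, but it is positive at [-2] and negative at [-1]. *)
Lemma conj_tperm (a : 'I_5 -> algC) (c : {perm 'I_5}) :
  quintic algC = \prod_i ('X - (a i)%:P) -> injective a ->
  (forall i, (a i)^* = a (c i)) ->
  exists2 i, c i != i & c = tperm i (c i).
Proof.
move=> Dq a_inj ca.
have cK i : c (c i) = i by apply: a_inj; rewrite -!ca conjCK.
have [i ci] : exists i, c i != i.
  apply/existsP; apply: contra_notT (quintic_not_real Dq) => /existsPn fixc i.
  by apply/CrealP; rewrite ca; move: (fixc i); rewrite negbK => /eqP->.
exists i => //; apply/permP => j; case: tpermP => [-> //|-> //|ne_ji ne_jci].
apply/eqP/contraT => cj; pose S := [:: i; c i; j; c j].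
have uS : uniq S.
  rewrite /= !inE !negb_or (eq_sym i (c i)) ci (eq_sym i j) (introN eqP ne_ji).
  rewrite (eq_sym (c i) j) (introN eqP ne_jci) (eq_sym j (c j)) cj !andbT /=.
  rewrite (inj_eq perm_inj) (eq_sym i j) (introN eqP ne_ji) andbT.
  by rewrite -(inj_eq (@perm_inj _ c)) cK (introN eqP (nesym ne_jci)).
have [z zS] : exists z, z \notin S.
  apply/existsP; apply: contraT => /existsPn allS.
  have : (#|'I_5| <= #|S|)%N by apply: subset_leq_card; apply/subsetP => z _; apply/negPn/allS.
  by rewrite card_ord (card_uniqP uS).
have cz : c z = z.
  apply/eqP/contraT => cz; have : uniq (c z :: z :: S).
    rewrite cons_uniq [uniq (_ :: _)]cons_uniq uS zS inE negb_or cz !andbT /=.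
    apply: contra zS; rewrite !inE => /or4P[] /eqP cze; rewrite -[z]cK cze ?cK eqxx ?orbT //.
  by move/card_uniqP => cardU; have := max_card (mem (c z :: z :: S)); rewrite cardU card_ord.
have az_real : a z \is Num.real by apply/CrealP; rewrite ca cz.
have prodE x : (quintic algC).[x] = (x - a z) *
    ((x - a i) * (x - a (c i)) * ((x - a j) * (x - a (c j)))).
  rewrite Dq; have -> : \prod_i ('X - (a i)%:P) = \prod_(k <- z :: S) ('X - (a k)%:P).
    rewrite [LHS](perm_big (z :: S)) //= uniq_perm ?index_enum_uniq //.
      by rewrite cons_uniq zS.
    move=> k; rewrite mem_index_enum; symmetry.
    have uzS : uniq (z :: S) by rewrite cons_uniq zS.
    have /subset_cardP/elimT -> // : #|z :: S| = #|'I_5|.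
      by rewrite card_ord (card_uniqP uzS).
    exact/subsetP.
  rewrite horner_prod !big_cons big_nil !hornerXsubC; ring.
have pair_ge0 x k : x \is Num.real -> 0 <= (x - a k) * (x - a (c k)).
  by move=> xr; rewrite -ca -{2}(conj_Creal xr) -rmorphB -normCK exprn_ge0.
have real2 : - 2%:R \is @Num.real algC by rewrite realN realn.
have real1 : - 1 \is @Num.real algC by rewrite realN real1.
have lt_z2 : a z < - 2%:R.
  rewrite real_ltNge //; apply/negP => le_2z.
  have : (quintic algC).[- 2%:R] <= 0.
    rewrite prodE; apply: mulr_le0_ge0; first by rewrite subr_le0.
    by apply: mulr_ge0; apply: pair_ge0.
  rewrite horner_quintic; have -> : (- 2%:R) ^+ 5 + 2 * (- 2%:R) ^+ 4 - 3 * (- 2%:R) ^+ 3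
    - 4 * (- 2%:R) ^+ 2 + 4 * (- 2%:R) + 3 = 3%:R :> algC by ring.
  by rewrite lern0.
have : 0 <= (quintic algC).[- 1].
  rewrite prodE; apply: mulr_ge0; last by apply: mulr_ge0; apply: pair_ge0.
  by rewrite subr_ge0 (le_trans (ltW lt_z2)) // lerN2 ler1n.
rewrite horner_quintic; have -> : (- 1) ^+ 5 + 2 * (- 1) ^+ 4 - 3 * (- 1) ^+ 3
  - 4 * (- 1) ^+ 2 + 4 * (- 1) + 3 = - 1 :> algC by ring.
by rewrite oppr_ge0 ler10.
Qed.

Lemma quintic_symmetric : exists (N : splittingFieldType rat) (r : 'I_5 -> N),
  [/\ injective r, forall i, root (quintic N) (r i)
    & forall s : {perm 'I_5}, exists tau : {rmorphism N -> N},
        forall i, tau (r i) = r (s i)].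
Proof.
have charQ : [pchar rat] =i pred0 := pchar_num _.
pose iota : {rmorphism rat -> algC} := ratr.
have [N [j [jQ _ jroot]]] := splitting_field_in_closed iota charQ (quintic_neq0 _).
have [zs Dq] := closed_field_poly_normal (quintic algC).
rewrite lead_coef_quintic scale1r in Dq.
have szs : size zs = 5%N.
  by have := congr1 (fun p : {poly _} => size p) Dq; rewrite size_quintic size_prod_XsubC => -[].
have uzs : uniq zs.
  by rewrite -separable_prod_XsubC -Dq -(map_quintic iota) separable_map quintic_separable.
pose a (i : 'I_5) := zs`_i.
have a_inj : injective a.
  by move=> i k /eqP; rewrite nth_uniq ?szs // => /eqP/val_inj.
have Da : quintic algC = \prod_i ('X - (a i)%:P) by rewrite Dq (big_nth 0) szs big_mkord.
have root_zs z : root (quintic algC) z = (z \in zs) by rewrite Dq root_prod_XsubC.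
have root_a i : root (quintic algC) (a i) by rewrite root_zs mem_nth ?szs.
have ex_r i : exists y, j y = a i by apply: jroot; rewrite map_quintic.
have [r jr] := fin_all_exists ex_r.
have r_inj : injective r by move=> i k rik; apply: a_inj; rewrite -!jr rik.
have jQ' : forall c : rat, (j \o in_alg N) c = iota c by move=> c; apply: jQ.
have root_r i : root (quintic N) (r i).
  by rewrite -(fmorph_root j) map_quintic jr.
have rootP z : root (quintic N) z -> exists i, z = r i.
  rewrite -(fmorph_root j) map_quintic root_zs => /(nthP 0)[i lt_i zi].
  rewrite szs in lt_i; exists (Ordinal lt_i); apply: (fmorph_inj j).
  by rewrite jr -zi.
exists N, r; split=> //.
pose H := [set s : {perm 'I_5} | [exists g in 'Gal({:N} / 1%AS)%g, [forall i, g (r i) == r (s i)]]].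
have HP (s : {perm 'I_5}) : reflect (exists2 g, g \in 'Gal({:N} / 1%AS)%g & forall i, g (r i) = r (s i)) (s \in H).
  rewrite inE; apply: (iffP exists_inP) => -[g Gg].
    by move/forallP=> gs; exists g => // i; apply/eqP/gs.
  by move=> gs; exists g => //; apply/forallP => i; apply/eqP/gs.
have H_group : group_set H.
  apply/group_setP; split=> [|s t /HP[g Gg gs] /HP[h Gh ht]]; apply/HP.
    by exists 1%g => [|i]; rewrite ?group1 // gal_id perm1.
  by exists (g * h)%g => [|i]; rewrite ?groupM // galM ?memvf // gs ht permM.
have gal_perm g : g \in 'Gal({:N} / 1%AS)%g -> exists s : {perm 'I_5}, forall i, g (r i) = r (s i).
  move=> Gg; have ex_s i : exists k, g (r i) = r k.
    by apply: rootP; rewrite -(map_quintic g) fmorph_root.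
  have [s gs] := fin_all_exists ex_s.
  have s_inj : injective s.
    by move=> i k sik; have := congr1 r sik; rewrite -!gs => /fmorph_inj/r_inj.
  by exists (perm s_inj) => i; rewrite permE.
have trH i k : exists2 s, s \in H & s i = k.
  have [f|g Gg gik] := @gal_conjugate_family rat N 1 (fun=> r i) (fun=> r k) charQ.
     have irr := quintic_irreducible.
    pose p := mmap (@polyC rat) (fun=> 'X) f.
    have pE z : mmap (in_alg N) (fun=> z) f = (map_poly (in_alg N) p).[z].
      rewrite horner_mmap; apply: eq_mmap => // l.
      by rewrite map_polyX hornerX.
    rewrite !pE => /eqP; rewrite -/(root _ _).
    rewrite (irreducible_root_dvdp _ irr) ?map_quintic // => dv.
    by apply/eqP; rewrite -/(root _ _) (irreducible_root_dvdp _ irr) ?map_quintic.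
  have [s gs] := gal_perm g Gg.
  exists s; first by apply/HP; exists g.
  by apply: r_inj; rewrite -gs (gik ord0).
have [c ac] : exists c : {perm 'I_5}, forall i, (a i)^* = a (c i).
  have ex_c i : exists k, (a i)^* = a k.
    have : root (quintic algC) (a i)^*.
      by rewrite -(map_quintic Num.conj) fmorph_root.
    rewrite root_zs => /(nthP 0)[l lt_l <-]; rewrite szs in lt_l.
    by exists (Ordinal lt_l).
  have [c ac] := fin_all_exists ex_c.
  have c_inj : injective c.
    by move=> i k cik; apply: a_inj; apply: (fmorph_inj Num.conj); rewrite /= !ac cik.
  by exists (perm c_inj) => i; rewrite permE.
(* Complex conjugation acts on [algC], not on [N]; but it preserves the rational relations between
   the roots, and so does some Galois automorphism of [N] inducing the same permutation. *)
have cH : c \in H.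
  apply/HP; have [f|g Gg gr] := @gal_conjugate_family rat N 5 r (r \o c) charQ; last by exists g.
  move=> /(congr1 (Num.conj \o j)); rewrite /= !rmorph0 rmorph_mmap rmorph_mmap => f0.
  apply: (fmorph_inj j); rewrite rmorph0 -[RHS]f0 rmorph_mmap; apply: eq_mmap => [b|i] /=.
    by rewrite -[j _]/((j \o in_alg N) b) -[RHS]/((Num.conj \o j \o in_alg N) b) !fmorph_eq_rat.
  by rewrite !jr -ac.
have [i ci Dc] := conj_tperm Da a_inj ac.
have HT : Group H_group = [set: {perm 'I_5}] :> {set _}.
  apply: (@prime_transitive_tperm _ (Group H_group) i (c i)) => //.
  - by rewrite card_ord.
  - by rewrite eq_sym.
  by rewrite -Dc.
move=> s; have : s \in Group H_group by rewrite HT inE.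
by case/HP=> g _ gs; exists (GRing.RMorphism.clone N N (fun x => g x) _).
Qed.

(** * The special equation *)

Definition mx2 (R : Type) (a b c d : R) : 'M[R]_2 :=
  \matrix_(i, j) if i == 0 then if j == 0 then a else b
                 else if j == 0 then c else d.

Lemma mx2P (R : Type) (X Y : 'M[R]_2) :
  X 0 0 = Y 0 0 -> X 0 1 = Y 0 1 -> X 1 0 = Y 1 0 -> X 1 1 = Y 1 1 -> X = Y.
Proof.
have I2 (i : 'I_2) : i = 0 \/ i = 1.
  by case: i => [[|[|i]] lt_i] //; [left | right]; apply: val_inj.
by move=> *; apply/matrixP => i j; have [->|->] := I2 i; have [->|->] := I2 j.
Qed.

Lemma mulmx2E (R : pzSemiRingType) (X Y : 'M[R]_2) i j :
  (X *m Y) i j = X i 0 * Y 0 j + X i 1 * Y 1 j.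
Proof.
rewrite mxE !big_ord_recl big_ord0 addr0.
by rewrite (_ : lift ord0 ord0 = 1) //; apply: val_inj.
Qed.

Lemma mx2_00 (R : Type) (a b c d : R) : mx2 a b c d 0 0 = a.
Proof. by rewrite mxE. Qed.
Lemma mx2_01 (R : Type) (a b c d : R) : mx2 a b c d 0 1 = b.
Proof. by rewrite mxE. Qed.
Lemma mx2_10 (R : Type) (a b c d : R) : mx2 a b c d 1 0 = c.
Proof. by rewrite mxE. Qed.
Lemma mx2_11 (R : Type) (a b c d : R) : mx2 a b c d 1 1 = d.
Proof. by rewrite mxE. Qed.
Definition mx2E := (mx2_00, mx2_01, mx2_10, mx2_11).

Lemma map_mx2 (R S : Type) (f : R -> S) (a b c d : R) :
  map_mx f (mx2 a b c d) = mx2 (f a) (f b) (f c) (f d).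
Proof. by apply: mx2P; rewrite mxE !mx2E. Qed.

Lemma quad2E (R : comNzRingType) (B C X : 'M[R]_2) i j :
  quad_lhs B C X i j = X i 0 * X 0 j + X i 1 * X 1 j +
    ((B i 0 * X 0 0 + B i 1 * X 1 0) * B 0 j +
     (B i 0 * X 0 1 + B i 1 * X 1 1) * B 1 j) + C i j.
Proof. by rewrite /quad_lhs 2!mxE !mulmx2E. Qed.

Lemma quad_derivative2E (R : comNzRingType) (B X H : 'M[R]_2) i j :
  quad_derivative B X H i j = X i 0 * H 0 j + X i 1 * H 1 j +
    (H i 0 * X 0 j + H i 1 * X 1 j) +
    ((B i 0 * H 0 0 + B i 1 * H 1 0) * B 0 j +
     (B i 0 * H 0 1 + B i 1 * H 1 1) * B 1 j).
Proof. by rewrite /quad_derivative 2!mxE !mulmx2E. Qed.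

Section SpecialEquation.

Variable k : fieldType.
Hypothesis chark : [pchar k] =i pred0.

Let nat_neq0 n : n.+1%:R != 0 :> k.
Proof. by rewrite (pcharf0P _).1. Qed.

(* For these matrices the traces of the solutions are the roots of
   [t * quintic], and the solution of trace [t] is [special_X t]. *)
Definition special_B : 'M[k]_2 := mx2 1 0 0 (- 1).
Definition special_C : 'M[k]_2 := mx2 0 (1 / 4) (3 / 4) (- (1 / 2)).
Definition special_X (t : k) : 'M[k]_2 :=
  mx2 (t / 2 - 1 / (4 * (t + 1))) (- (1 / (4 * (t - 1))))
      (- (3 / (4 * (t - 1)))) (t / 2 + 1 / (4 * (t + 1))).

Definition special_root (t : k) := t * (quintic k).[t] = 0.

Section Root.

Variable t : k.
Hypothesis t_root : special_root t.

Let t_eq : t * (t ^+ 5 + 2 * t ^+ 4 - 3 * t ^+ 3 - 4 * t ^+ 2 + 4 * t + 3) = 0.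
Proof. by rewrite -horner_quintic. Qed.

Let tm_neq0 : t - 1 != 0.
Proof.
apply: contra_eq_neq t_eq => /eqP; rewrite subr_eq0 => /eqP->.
rewrite (_ : _ * _ = 3%:R) ?nat_neq0 //; ring.
Qed.

Let tp_neq0 : t + 1 != 0.
Proof.
apply: contra_eq_neq t_eq => /eqP; rewrite addr_eq0 => /eqP->.
rewrite (_ : _ * _ = 1%:R) ?nat_neq0 //; ring.
Qed.

Lemma special_X_solution : quad_lhs special_B special_C (special_X t) = 0.
Proof.
have n2 := nat_neq0 1; have n4 := nat_neq0 3.
have tt_neq0 : t ^+ 2 - 1 != 0.
  by rewrite (_ : _ - 1 = (t - 1) * (t + 1)) ?mulf_neq0 //; ring.
(* Both diagonal equations reduce to this one, the only place where the equation of [t] enters; the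
   off-diagonal ones hold identically. *)
have E : (t / 2 - 1 / (4 * (t + 1))) ^+ 2 + 3 / (4 * (t - 1)) * (1 / (4 * (t - 1)))
    + (t / 2 - 1 / (4 * (t + 1))) = 0.
  transitivity (t * (t ^+ 5 + 2 * t ^+ 4 - 3 * t ^+ 3 - 4 * t ^+ 2 + 4 * t + 3)
    / (4 * (t ^+ 2 - 1) ^+ 2)); last by rewrite t_eq mul0r.
  by field; do ?[apply/andP; split] => //.
apply: mx2P; rewrite [RHS]mxE quad2E !mx2E.
- by rewrite -[RHS]E; ring.
- by field; do ?[apply/andP; split] => //.
- by field; do ?[apply/andP; split] => //.
transitivity ((t / 2 - 1 / (4 * (t + 1))) ^+ 2 + 3 / (4 * (t - 1)) * (1 / (4 * (t - 1)))
    + (t / 2 - 1 / (4 * (t + 1)))); last exact: E.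
by field; do ?[apply/andP; split] => //.
Qed.

(** The off-diagonal equations express [b] and [c] by the trace [m] of [H]; eliminating them from
    the diagonal ones leaves [K * m = 0], where the numerator of [K] is the polynomial of
    [J_neq0]. *)
Lemma special_X_nondegenerate H : quad_derivative special_B (special_X t) H = 0 -> H = 0.
Proof.
move=> dH0.
have n2 := nat_neq0 1; have n4 := nat_neq0 3.
pose x := t / 2 - 1 / (4 * (t + 1)); pose y := t / 2 + 1 / (4 * (t + 1)).
pose z := - (1 / (4 * (t - 1))); pose w := - (3 / (4 * (t - 1))).
have dE i j := quad_derivative2E special_B (special_X t) H i j.
have := (dE 0 0, dE 0 1, dE 1 0, dE 1 1); rewrite dH0 !mxE /= -/x -/y -/z -/w.
set a := H 0 0; set b := H 0 1; set c := H 1 0; set e := H 1 1.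
case=> [[[E00 E01] E10] E11].
have J_neq0 : 4 * (t - 1) ^+ 3 * (t + 1) ^+ 4 - (t - 1) ^+ 3 - 3 * (t + 1) ^+ 3 != 0.
  have := t_eq => /eqP; rewrite mulf_eq0 => /orP[/eqP t0|/eqP q0].
    rewrite t0 (_ : _ - _ = - 6%:R); last by ring.
    by rewrite oppr_eq0 nat_neq0.
  apply: contraTneq isT => J0.
  (* A Bezout identity between this numerator and the quintic. The constant is 23934, split into
     small numerals since naturals are unary. *)
  have [u [v E]] : exists u v, 154 * 155 + 64 =
      u * (4 * (t - 1) ^+ 3 * (t + 1) ^+ 4 - (t - 1) ^+ 3 - 3 * (t + 1) ^+ 3) +
      v * (t ^+ 5 + 2 * t ^+ 4 - 3 * t ^+ 3 - 4 * t ^+ 2 + 4 * t + 3).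
    exists (1232 * t ^+ 4 + 2159 * t ^+ 3 - 4428 * t ^+ 2 - 3508 * t + 6716).
    exists (- 4928 * t ^+ 6 - 3708 * t ^+ 5 + 16492 * t ^+ 4 + 8616 * t ^+ 3
      - 12792 * t ^+ 2 + 256 * t + 21410).
    ring.
  have N_neq0 : 154 * 155 + 64 != 0 :> k.
    by rewrite -natrM -natrD (pcharf0P _).1 // addn_eq0 andbF.
  by case/eqP: N_neq0; apply: etrans E _; rewrite J0 q0 !mulr0 addr0.
pose m := a + e.
have xy : x + y = t by rewrite /x /y; field; do ?[apply/andP; split].
have Db : (t - 1) * b + z * m = 0 by rewrite [RHS]E01 -xy /m; ring.
have Dc : (t - 1) * c + w * m = 0 by rewrite [RHS]E10 -xy /m; ring.
have Da : (2 * x + 1) * a + (z * c + w * b) = 0 by rewrite [RHS]E00; ring.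
have De : (2 * y + 1) * e + (z * c + w * b) = 0 by rewrite [RHS]E11; ring.
have m0 : m = 0.
  pose K := (t - 1) * (2 * x + 1) * (2 * y + 1) - 4 * z * w * (t + 1).
  have DK : K = (4 * (t - 1) ^+ 3 * (t + 1) ^+ 4 - (t - 1) ^+ 3 - 3 * (t + 1) ^+ 3)
      / (4 * (t + 1) ^+ 2 * (t - 1) ^+ 2).
    by rewrite /K /x /y /z /w; field; do ?[apply/andP; split].
  have K_neq0 : K != 0 by rewrite DK mulf_neq0 ?invr_neq0 ?mulf_neq0 ?expf_neq0.
  have Km : K * m = 0.
    transitivity ((t - 1) * (2 * y + 1) * ((2 * x + 1) * a + (z * c + w * b))
      + (t - 1) * (2 * x + 1) * ((2 * y + 1) * e + (z * c + w * b))
      - 2 * (x + y + 1) * (z * ((t - 1) * c + w * m) + w * ((t - 1) * b + z * m))).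
      by rewrite /K -xy /m; ring.
    by rewrite Da De Db Dc !mulr0 !addr0 mulr0 subr0.
  by move/eqP: Km; rewrite mulf_eq0 (negPf K_neq0) => /eqP.
move: Db Dc; rewrite m0 !mulr0 !addr0 => /eqP; rewrite mulf_eq0 (negPf tm_neq0) => /eqP b0.
move/eqP; rewrite mulf_eq0 (negPf tm_neq0) => /eqP c0.
have a0 : a = 0.
  have : 2 * (t + 1) * a = 0.
    transitivity ((2 * x + 1) * a + (z * c + w * b) - ((2 * y + 1) * e + (z * c + w * b))
      + (2 * y + 1) * m); first by rewrite -xy /m; ring.
    by rewrite Da De m0 mulr0 subr0 addr0.
  by move/eqP; rewrite !mulf_eq0 (negPf n2) (negPf tp_neq0) => /eqP.
apply: mx2P; rewrite ?mxE //.
by move: m0; rewrite /m a0 add0r.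
Qed.

(** In the nondegeneracy of the block solutions, the off-diagonal blocks of [H] are multiplied by
    [special_X t + 1], on the left or on the right. *)
Lemma special_X_add1_unit : (quintic k).[t] = 0 ->
  special_X t + 1%:M \in unitmx.
Proof.
rewrite horner_quintic => q0; have n2 := nat_neq0 1; have n4 := nat_neq0 3.
pose x := t / 2 - 1 / (4 * (t + 1)); pose y := t / 2 + 1 / (4 * (t + 1)).
pose z := - (1 / (4 * (t - 1))); pose w := - (3 / (4 * (t - 1))).
have D_neq0 : 2 * t ^+ 2 + 6 * t + 3 != 0.
  apply: contraTneq isT => D0.
  (* A Bezout identity with the quintic: [2 t^2 + 6 t + 3] is four times the determinant of
     [special_X t + 1]. *)
  have E : 3%:R = (4 * t ^+ 4 + 8 * t ^+ 3 - 18 * t ^+ 2 - 10 * t + 25) *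
      (2 * t ^+ 2 + 6 * t + 3) + (- 8 * t - 24) *
      (t ^+ 5 + 2 * t ^+ 4 - 3 * t ^+ 3 - 4 * t ^+ 2 + 4 * t + 3) :> k by ring.
  by have := nat_neq0 2; rewrite E D0 q0 !mulr0 addr0 eqxx.
have D : (x + 1) * (y + 1) - z * w = (2 * t ^+ 2 + 6 * t + 3) / 4.
  transitivity ((2 * t ^+ 2 + 6 * t + 3) / 4 - t * (t ^+ 5 + 2 * t ^+ 4 - 3 * t ^+ 3 - 4 * t ^+ 2 + 4 * t + 3)
    / (4 * (t - 1) ^+ 2 * (t + 1) ^+ 2)); last by rewrite q0 mulr0 mul0r subr0.
  by rewrite /x /y /z /w; field; do ?[apply/andP; split].
have det_neq0 : (x + 1) * (y + 1) - z * w != 0 by rewrite D mulf_neq0 ?invr_neq0.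
suff /mulmx1_unit[] : (special_X t + 1%:M) *m
    (((x + 1) * (y + 1) - z * w)^-1 *: mx2 (y + 1) (- z) (- w) (x + 1)) = 1%:M by [].
rewrite -scalemxAr (_ : _ *m _ = ((x + 1) * (y + 1) - z * w)%:M).
  by rewrite scale_scalar_mx mulVf.
apply: mx2P; rewrite mulmx2E !mxE /= -/x -/y -/z -/w ?mulr1n ?mulr0n; ring.
Qed.

Lemma special_X_trace : \tr (special_X t) = t.
Proof.
rewrite /mxtrace !big_ord_recl big_ord0 addr0 (_ : lift ord0 ord0 = 1); last exact: val_inj.
rewrite !mx2E; field.
by have := nat_neq0 1; have := nat_neq0 3; do ?[move=> ?]; do ?[apply/andP; split].
Qed.

End Root.

End SpecialEquation.

Lemma map_special_B (k k' : fieldType) (f : {rmorphism k -> k'}) :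
  map_mx f (special_B k) = special_B k'.
Proof. by rewrite map_mx2 rmorphN rmorph1 rmorph0. Qed.

Lemma map_special_C (k k' : fieldType) (f : {rmorphism k -> k'}) :
  map_mx f (special_C k) = special_C k'.
Proof. by rewrite map_mx2 rmorphN !fmorph_div rmorph0 rmorph1 !rmorph_nat. Qed.

Lemma map_special_X (k k' : fieldType) (f : {rmorphism k -> k'}) t :
  map_mx f (special_X t) = special_X (f t).
Proof.
by rewrite map_mx2 !rmorphN !(rmorphD, rmorphB) !rmorphN !fmorph_div !rmorphM !(rmorphD, rmorphB) !rmorphN ?rmorph1 ?rmorph_nat.
Qed.

(** * Radicals *)

Section Block.

Variables (k : fieldType) (m : nat).
Hypothesis chark : [pchar k] =i pred0.

(** In the added block the equation is [Y^2 = 1], solved by [Y = 1], where the derivative is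
    multiplication by 2. *)
Definition block_B : 'M[k]_(2 + m) := block_mx (special_B k) 0 0 0.
Definition block_C : 'M[k]_(2 + m) := block_mx (special_C k) 0 0 (- 1%:M).
Definition block_X (t : k) : 'M[k]_(2 + m) := block_mx (special_X t) 0 0 1%:M.

Lemma block_X_solution t : special_root t -> quad_lhs block_B block_C (block_X t) = 0.
Proof.
move/(special_X_solution chark) => sol; rewrite /quad_lhs !mulmx_block.
rewrite !mulmx0 !mul0mx !addr0 !add0r mulmx1 !add_block_mx !addr0.
rewrite -[RHS]block_mx0; congr block_mx; first exact: sol.
  by rewrite mul0mx addr0.
exact: addrN.
Qed.

Lemma block_X_nondegenerate t H : (quintic k).[t] = 0 ->
  quad_derivative block_B (block_X t) H = 0 -> H = 0.
Proof.
move=> qt0; have rt : special_root t by rewrite /special_root qt0 mulr0.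
have u1 := special_X_add1_unit chark rt qt0.
rewrite -[H]submxK /quad_derivative; set H1 := ulsubmx H; set H2 := ursubmx H.
set H3 := dlsubmx H; set H4 := drsubmx H.
rewrite !mulmx_block !mulmx0 !mul0mx !addr0 !add0r mulmx1 mul1mx !add_block_mx !addr0.
rewrite -[RHS]block_mx0 => /eq_block_mx[E1 E2 E3 E4].
have -> : H1 = 0 by apply: (special_X_nondegenerate chark rt).
have -> : H2 = 0.
  by rewrite -[H2](mulKmx u1) mulmxDl mul1mx E2 mulmx0.
have -> : H3 = 0.
  by rewrite mul0mx addr0 in E3; rewrite -[H3](mulmxK u1) mulmxDr mulmx1 addrC E3 mul0mx.
have -> : H4 = 0.
  have two : 2%:R != 0 :> k by rewrite (pcharf0P _).1.
  apply: (scalerI two); rewrite scaler0 scaler_nat mulr2n.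
  by rewrite -[RHS]E4 mul1mx mulmx1.
exact: block_mx0.
Qed.

Lemma block_X_inj t t' : block_X t = block_X t' -> special_root t -> special_root t' -> t = t'.
Proof.
move=> /(congr1 ulsubmx); rewrite !block_mxKul => E rt rt'.
by rewrite -(special_X_trace chark rt) E special_X_trace.
Qed.

End Block.

Lemma map_block_B (k k' : fieldType) m (f : {rmorphism k -> k'}) :
  map_mx f (block_B k m) = block_B k' m.
Proof. by rewrite map_block_mx map_special_B !map_mx0. Qed.

Lemma map_block_C (k k' : fieldType) m (f : {rmorphism k -> k'}) :
  map_mx f (block_C k m) = block_C k' m.
Proof. by rewrite map_block_mx map_special_C !map_mx0 map_mxN map_mx1. Qed.

Lemma map_block_X (k k' : fieldType) m (f : {rmorphism k -> k'}) t :
  map_mx f (block_X m t) = block_X m (f t).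
Proof. by rewrite map_block_mx map_special_X !map_mx0 map_mx1. Qed.

Section RadicalObstruction.

Variables (K : fieldType) (L : closedFieldType) (iota : {rmorphism K -> L}).
Variables (N : splittingFieldType K) (j : {rmorphism N -> L}).
Hypothesis jK : forall a : K, j a%:A = iota a.

Local Notation G := ('Gal({:N} / 1%AS))%g.

(** A tower of radicals is measured by the derived subgroup of one fixed Galois group that acts
    trivially on it, so that roots of unity need not be adjoined. *)
Definition fixed_preimage (k : nat) (x : L) :=
  exists2 y : N, j y = x & forall g, g \in (G^`(k))%g -> g y = y.

Lemma fixed_preimageS k l x : (k <= l)%N -> fixed_preimage k x -> fixed_preimage l x.
Proof.
move=> /subnKC <-; elim: (l - k)%N => [|d IHd]; rewrite ?addn0 // => /IHd[y jy fix_y].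
by exists y => // g; rewrite addnS => /(subsetP (der_subS _ _)); apply: fix_y.
Qed.

Lemma fixed_preimage_adjoin k (A : L -> Prop) x :
  (forall a, A a -> fixed_preimage k a) -> adjoin iota A x -> fixed_preimage k x.
Proof.
move=> fixA; elim=> [a|a /fixA //|u v _ [u' <- fu] _ [v' <- fv]|u v _ [u' <- fu] _ [v' <- fv]].
- by exists a%:A => // g _; rewrite rmorph_alg.
- by exists (u' - v') => [|g Dg]; rewrite rmorphB //= fu // fv.
by exists (u' / v') => [|g Dg]; rewrite fmorph_div //= fu // fv.
Qed.

Lemma commutators_fix (H : {group gal_of {:N}}) (z : N) :
  (forall g h, g \in H -> h \in H -> h (g z) = g (h z)) ->
  forall g, g \in [~: H, H]%g -> g z = z.
Proof.
move=> Hz g; pose F := [set g : gal_of {:N} | g z == z].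
have F_group : group_set F.
  apply/group_setP; split=> [|g1 g2]; rewrite !inE ?gal_id //.
  by move=> /eqP g1z /eqP g2z; rewrite galM ?memvf // g1z g2z.
have galVK (h : gal_of {:N}) x : h ((h^-1)%g x) = x.
  by rewrite -galM ?memvf // mulVg gal_id.
suff /subsetP sF : ([~: H, H] \subset Group F_group)%g.
  by move/sF; rewrite inE => /eqP.
rewrite gen_subG; apply/subsetP => _ /imset2P[g1 g2 Hg1 Hg2 ->].
rewrite inE; apply/eqP; rewrite /commg /conjg !mulgA !galM ?memvf //.
by rewrite Hz ?groupV // !galVK.
Qed.

(* Automorphisms commute on the roots of unity; commutators of commutators then
   fix every radical of a fixed element. *)
Lemma fixed_radical k m (y : N) : (0 < m)%N ->
  (forall g, g \in (G^`(k))%g -> g (y ^+ m) = y ^+ m) ->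
  forall g, g \in (G^`(k.+2))%g -> g y = y.
Proof.
move=> m_gt0 fix_ym; have [-> g _|y_neq0] := eqVneq y 0; first exact: rmorph0.
have unity_fixed (z : N) : z ^+ m = 1 -> forall g, g \in (G^`(k.+1))%g -> g z = z.
  move=> zm; apply: (@commutators_fix (G^`(k))%G) => g h _ _.
  have [d /prim_expr_order zd _] := prim_order_exists m_gt0 zm.
  have [d' prim_z _] := prim_order_exists m_gt0 zm.
  have pow (f : gal_of {:N}) : exists i, f z = z ^+ i.
    have /(prim_rootP prim_z)[i ->] : f z ^+ d' = 1.
      by rewrite -rmorphXn prim_expr_order // rmorph1.
    by exists i.
  have [a ga] := pow g; have [b hb] := pow h.
  by rewrite ga hb !rmorphXn /= ga hb -!exprM mulnC.
apply: (@commutators_fix (G^`(k.+1))%G) => g h Dg Dh.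
have Du f : f \in (G^`(k.+1))%g -> exists2 w, f y = w * y & w ^+ m = 1.
  move=> Df; exists (f y / y); first by rewrite divfK.
  have := fix_ym f (subsetP (der_subS _ _) _ Df); rewrite rmorphXn /= => fym.
  by rewrite expr_div_n fym divff // expf_neq0.
have [v gy gv] := Du g Dg; have [w hy hw] := Du h Dh.
rewrite gy hy !rmorphM /= (unity_fixed _ gv h Dh) (unity_fixed _ hw g Dg) gy hy.
by rewrite mulrCA.
Qed.

(** Each radical costs two derivations of the group, one for the roots of unity and one for the
    radical itself. *)
Lemma fixed_radical_sequence (a : seq L) :
  (forall x, x \in a -> exists y, j y = x) -> radical_sequence iota a ->
  forall x, adjoin iota (fun x => x \in a) x -> fixed_preimage (2 * size a) x.
Proof.
move=> pre_a rad_a.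
suff fix_take i : (i <= size a)%N -> forall x, x \in take i a -> fixed_preimage (2 * i) x.
  by move=> x; apply: fixed_preimage_adjoin => y; rewrite -{1}(take_size a); apply: fix_take.
elim: i => [|i IHi] lt_ia x; first by rewrite take0.
rewrite (take_nth 0 lt_ia) mem_rcons inE => /predU1P[->|/(IHi (ltnW lt_ia))]; last first.
  by apply: fixed_preimageS; rewrite leq_mul2l leqW.
have [m [m_gt0 /(fixed_preimage_adjoin (IHi (ltnW lt_ia)))[z jz fix_z]]] := rad_a i lt_ia.
have [y jy] := pre_a _ (mem_nth 0 lt_ia).
have Dz : z = y ^+ m by apply: (fmorph_inj j); rewrite rmorphXn /= jy jz.
by exists y => //; rewrite mulnS add2n; apply: (fixed_radical m_gt0); rewrite -Dz.
Qed.

End RadicalObstruction.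

Section SymmetricAction.

Variables (T : finType) (gT : finGroupType) (G : {group gT}) (act : gT -> {perm T} -> Prop).
Hypothesis act1 : act 1%g 1%g.
Hypothesis actM : forall g h s t, act g s -> act h t -> act (g * h)%g (s * t)%g.
Hypothesis actV : forall g s, act g s -> act g^-1%g s^-1%g.

(** [act] is a relation and not a morphism, because an element of [G] may send one of the five
    solutions outside of the five and then induces no permutation of them. *)
Lemma der_act k : (forall s, exists2 g, g \in G & act g s) ->
  forall s, s \in ([set: {perm T}]^`(k))%g -> exists2 g, g \in (G^`(k))%g & act g s.
Proof.
move=> full; elim: k => [|k IHk] s; first by rewrite derg0 => _; apply: full.
pose F := [set s : {perm T} | boolp.asbool (exists2 g, g \in (G^`(k.+1))%g & act g s)].
have FP t : reflect (exists2 g, g \in (G^`(k.+1))%g & act g t) (t \in F).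
  by rewrite inE; apply: boolp.asboolP.
have F_group : group_set F.
  apply/group_setP; split=> [|s1 s2 /FP[g1 Gg1 a1] /FP[g2 Gg2 a2]]; apply/FP.
    by exists 1%g; first exact: group1.
  by exists (g1 * g2)%g; [exact: groupM | exact: actM].
move=> Ds; apply/FP; apply: (subsetP _ _ Ds : s \in Group F_group).
rewrite dergSn gen_subG; apply/subsetP => _ /imset2P[s1 s2 Ds1 Ds2 ->].
have [g1 Gg1 a1] := IHk s1 Ds1; have [g2 Gg2 a2] := IHk s2 Ds2.
apply/FP; exists [~ g1, g2]%g; first by rewrite dergSn mem_commg.
by rewrite /commg /conjg; do ?[apply: actM | apply: actV].
Qed.

End SymmetricAction.

Lemma algebraic_family_annihilator (K F : fieldType) (kappa : {rmorphism K -> F})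
    (s : seq F) : (forall x, x \in s -> algebraicOver kappa x) ->
  exists2 p : {poly K}, p != 0 & forall x, x \in s -> root (map_poly kappa p) x.
Proof.
elim: s => [|x s IHs] alg_s; first by exists 1; rewrite ?oner_eq0.
have [p p0 ps] := IHs (fun y ys => alg_s y (mem_behead (s := x :: s) ys)).
have [q q0 qx] := alg_s x (mem_head x s).
exists (q * p) => [|y]; first by rewrite mulf_neq0.
rewrite inE rmorphM rootM => /predU1P[->|/ps ->]; by rewrite ?qx ?orbT.
Qed.

Lemma symmetric_not_radical (n : nat) (K : fieldType) (L : closedFieldType)
    (iota : {rmorphism K -> L}) (Y : 'I_5 -> 'M[L]_n) :
  [pchar K] =i pred0 -> is_algebraic_closure iota -> injective Y ->
  (forall (s : {perm 'I_5}) (f : {mpoly K[5 * (n * n)]}),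
     mmap iota (family_entries Y) f = 0 -> mmap iota (family_entries (Y \o s)) f = 0) ->
  ~ (forall i, entries_by_radicals iota (Y i)).
Proof.
move=> charK L_closure Y_inj relY radY.
have [a aP] := fin_all_exists radY.
pose E := flatten [seq a i | i <- enum 'I_5] ++ codom (family_entries Y).
(* [p] annihilates all the entries and all the radicals involved, so that its splitting field
   contains them and is normal. *)
have [p p_neq0 rootE] := @algebraic_family_annihilator _ _ iota E (fun x _ => L_closure x).
have [N [j [jK _ pre]]] := splitting_field_in_closed iota charK p_neq0.
have preE x : x \in E -> exists y, j y = x by move/rootE; apply: pre.
have pre_a i x : x \in a i -> exists y, j y = x.
  move=> xa; apply: preE; rewrite mem_cat; apply/orP; left.
  by apply/flatten_mapP; exists i; rewrite ?mem_enum.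
have pre_Y v : exists y, j y = family_entries Y v.
  by apply: preE; rewrite mem_cat codom_f orbT.
have [y jy] := fin_all_exists pre_Y.
pose V : 'I_5 -> 'M[N]_n := family_of_entries y.
have jV i : map_mx j (V i) = Y i.
  rewrite /V map_family_of_entries -[RHS](family_entriesK Y).
  by apply/matrixP => b c; rewrite !mxE /= jy.
have V_inj : injective V by move=> i l Vil; apply: Y_inj; rewrite -!jV Vil.
pose G := ('Gal({:N} / 1%AS))%G.
pose act (g : gal_of {:N}) (s : {perm 'I_5}) := forall i, map_mx g (V i) = V (s i).
have act1 : act 1%g 1%g.
  by move=> i; apply/matrixP => b c; rewrite mxE gal_id perm1.
have actM g h s t : act g s -> act h t -> act (g * h)%g (s * t)%g.
  move=> gs ht i; rewrite permM -ht -gs; apply/matrixP => b c.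
  by rewrite !mxE galM ?memvf.
have actV g s : act g s -> act g^-1%g s^-1%g.
  move=> gs i; rewrite -{1}(permKV s i) -gs; apply/matrixP => b c.
  by rewrite !mxE -galM ?memvf // mulgV gal_id.
have full s : exists2 g, g \in G & act g s.
  have [f|g Gg gV] := @gal_conjugate_family K N _ (family_entries V) (family_entries (V \o s)) charK.
    have jf W : j (mmap (in_alg N) (family_entries W) f) =
        mmap iota (family_entries (fun i => map_mx j (W i))) f.
      rewrite rmorph_mmap; apply: eq_mmap => [c|v] /=; first exact: jK.
      exact: map_family_entries.
    have eqY W W' : W =1 W' -> mmap iota (family_entries W) f = mmap iota (family_entries W') f.
      by move=> WW'; apply: eq_mmap => //; apply: eq_family_entries.
    move=> /(congr1 j); rewrite rmorph0 jf (eqY _ Y) // => /(relY s) f0.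
    apply: (fmorph_inj j); rewrite rmorph0 jf (eqY _ (Y \o s)) // => i.
    by rewrite /= jV.
  exists g => // i; rewrite -[RHS](family_entriesK (V \o s)) -{1}(family_entriesK V).
  rewrite map_family_of_entries; apply/matrixP => b c; rewrite !mxE /=.
  exact: gV.
(* This depth suffices for the five solutions at once: the k-th derived subgroup of [G] fixes them
   all, so that of S_5 is trivial, against its non-solvability. *)
pose k := (2 * \sum_i size (a i))%N.
have fixV i g : g \in (G^`(k))%g -> map_mx g (V i) = V i.
  move=> Dg; apply/matrixP => b c; rewrite mxE.
  have [rad_a /(_ b c) adj_a] := aP i.
  have le_k : (2 * size (a i) <= k)%N.
    by rewrite leq_mul2l (bigD1 i) //= leq_addr.
  have fix_bc := fixed_preimageS le_k (fixed_radical_sequence jK (pre_a i) rad_a adj_a).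
  have [z jz fix_z] := fix_bc; have -> : V i b c = z.
    by apply: (fmorph_inj j); rewrite jz -jV [RHS]mxE.
  exact: fix_z.
have : ~~ solvable [set: {perm 'I_5}] by rewrite -[setT]/('Sym_('I_5))%g solvable_SymF ?card_ord.
case/negP; apply/derivedP; exists k; apply/trivgP/subsetP => s Ds; rewrite inE.
have [g Dg gs] := der_act act1 actM actV full Ds.
apply/eqP/permP => i; rewrite perm1; apply: V_inj.
by rewrite -gs fixV.
Qed.

Lemma large_quadratic_not_solvable (m : nat) (K : fieldType) (q : {rmorphism rat -> K})
    (B C : 'M[K]_(2 + m)) (L : closedFieldType) (iota : {rmorphism K -> L}) :
  generic_matrices q B C -> generated_by_entries q B C -> is_algebraic_closure iota ->
  finitely_many_solutions (quad_solution iota B C) /\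
  non_solvable_equation iota (quad_solution iota B C).
Proof.
move=> BC_generic K_generated L_closure.
have finS : finitely_many_solutions (quad_solution iota B C) := finite_solutions BC_generic iota.
split=> //.
have [N [r [r_inj r_root rP]]] := quintic_symmetric.
have charN : [pchar N] =i pred0.
  by move=> p; rewrite (fmorph_pchar (in_alg N)) pchar_num.
have charK : [pchar K] =i pred0 by move=> p; rewrite (fmorph_pchar q) pchar_num.
have q0 i : (quintic N).[r i] = 0 by apply/eqP/r_root.
have sr i : special_root (r i) by rewrite /special_root q0 mulr0.
have [Y [solY injY relY]] := @specialization _ _ q B C L iota N (in_alg N)
  (block_B N m) (block_C N m) 5 (fun i => block_X m (r i)) BC_generic K_generated
  (fun i => block_X_solution m charN (sr i))
  (fun i H => block_X_nondegenerate charN (q0 i)).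
have {}injY : injective Y.
  by apply: injY => i l /(block_X_inj charN)-/(_ (sr i) (sr l))/r_inj.
have nrad : ~ (forall i, entries_by_radicals iota (Y i)).
  apply: (symmetric_not_radical charK L_closure injY) => s f.
  have [tau tau_r] := rP s.
  apply: (relY tau s) => [||i]; rewrite ?map_block_B ?map_block_C //.
  by rewrite map_block_X tau_r.
split; last by case=> _ rad; apply: nrad => i; apply: rad.
have [nu nuP] := finS; exists nu; split=> //.
have [s [_ <- sP]] := nuP; rewrite -has_predT; apply/hasP; exists (Y ord0) => //.
exact/sP.
Qed.

(** * The ideal of the equation *)

Section IdealOfEntries.

Variables (R : comNzRingType) (n : nat) (E : 'M[R]_n).

Lemma ideal_of_entries0 : ideal_of_entries E 0.
Proof.
by exists 0; rewrite big1 // => i _; rewrite big1 // => j _; rewrite mxE mul0r.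
Qed.

Lemma ideal_of_entriesD f g :
  ideal_of_entries E f -> ideal_of_entries E g -> ideal_of_entries E (f + g).
Proof.
move=> [a ->] [b ->]; exists (a + b); rewrite -big_split; apply: eq_bigr => i _.
by rewrite -big_split; apply: eq_bigr => j _; rewrite mxE mulrDl.
Qed.

Lemma ideal_of_entriesM h f : ideal_of_entries E f -> ideal_of_entries E (h * f).
Proof.
move=> [a ->]; exists (h *: a); rewrite mulr_sumr; apply: eq_bigr => i _.
by rewrite mulr_sumr; apply: eq_bigr => j _; rewrite mxE mulrA.
Qed.

Lemma ideal_of_entriesB f g :
  ideal_of_entries E f -> ideal_of_entries E g -> ideal_of_entries E (f - g).
Proof.
move=> Ef Eg; rewrite -[- g]mulN1r.
by apply: ideal_of_entriesD => //; apply: ideal_of_entriesM.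
Qed.

Lemma ideal_of_entries_entry i j : ideal_of_entries E (E i j).
Proof.
exists (delta_mx i j); rewrite (bigD1 i) //= (bigD1 j) //= mxE !eqxx mul1r.
rewrite big1 => [|l ne_lj]; last by rewrite mxE (negPf ne_lj) andbF mul0r.
rewrite addr0 big1 ?addr0 // => k ne_ki; rewrite big1 // => l _.
by rewrite mxE (negPf ne_ki) mul0r.
Qed.

Lemma ideal_of_entries_mmap (m : nat) (S : comNzRingType) (phi : {rmorphism S -> R})
    (u v : 'I_m -> R) (p : {mpoly S[m]}) :
  (forall i, ideal_of_entries E (u i - v i)) ->
  ideal_of_entries E (mmap phi u p - mmap phi v p).
Proof.
move=> uv.
have mulP a b c d : ideal_of_entries E (a - b) -> ideal_of_entries E (c - d) ->
    ideal_of_entries E (a * c - b * d).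
  move=> ab cd; rewrite (_ : _ - _ = c * (a - b) + b * (c - d)); last by ring.
  by apply: ideal_of_entriesD; apply: ideal_of_entriesM.
have prodP I (r : seq I) (a b : I -> R) : (forall i, ideal_of_entries E (a i - b i)) ->
    ideal_of_entries E (\prod_(i <- r) a i - \prod_(i <- r) b i).
  move=> ab; elim/big_rec2: _ => [|i x y _ IH]; last exact: mulP.
  by rewrite subrr; apply: ideal_of_entries0.
rewrite -sumrB; elim/big_rec: _ => [|w x _ Ex]; first exact: ideal_of_entries0.
apply: ideal_of_entriesD => //; rewrite -mulrBr; apply: ideal_of_entriesM.
apply: prodP => i; elim: (w i) => [|d IHd]; last by rewrite !exprS; apply: mulP.
by rewrite subrr; apply: ideal_of_entries0.
Qed.

End IdealOfEntries.

Lemma map_unknowns (n : nat) (K F : fieldType) (kappa : {rmorphism K -> F}) (X : 'M[F]_n) :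
  map_mx (mmap kappa (fun v => mxvec X 0 v)) (\matrix_(i, j) unknown K i j) = X.
Proof. by apply/matrixP => i j; rewrite 2!mxE mmapX mmap1U mxvecE. Qed.

Lemma quad_ideal_vanishes (n : nat) (K F : fieldType) (B C : 'M[K]_n)
    (kappa : {rmorphism K -> F}) (X : 'M[F]_n) (f : {mpoly K[n * n]}) :
  quad_lhs (map_mx kappa B) (map_mx kappa C) X = 0 ->
  ideal_of_entries (quad_system B C) f -> mmap kappa (fun v => mxvec X 0 v) f = 0.
Proof.
move=> X_sol [a ->]; pose cst : {rmorphism K -> {mpoly K[n * n]}} := @mpolyC (n * n) K.
pose evX : {rmorphism {mpoly K[n * n]} -> F} := mmap kappa (fun v => mxvec X 0 v).
have map_cst (M : 'M[K]_n) : map_mx evX (map_mx cst M) = map_mx kappa M.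
  by apply: map_mx_comp_eq => c; apply: mmapC.
have evE : map_mx evX (quad_system B C) = 0.
  rewrite [LHS](map_quad_lhs evX (map_mx cst B) (map_mx cst C)) !map_cst.
  by rewrite [map_mx evX _]map_unknowns.
rewrite -[LHS]/(evX _) rmorph_sum big1 // => i _; rewrite rmorph_sum big1 // => j _.
rewrite rmorphM (_ : evX (quad_system B C i j) = (map_mx evX (quad_system B C)) i j).
  by rewrite evE mxE mulr0.
by rewrite [RHS]mxE.
Qed.

(* The ideal of the equation is maximal: up to a nonzero element of K, every
   polynomial is congruent to a polynomial over Q in the entries of B and X,
   and these are algebraically independent when X is a solution. *)
Lemma vanishing_ideal_of_entries (n : nat) (K : fieldType) (q : {rmorphism rat -> K})
    (B C : 'M[K]_n) (F : fieldType) (kappa : {rmorphism K -> F}) (X : 'M[F]_n)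
    (f : {mpoly K[n * n]}) :
  generic_matrices q B C -> generated_by_entries q B C ->
  quad_lhs (map_mx kappa B) (map_mx kappa C) X = 0 ->
  mmap kappa (fun v => mxvec X 0 v) f = 0 ->
  ideal_of_entries (quad_system B C) f.
Proof.
move=> BC_generic K_generated X_sol fX0.
pose A : comNzRingType := {mpoly K[n * n]}.
pose cst : {rmorphism K -> A} := @mpolyC (n * n) K.
pose E := quad_system B C; pose I := ideal_of_entries E.
pose U : 'M[A]_n := \matrix_(i, j) unknown K i j.
pose BA := map_mx cst B; pose CA := map_mx cst C.
pose phi : {rmorphism {mpoly rat[n * n + n * n]} -> A} := mmap (cst \o q) (pair_entries BA U).
pose ev := mmap q (pair_entries B C).
(* [elim_C] substitutes [-(X^2 + BXB)] for [C], which changes nothing modulo the ideal: this is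
   [ev_phi]. *)
pose elim_C p := mmap (@mpolyC (n * n + n * n) rat) (pair_entries (genB n) (genC n)) p.
have phi_elim p : phi (elim_C p) = mmap (cst \o q) (pair_entries BA (quad_constant BA U)) p.
  rewrite [LHS]mmap_comp; apply: eq_mmap => // v.
  by rewrite [LHS]map_pair_entries map_genB map_genC.
have ev_phi p : I ((ev p)%:MP - phi (elim_C p)).
  rewrite phi_elim -[(ev p)%:MP]/(cst (ev p)) rmorph_mmap.
  have -> : mmap (cst \o q) (cst \o pair_entries B C) p = mmap (cst \o q) (pair_entries BA CA) p.
    by apply: eq_mmap => // v; rewrite [LHS]map_pair_entries.
  apply: ideal_of_entries_mmap => v; rewrite /pair_entries !mxE.
  case: (split v) => w; first by rewrite subrr; apply: ideal_of_entries0.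
  case/mxvec_indexP: w => i j; rewrite !mxvecE.
  rewrite (_ : _ - _ = E i j); first exact: ideal_of_entries_entry.
  by rewrite [RHS]mxE [X in _ - X]mxE opprK addrC.
have transP (a b g h : A) : I (a - b) -> I (a * g - h) -> I (b * g - h).
  move=> ab agh; rewrite (_ : _ - _ = (a * g - h) - g * (a - b)); last by ring.
  by apply: ideal_of_entriesB => //; apply: ideal_of_entriesM.
have addP (a b g h x y : A) : I (a * g - x) -> I (b * h - y) ->
    I (a * b * (g + h) - (b * x + a * y)).
  move=> ag bh; rewrite (_ : _ - _ = b * (a * g - x) + a * (b * h - y)); last by ring.
  by apply: ideal_of_entriesD; apply: ideal_of_entriesM.
have mulP (a b g h x y : A) : I (a * g - x) -> I (b * h - y) ->
    I (a * b * (g * h) - x * y).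
  move=> ag bh; rewrite (_ : _ - _ = b * h * (a * g - x) + x * (b * h - y)); last by ring.
  by apply: ideal_of_entriesD; apply: ideal_of_entriesM.
(* [D] is a common denominator of the coefficients of [g], which are fractions in the entries of [B]
   and [C]; [G] involves [B] and the unknowns only. *)
pose good (g : A) := exists D G, ev D != 0 /\ I ((ev D)%:MP * g - phi G).
have evM D1 D2 : ev (D1 * D2) = ev D1 * ev D2 by rewrite /ev rmorphM.
have goodD g h : good g -> good h -> good (g + h).
  move=> [D1 [G1 [D10 DG1]]] [D2 [G2 [D20 DG2]]].
  exists (D1 * D2), (elim_C D2 * G1 + elim_C D1 * G2); split; first by rewrite evM mulf_neq0.
  rewrite evM mpolyCM rmorphD !rmorphM /=.
  have E1 := transP _ _ _ _ (ev_phi D1) DG1; have E2 := transP _ _ _ _ (ev_phi D2) DG2.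
  apply: transP (addP _ _ _ _ _ _ E1 E2).
  rewrite -opprB -mulN1r; apply: ideal_of_entriesM.
  rewrite -[X in X - _]mulr1 -[1]mulr1; apply: mulP; rewrite mulr1; exact: ev_phi.
have goodM g h : good g -> good h -> good (g * h).
  move=> [D1 [G1 [D10 DG1]]] [D2 [G2 [D20 DG2]]].
  exists (D1 * D2), (G1 * G2); split; first by rewrite evM mulf_neq0.
  by rewrite evM mpolyCM rmorphM; apply: mulP.
have goodC c : good c%:MP.
  have [p [r [r0 ->]]] := generated_fraction K_generated c.
  exists r, (elim_C p); split=> //; rewrite -mpolyCM mulrCA divff // mulr1; exact: ev_phi.
have good1 : good 1 by rewrite -mpolyC1.
have goodX v : good 'X_v.
  case/mxvec_indexP: v => i j; exists 1, 'X_(rshift _ (mxvec_index i j)).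
  split; first by rewrite /ev rmorph1 oner_neq0.
  rewrite /ev rmorph1 mpolyC1 mul1r (_ : phi _ = 'X_(mxvec_index i j)).
    by rewrite subrr; apply: ideal_of_entries0.
  by rewrite [LHS]mmapX mmap1U pair_entries_snd mxE.
have goodXn v d : good ('X_v ^+ d).
  by elim: d => [|d IHd]; rewrite ?expr0 // exprS; apply: goodM.
have goodXm (m : 'X_{1..n * n}) : good 'X_[m].
  by rewrite mpolyXE_id; apply: (big_ind good).
have good_f : good f.
  rewrite [f]mpolyE; apply: (big_ind good) => [|//|m _]; first by rewrite -mpolyC0.
  by rewrite -mul_mpolyC; apply: goodM.
pose evX : {rmorphism A -> F} := mmap kappa (fun v => mxvec X 0 v).
have evX_ideal g : I g -> evX g = 0 by apply: quad_ideal_vanishes.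
have [D [G [D0 DG]]] := good_f.
(* [G] vanishes at a solution, so it is the zero polynomial by genericity; the multiple of [f] by
   [ev D], a nonzero element of [K], is then in the ideal. *)
have G0 : G = 0.
  apply: (solution_generic BC_generic X_sol).
  have := evX_ideal _ DG; rewrite rmorphB rmorphM /= [evX f]fX0 mulr0 sub0r => /eqP.
  rewrite oppr_eq0 => /eqP; rewrite rmorph_mmap => pX0; rewrite -[RHS]pX0.
  apply: eq_mmap => [a|v] /=; first by rewrite [RHS]mmapC.
  rewrite [RHS]map_pair_entries [map_mx evX U]map_unknowns.
  by congr (pair_entries _ _ v); apply/esym; apply: map_mx_comp_eq => c; apply: mmapC.
move: DG; rewrite G0 rmorph0 subr0 => If.
rewrite -[f]mul1r -mpolyC1 -(mulVf D0) mpolyCM -mulrA.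
exact: ideal_of_entriesM.
Qed.

(** * Traces of the solutions in dimension two *)

Lemma trmx2E (R : nzRingType) (X : 'M[R]_2) : \tr X = X 0 0 + X 1 1.
Proof.
rewrite /mxtrace !big_ord_recl big_ord0 addr0.
by rewrite (_ : lift ord0 ord0 = 1) //; apply: val_inj.
Qed.

Lemma detmx2E (R : comNzRingType) (X : 'M[R]_2) : \det X = X 0 0 * X 1 1 - X 0 1 * X 1 0.
Proof.
rewrite (expand_det_row _ 0) !big_ord_recl big_ord0 addr0 /cofactor !det_mx11 !mxE /=.
rewrite expr0 expr1 mul1r mulN1r mulrN.
by congr (X _ _ * X _ _ - X _ _ * X _ _); apply: val_inj.
Qed.

(* [t = \tr X] of a solution [X] determines first [a = \tr (B X)], then [\det X],
   and then [X], by Cayley-Hamilton for [X] and for [X + B]; the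
   determinant of [(t + \det B) X] gives an equation for [t]. *)
Section TraceEquation.

Variable R : comNzRingType.
Variables (B C X : 'M[R]_2).
Hypothesis X_sol : quad_lhs B C X = 0.

Let t := \tr X.
Let a := \tr (B *m X).

(** This is the trace of [B *m B]. *)
Definition trace_offset (B : 'M[R]_2) := \tr B ^+ 2 - 2 * \det B.
(** When 2 is invertible, this is twice the trace of the product of the traceless parts of [B] and
    [C]. *)
Definition mixed_trace (B C : 'M[R]_2) := 2 * \tr (B *m C) - \tr B * \tr C.

(** The right side minus the left side of [trace_equation], times [4 (2 t + s)^2] to clear the
    denominators of [\det X] and of [a]. [D] is the discriminant of the characteristic polynomial of
    [C]. *)
Definition trace_poly (B C : 'M[R]_2) : {poly R} :=
  let T := \tr B in let e := \det B in let o := \tr C in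
  let s := trace_offset B in let w := mixed_trace B C in
  let D := o ^+ 2 - 4 * \det C in
  Poly [:: 4 * e * w ^+ 2 - T ^+ 2 * w ^+ 2 + 2 * s * w ^+ 2 + 2 * T * e ^+ 2 * s * w
          - s ^+ 2 * D - 2 * e ^+ 2 * s ^+ 2 * o;
      - 4 * T * e ^+ 2 * w + 2 * T ^+ 3 * e * w + 2 * T * e * s * w + 4 * w ^+ 2
          - 2 * T ^+ 2 * e ^+ 3 * s + 2 * e ^+ 3 * s ^+ 2 - 4 * e * s ^+ 2 * o
          - 4 * s * D - 8 * e ^+ 2 * s * o;
      - 4 * T * e * w + 2 * T ^+ 3 * w - T ^+ 4 * e ^+ 2
          - 6 * T ^+ 2 * e ^+ 2 * s + 3 * e ^+ 2 * s ^+ 2 - 2 * s ^+ 2 * o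
          + 8 * e ^+ 3 * s - 16 * e * s * o - 4 * D - 8 * e ^+ 2 * o;
      - 4 * T ^+ 2 * e ^+ 2 - 2 * T ^+ 4 * e - 6 * T ^+ 2 * e * s
          + 12 * e ^+ 2 * s - 8 * s * o + 8 * e ^+ 3 - 16 * e * o;
      - 8 * T ^+ 2 * e - T ^+ 4 - 2 * T ^+ 2 * s - s ^+ 2 + 12 * e ^+ 2 - 8 * o;
      - 4 * T ^+ 2 - 4 * s;
      - 4].

Lemma size_trace_poly : (size (trace_poly B C) <= 7)%N.
Proof. exact: size_Poly. Qed.

(** Multiply the equation by [B], take traces, reduce [X^2] and [B^3] by Cayley-Hamilton, double,
    and replace [2 * \det X] by its value in [det_solution]. *)
Lemma mixed_trace_solution :
  (2 * t + trace_offset B) * a = \tr B * t * (t + \det B) - mixed_trace B C.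
Proof.
rewrite /a /t /trace_offset /mixed_trace ((quad_lhs_eq0 _ _ _).1 X_sol).
by rewrite !trmx2E !detmx2E /quad_constant !(mulmx2E, mxE); ring.
Qed.

Lemma det_solution : 2 * \det X = t ^+ 2 + \tr B * a - \det B * t + \tr C.
Proof.
rewrite /a /t ((quad_lhs_eq0 _ _ _).1 X_sol).
by rewrite !trmx2E !detmx2E /quad_constant !(mulmx2E, mxE); ring.
Qed.

(** Here [X^2 = t X - \det X], and [B X B = a B - \det B (t - X)], where [t - X] is the adjugate of
    [X]. *)
Lemma solution_linear :
  (t + \det B) *: X = (\det X + t * \det B)%:M - a *: B - C.
Proof.
rewrite /a /t ((quad_lhs_eq0 _ _ _).1 X_sol).
by apply: mx2P; rewrite !trmx2E !detmx2E /quad_constant !(mulmx2E, mxE) /=; ring.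
Qed.

Lemma trace_equation : (t + \det B) ^+ 2 * \det X =
  (\det X + t * \det B) ^+ 2 - (\det X + t * \det B) * (a * \tr B + \tr C)
    + a ^+ 2 * \det B + a * (\tr B * \tr C - \tr (B *m C)) + \det C.
Proof.
have := congr1 determinant solution_linear; rewrite detZ => ->.
by rewrite !trmx2E !detmx2E !(mulmx2E, mxE) /=; ring.
Qed.

Lemma root_trace_poly : root (trace_poly B C) t.
Proof.
have Ea := mixed_trace_solution; have Ed := det_solution; have Et := trace_equation.
rewrite /root; apply/eqP; rewrite /trace_poly /= !horner_cons horner0.
move: Ea Ed Et; rewrite /mixed_trace /trace_offset.
move: t a (\det X) (\tr B) (\det B) (\tr C) (\tr (B *m C)) (\det C).
move=> z y d T e o b c Ea Ed Et.
pose s := 2 * z + (T ^+ 2 - 2 * e).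
pose u := T * z * (z + e) - (2 * b - T * o).
(* The coefficients regrouped by powers of [s] and [u]. As [u = s * y], the factor [s^2] comes out
   and the trace equation is left. *)
transitivity (u ^+ 2 * (4 * e - T ^+ 2) +
  u * s * (- 2 * (2 * b - T * o) - 2 * T * (z + e) ^+ 2) +
  s ^+ 2 * (z ^+ 2 * (z + e) ^+ 2 - o ^+ 2 + 4 * c
    - 2 * (z + e) ^+ 2 * (z ^+ 2 - e * z + o))); first by rewrite /u /s; ring.
rewrite -[u]Ea -/s; have -> : o = 2 * d - z ^+ 2 - T * y + e * z by rewrite Ed; ring.
transitivity (4 * s ^+ 2 * ((d + z * e) ^+ 2
  - (d + z * e) * (y * T + (2 * d - z ^+ 2 - T * y + e * z)) + y ^+ 2 * e
  + y * (T * (2 * d - z ^+ 2 - T * y + e * z) - b) + c - (z + e) ^+ 2 * d)); first by ring.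
have Do : 2 * d - z ^+ 2 - T * y + e * z = o by rewrite Ed; ring.
by rewrite Do -Et subrr mulr0.
Qed.

End TraceEquation.

Lemma map_trace_offset (R S : comNzRingType) (f : {rmorphism R -> S}) (B : 'M[R]_2) :
  f (trace_offset B) = trace_offset (map_mx f B).
Proof. by rewrite /trace_offset trace_map_mx det_map_mx; ring. Qed.

Lemma map_trace_poly (R S : comNzRingType) (f : {rmorphism R -> S}) (B C : 'M[R]_2) :
  map_poly f (trace_poly B C) = trace_poly (map_mx f B) (map_mx f C).
Proof.
rewrite /trace_poly map_Poly_id0 ?rmorph0 //; congr (Poly _).
rewrite /= /mixed_trace /trace_offset -map_mxM !trace_map_mx !det_map_mx.
by congr [:: _; _; _; _; _; _; _]; ring.
Qed.

Lemma trace_poly_neq0 (R : comNzRingType) (B C : 'M[R]_2) :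
  4%:R != 0 :> R -> trace_poly B C != 0.
Proof.
move=> n4; apply: contraNneq n4 => /polyP/(_ 6); rewrite coef_Poly coef0 /= => /eqP.
by rewrite oppr_eq0.
Qed.

Section SolutionOfTrace.

Variable F : fieldType.

Definition solution_of_trace (B C : 'M[F]_2) (t : F) : 'M[F]_2 :=
  let T := \tr B in let e := \det B in
  let a := (T * t * (t + e) - mixed_trace B C) / (2 * t + trace_offset B) in
  let d := (t ^+ 2 + T * a - e * t + \tr C) / 2 in
  (t + e)^-1 *: ((d + t * e)%:M - a *: B - C).

Lemma solution_of_traceE (B C X : 'M[F]_2) : quad_lhs B C X = 0 -> 2%:R != 0 :> F ->
  2 * \tr X + trace_offset B != 0 -> \tr X + \det B != 0 ->
  X = solution_of_trace B C (\tr X).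
Proof.
move=> X_sol n2 s_neq0 te_neq0; rewrite /solution_of_trace.
rewrite -(mixed_trace_solution X_sol) [_ * \tr (B *m X)]mulrC mulfK //.
rewrite -(det_solution X_sol) [2 * _]mulrC mulfK // -(solution_linear X_sol).
by rewrite scalerA mulVf // scale1r.
Qed.

End SolutionOfTrace.

Lemma map_solution_of_trace (F G : fieldType) (f : {rmorphism F -> G}) (B C : 'M[F]_2) t :
  map_mx f (solution_of_trace B C t) = solution_of_trace (map_mx f B) (map_mx f C) (f t).
Proof.
rewrite /solution_of_trace /mixed_trace /trace_offset -map_mxM !trace_map_mx !det_map_mx.
rewrite map_mxZ fmorphV rmorphD !map_mxB map_mxZ map_scalar_mx.
set a' := (X in _ = _ *: (_ - X *: _ - _)).
pose a := (\tr B * t * (t + \det B) - (2 * \tr (B *m C) - \tr B * \tr C)) /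
  (2 * t + (\tr B ^+ 2 - 2 * \det B)).
have fa : f a = a' by rewrite [LHS]fmorph_div; congr (_ / _); ring.
congr (_ *: (_%:M - _ *: _ - _)); last exact: fa.
transitivity ((f t ^+ 2 + f (\tr B) * f a - f (\det B) * f t + f (\tr C)) / f 2
  + f t * f (\det B)); last by rewrite fa rmorph_nat.
rewrite [LHS]rmorphD [X in X + _]fmorph_div [X in _ + X]rmorphM -/a.
by congr (_ / _ + _); move: (a) => y; ring.
Qed.

Section GenericTrace.

Variables (K : fieldType) (q : {rmorphism rat -> K}) (B C : 'M[K]_2).
Hypothesis BC_generic : generic_matrices q B C.
Variables (F : fieldType) (kappa : {rmorphism K -> F}) (X : 'M[F]_2).
Hypothesis X_sol : quad_lhs (map_mx kappa B) (map_mx kappa C) X = 0.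

Let P := {mpoly rat[2 * 2 + 2 * 2]}.

(** One rational pair suffices as a witness, since the pair formed by [B] and a solution is generic.
    The pair [(0, 1)] is used below, with values 2 and 4. *)
Lemma solution_generic_neq0 (p : P) (b x : 'M[rat]_2) : mmap idfun (pair_entries b x) p != 0 ->
  mmap (kappa \o q) (pair_entries (map_mx kappa B) X) p != 0.
Proof.
apply: contraNneq => /(solution_generic BC_generic X_sol) ->; by rewrite rmorph0.
Qed.

Lemma generic_trace_neq0 : \tr X + \det (map_mx kappa B) != 0.
Proof.
have E (G : comNzRingType) (qG : {rmorphism rat -> G}) (b x : 'M[G]_2) :
    mmap qG (pair_entries b x) (\tr (genX 2) + \det (genB 2)) = \tr x + \det b.
  by rewrite rmorphD /= -trace_map_mx -det_map_mx map_genX map_genB.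
rewrite -(E _ (kappa \o q)); apply: (@solution_generic_neq0 _ 0 1).
by rewrite E mxtrace1 det0.
Qed.

Lemma generic_trace_offset_neq0 : 2 * \tr X + trace_offset (map_mx kappa B) != 0.
Proof.
have E (G : comNzRingType) (qG : {rmorphism rat -> G}) (b x : 'M[G]_2) :
    mmap qG (pair_entries b x) (2 * \tr (genX 2) + trace_offset (genB 2))
      = 2 * \tr x + trace_offset b.
  rewrite rmorphD rmorphM rmorph_nat [X in _ + X]map_trace_offset -[X in _ * X]trace_map_mx.
  by rewrite map_genX map_genB.
rewrite -(E _ (kappa \o q)); apply: (@solution_generic_neq0 _ 0 1).
by rewrite E /trace_offset mxtrace1 det0 mxtrace0.
Qed.

End GenericTrace.

Lemma solution_of_generic_trace (K : fieldType) (q : {rmorphism rat -> K}) (B C : 'M[K]_2)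
    (F : fieldType) (kappa : {rmorphism K -> F}) (X : 'M[F]_2) :
  generic_matrices q B C -> quad_lhs (map_mx kappa B) (map_mx kappa C) X = 0 ->
  X = solution_of_trace (map_mx kappa B) (map_mx kappa C) (\tr X).
Proof.
move=> BC_generic X_sol; apply: solution_of_traceE => //.
- have charF : [pchar F] =i pred0.
    by move=> p; rewrite (fmorph_pchar (kappa \o q)) pchar_num.
  by rewrite (pcharf0P _).1.
- exact: (generic_trace_offset_neq0 BC_generic).
exact: (generic_trace_neq0 BC_generic).
Qed.

(** Among at least three points some [z] is fixed by the transposition of [x] and [y]; conjugation
    moving [z] to [ord0] brings the transposition into the stabilizer. *)
Lemma point_stabilizer_transitive (n : nat) (G : {group {perm 'I_n.+1}}) : (1 < n)%N ->
  (forall s : {perm 'I_n}, lift_perm ord0 ord0 s \in G) ->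
  (forall i, exists2 s, s \in G & s ord0 = i) -> G :=: [set: {perm 'I_n.+1}].
Proof.
move=> n_gt1 stabG transG; apply: tpermsT => x y.
have [->|ne_xy] := eqVneq x y; first by rewrite tperm1 group1.
have stabT (a b : 'I_n.+1) : a != ord0 -> b != ord0 -> tperm a b \in G.
  case: (unliftP ord0 a) => [a' ->|->] => [|/eqP//].
  case: (unliftP ord0 b) => [b' ->|->] _ => [_|/eqP//].
  have <- : lift_perm ord0 ord0 (tperm a' b') = tperm (lift ord0 a') (lift ord0 b').
    apply/permP => i; case: (unliftP ord0 i) => [i' ->|->].
      by rewrite lift_perm_lift inj_tperm //; apply: lift_inj.
    by rewrite lift_perm_id tpermD // eq_sym neq_lift.
  exact: stabG.
have [z zP] : exists z : 'I_n.+1, (z != x) && (z != y).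
  apply/existsP; apply: contraT; rewrite negb_exists => /forallP all_xy.
  have : (#|'I_n.+1| <= #|[set x; y]|)%N.
    by apply/subset_leq_card/subsetP => z _; have := all_xy z; rewrite !inE negb_and !negbK.
  by rewrite card_ord cards2 ne_xy leqNgt ltnS n_gt1.
have [s Gs s0] := transG z; case/andP: zP => zx zy.
have <- : ((tperm (s^-1 x) (s^-1 y)) ^ s = tperm x y)%g by rewrite tpermJ !permKV.
rewrite groupJ // stabT //; apply/eqP => s0'.
  by move/eqP: zx; rewrite -s0 -s0' permKV.
by move/eqP: zy; rewrite -s0 -s0' permKV.
Qed.

Lemma six_solutions (K : fieldType) (q : {rmorphism rat -> K}) (B C : 'M[K]_2)
    (L : closedFieldType) (iota : {rmorphism K -> L}) :
  generic_matrices q B C -> generated_by_entries q B C ->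
  exists Y : 'I_6 -> 'M[L]_2,
    [/\ injective Y, forall X, quad_solution iota B C X <-> X \in codom Y,
        injective (fun i => \tr (Y i))
      & forall (s : {perm 'I_5}) (f : {mpoly K[6 * (2 * 2)]}),
          mmap iota (family_entries Y) f = 0 ->
          mmap iota (family_entries (Y \o lift_perm ord0 ord0 s)) f = 0].
Proof.
move=> BC_generic K_generated.
have [N [r [r_inj r_root rP]]] := quintic_symmetric.
have charN : [pchar N] =i pred0.
  by move=> p; rewrite (fmorph_pchar (in_alg N)) pchar_num.
have charL : [pchar L] =i pred0 by move=> p; rewrite (fmorph_pchar (iota \o q)) pchar_num.
(* The rational root 0 takes the index [ord0], so that S_5 acts as the stabilizer of this index. *)
pose t (i : 'I_6) : N := if unlift ord0 i is Some l then r l else 0.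
have sr i : special_root (t i).
  rewrite /t /special_root; case: unlift => [l|]; last by rewrite mul0r.
  by rewrite (eqP (r_root l)) mulr0.
have t_inj : injective t.
  have r_neq0 l : r l != 0.
    apply: contraTneq (r_root l) => ->; rewrite /root horner_quintic !expr0n /=.
    by rewrite !mulr0 !(addr0, subr0, add0r) (pcharf0P _).1.
  move=> i l; rewrite /t.
  case: (unliftP ord0 i) => [i' ->|->]; case: (unliftP ord0 l) => [l' ->|->] //.
  - by move/r_inj->.
  - by move/eqP; rewrite (negPf (r_neq0 _)).
  by move/esym/eqP; rewrite (negPf (r_neq0 _)).
have [Y [solY injY relY]] := @specialization _ _ q B C L iota N (in_alg N)
  (special_B N) (special_C N) 6 (fun i => special_X (t i)) BC_generic K_generated
  (fun i => special_X_solution charN (sr i))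
  (fun i => special_X_nondegenerate charN (sr i)).
have {}injY : injective Y.
  apply: injY => i l /(congr1 mxtrace); rewrite !special_X_trace //; exact: t_inj.
have tr_inj X X' : quad_solution iota B C X -> quad_solution iota B C X' ->
    \tr X = \tr X' -> X = X'.
  move=> solX solX' trXX'; rewrite (solution_of_generic_trace BC_generic solX) trXX'.
  by rewrite -(solution_of_generic_trace BC_generic solX').
exists Y; split=> //.
- have [nu [sols [uniq_s _ solsP]]] := finite_solutions BC_generic iota.
  (* Distinct solutions have distinct traces, all roots of a nonzero polynomial of degree at most 6;
     the lifted solutions already reach this bound. *)
  have le_6 : (size sols <= 6)%N.
    have n4 : 4%:R != 0 :> L by rewrite (pcharf0P _).1.
    have := max_poly_roots (trace_poly_neq0 (map_mx iota B) (map_mx iota C) n4)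
      (rs := [seq \tr X | X <- sols]).
    rewrite size_map => lt_s; rewrite -ltnS.
    apply: leq_trans (lt_s _ _) (size_trace_poly _ _); first by apply/allP => _ /mapP[X /solsP solX ->]; apply: root_trace_poly.
    by rewrite map_inj_in_uniq // => X X' /solsP sX /solsP sX'; apply: tr_inj.
  have subY : {subset codom Y <= sols} by move=> _ /codomP[i ->]; apply/solsP.
  have uniqY : uniq (codom Y) by rewrite map_inj_uniq // enum_uniq.
  have le_sY : (size sols <= size (codom Y))%N by rewrite size_codom card_ord.
  have [_ eqY] := uniq_min_size uniqY subY le_sY.
  by move=> X; rewrite eqY; apply: solsP.
- by move=> i l /tr_inj/injY; apply.
move=> s f; have [tau tau_r] := rP s.
apply: (relY tau) => [||i]; rewrite ?map_special_B ?map_special_C //.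
rewrite map_special_X /t; case: (unliftP ord0 i) => [l ->|->].
  by rewrite lift_perm_lift liftK tau_r.
by rewrite lift_perm_id unlift_none rmorph0.
Qed.

(** * Elimination order *)

(* Compares first the monomials with x_v erased, then the exponents of x_v, so
   that each other unknown exceeds all the powers of x_v. *)
Section EliminationOrder.

Variables (m : nat) (v : 'I_m).

Definition erase (u : 'X_{1..m}) : 'X_{1..m} := [multinom if i == v then 0%N else u i | i < m].

Definition elimination_order : rel 'X_{1..m} := fun u w =>
  ((erase u < erase w)%O || ((erase u == erase w) && (u v <= w v)%N)).

Lemma eraseD u w : erase (u + w)%MM = (erase u + erase w)%MM.
Proof. by apply/mnmP => i; rewrite !mnmE; case: eqP. Qed.

Lemma erase_pow k : erase (U_(v) *+ k)%MM = 0%MM.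
Proof.
apply/mnmP => i; rewrite !mnmE; case: eqVneq => // ne_iv.
by rewrite mulmnE mnm1E eq_sym (negPf ne_iv) mul0n.
Qed.

Lemma erase_eq0 u : erase u = 0%MM -> u = (U_(v) *+ u v)%MM.
Proof.
move/mnmP => u0; apply/mnmP => i; have := u0 i; rewrite mulmnE mnm1E !mnmE.
by case: (eqVneq i v) => [->|_ ->]; rewrite ?mul1n ?mul0n.
Qed.

Lemma elimination_monomial_order : monomial_order elimination_order.
Proof.
split; rewrite /elimination_order.
- by move=> u w /=; case: ltgtP => //= _; apply: leq_total.
- move=> u w /= /andP[]; case: (ltgtP (erase u) (erase w)) => //= /mnmP e_uw.
  move=> uw wu; have uwv : u v = w v by apply/eqP; rewrite eqn_leq uw.
  apply/mnmP => i; have := e_uw i; rewrite !mnmE.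
  by case: (eqVneq i v) => [->|].
- move=> w u x /orP[lt_uw|/andP[/eqP-> uw]] /orP[lt_wx|/andP[/eqP<- wx]].
  + by rewrite (lt_trans lt_uw lt_wx).
  + by rewrite lt_uw.
  + by rewrite lt_wx.
  by rewrite eqxx (leq_trans uw wx) orbT.
- move=> u; rewrite (_ : erase 0%MM = 0%MM); last first.
    by apply/mnmP => i; rewrite !mnmE; case: eqP.
  by rewrite mnm0E leq0n andbT orbC -le_eqVlt le0m.
move=> u w x; rewrite !eraseD !mnmDE leq_add2r => /orP[lt_uw|/andP[/eqP-> uw]].
  by rewrite ltmc_add2l lt_uw.
by rewrite eqxx uw orbT.
Qed.

Lemma elimination_order_pow k u :
  elimination_order (U_(v) *+ k)%MM u = (erase u != 0%MM) || (k <= u v)%N.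
Proof.
rewrite /elimination_order erase_pow lt_neqAle le0m andbT mulmnE mnm1E eqxx mul1n.
by rewrite eq_sym; case: (erase u == _).
Qed.

End EliminationOrder.

Lemma leading_monomial_exists (K : fieldType) (m : nat) (le : rel 'X_{1..m})
    (f : {mpoly K[m]}) : monomial_order le -> f != 0 -> exists u, leading_monomial le f u.
Proof.
case=> le_total _ le_trans _ _; rewrite -msupp_eq0 /leading_monomial.
elim: (msupp f : seq _) => // u s IHs _; have [->|/IHs[w [sw w_max]]] := eqVneq s [::].
  by exists u; split=> [|x]; rewrite inE // => /eqP->; have := le_total u u; rewrite orbb.
have le_refl x : le x x by have := le_total x x; rewrite orbb.
case/orP: (le_total u w) => [le_uw | le_wu].
  exists w; split=> [|x]; first by rewrite inE sw orbT.
  by rewrite inE => /predU1P[->|/w_max].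
exists u; split=> [|x]; first by rewrite inE eqxx.
by rewrite inE => /predU1P[-> //|/w_max le_xw]; apply: le_trans le_wu.
Qed.

Section UnivariatePart.

Variables (K : fieldType) (m : nat) (v : 'I_m).

Lemma mcoeff_horner_alg (p : {poly K}) (u : 'X_{1..m}) :
  (horner_alg ('X_v : {mpoly K[m]}) p)@_u = p`_(u v) *+ (u == U_(v) *+ u v)%MM.
Proof.
rewrite -[p in LHS]coefK poly_def rmorph_sum raddf_sum /=.
have termE i : (horner_alg ('X_v : {mpoly K[m]}) (p`_i *: 'X^i))@_u
    = p`_i *+ (u == U_(v) *+ i)%MM.
  rewrite -mul_polyC rmorphM rmorphXn /= horner_algC horner_algX mulr_algl mcoeffZ mpolyXn mcoeffX eq_sym.
  by case: eqP => _; rewrite ?mulr1 ?mulr0.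
have lv k : (U_(v) *+ k)%MM v = k by rewrite mulmnE mnm1E eqxx mul1n.
case: eqP => [Du | not_pow]; last first.
  rewrite big1 // => i _; rewrite termE; case: eqP => // Du.
  by case: not_pow; rewrite {1}Du Du lv.
have [lt_up | le_pu] := ltnP (u v) (size p).
  rewrite (bigD1 (Ordinal lt_up)) //= termE -Du eqxx big1 ?addr0 // => i ne_i.
  rewrite termE; case: eqP => // ui; case/eqP: ne_i; apply: val_inj.
  by rewrite /= ui lv.
rewrite nth_default // big1 // => i _; rewrite termE; case: eqP => // ui.
by move: le_pu; rewrite ui lv leqNgt ltn_ord.
Qed.

Lemma mmap_horner_alg (F : comNzRingType) (kappa : {rmorphism K -> F}) (x : 'I_m -> F)
    (p : {poly K}) : mmap kappa x (horner_alg 'X_v p) = (map_poly kappa p).[x v].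
Proof.
rewrite -[p]coefK poly_def !rmorph_sum /= horner_sum; apply: eq_bigr => i _.
rewrite -{1}mul_polyC rmorphM rmorphXn /= horner_algC horner_algX mulr_algl mmapZ map_polyZ map_polyXn hornerZ hornerXn.
by rewrite rmorphXn /= mmapX mmap1U.
Qed.

End UnivariatePart.

(** If the leading monomial of [f] contains another unknown, that unknown leads one of the linear
    generators. Otherwise [f] is univariate and vanishes at [X a b], so its degree is at least that
    of [p]. *)
Lemma shape_effective (n : nat) (K F : fieldType) (kappa : {rmorphism K -> F})
    (E : 'M[{mpoly K[n * n]}]_n) (X : 'M[F]_n) (a b : 'I_n) (p : {poly K})
    (pp : 'I_n -> 'I_n -> {poly K}) :
  (forall f, ideal_of_entries E f <-> mmap kappa (fun v => mxvec X 0 v) f = 0) ->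
  p != 0 -> root (map_poly kappa p) (X a b) ->
  (forall g : {poly K}, g != 0 -> root (map_poly kappa g) (X a b) -> (size p <= size g)%N) ->
  (forall k l, (size (pp k l) < size p)%N /\ X k l = (map_poly kappa (pp k l)).[X a b]) ->
  has_effective_solution E.
Proof.
move=> idealP p_neq0 px0 p_min ppP; exists a, b, p, pp; split=> // [k l _|]; first by case: (ppP k l).
pose v := mxvec_index a b; exists (elimination_order v).
split; first exact: elimination_monomial_order.
pose ev : {rmorphism {mpoly K[n * n]} -> F} := mmap kappa (fun v => mxvec X 0 v).
have evX k l : ev (unknown K k l) = X k l by rewrite [LHS]mmapX mmap1U mxvecE.
have evP g : ev (horner_alg (unknown K a b) g) = (map_poly kappa g).[X a b].
  by rewrite [LHS]mmap_horner_alg mxvecE.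
split=> [g [->|[k [l [_ ->]]]] | f /idealP f0 f_neq0].
- by apply/idealP; rewrite [LHS]evP (eqP px0).
- by apply/idealP; rewrite -[LHS]/(ev _) rmorphB evP evX (ppP k l).2 subrr.
have [u [f_u u_max]] := leading_monomial_exists (elimination_monomial_order v) f_neq0.
have [e_u0|e_u_neq0] := eqVneq (erase v u) 0%MM; last first.
  have [w [wv uw]] : exists w, w != v /\ u w != 0%N.
    have /existsP[w] : [exists w, (w != v) && (u w != 0%N)].
      apply: contraR e_u_neq0; rewrite negb_exists => /forallP u0.
      apply/eqP/mnmP => i; rewrite !mnmE; case: eqVneq => // iv.
      by have := u0 i; rewrite iv negbK => /eqP.
    by case/andP; exists w.
  move: wv uw; case/mxvec_indexP: w => k l kl_v u_kl.
  have kl_ab : (k, l) != (a, b) by apply: contra_neq kl_v => -[-> ->].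
  exists (unknown K k l - horner_alg (unknown K a b) (pp k l)), U_(mxvec_index k l)%MM, u.
  split=> //; first by right; exists k, l.
    have e_kl : erase v U_(mxvec_index k l)%MM = U_(mxvec_index k l)%MM.
      apply/mnmP => i; rewrite mnmE mnm1E; case: (eqVneq i v) => // ->.
      by rewrite (negPf kl_v).
    have U_neq0 : U_(mxvec_index k l)%MM != 0%MM.
      by apply/eqP => /mnmP/(_ (mxvec_index k l)); rewrite mnm1E mnm0E eqxx.
    split.
      rewrite mcoeff_msupp mcoeffB mcoeffX eqxx mcoeff_horner_alg.
      rewrite mnm1E (negPf kl_v) mulm0n (negPf U_neq0) subr0; exact: oner_neq0.
    move=> x; rewrite mcoeff_msupp mcoeffB mcoeffX mcoeff_horner_alg.
    have [<-|_] := eqVneq U_(mxvec_index k l)%MM x.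
      by rewrite /elimination_order eqxx leqnn orbT.
    case: (x =P (U_(v) *+ x v)%MM) => [Dx _|_]; last by rewrite subrr eqxx.
    by rewrite Dx elimination_order_pow e_kl U_neq0.
  by apply/mnm_lepP => i; rewrite mnm1E; case: eqP => // <-; rewrite lt0n.
have f_pow x : x \in msupp f -> x = (U_(v) *+ x v)%MM.
  move/u_max; rewrite /elimination_order e_u0 => le_xu; apply: erase_eq0.
  by apply/eqP; case/orP: le_xu => [|/andP[]//]; rewrite ltNge le0m.
pose g : {poly K} := \sum_(x <- msupp f) f@_x *: 'X^(x v).
have g_u : g`_(u v) = f@_u.
  rewrite coef_sum (bigD1_seq u) ?msupp_uniq //= coefZ coefXn eqxx mulr1 big_seq_cond big1 ?addr0 // => x.
  case/andP=> fx ne_xu; rewrite coefZ coefXn (negPf (_ : u v != x v)) ?mulr0 //.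
  by apply: contra_neq ne_xu => uxv; rewrite (f_pow x fx) (f_pow u f_u) uxv.
have g_neq0 : g != 0.
  by apply/eqP => g0; move: g_u f_u; rewrite g0 coef0 mcoeff_msupp => <-; rewrite eqxx.
have gx0 : root (map_poly kappa g) (X a b).
  rewrite /root /g rmorph_sum horner_sum -[X in _ == X]f0 /mmap.
  have ev_pow d : mmap1 (fun v => mxvec X 0 v) (U_(v) *+ d) = X a b ^+ d.
    by rewrite -(mmapX _ kappa) -mpolyXn rmorphXn /= mmapX mmap1U mxvecE.
  apply/eqP/eq_big_seq => x fx; rewrite -mul_polyC rmorphM /= map_polyC map_polyXn.
  by rewrite hornerM hornerC hornerXn -ev_pow -(f_pow x fx).
exists (horner_alg (unknown K a b) p), (U_(v) *+ (size p).-1)%MM, u.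
have p_gt0 : (0 < size p)%N by rewrite lt0n size_poly_eq0.
have lv k : (U_(v) *+ k)%MM v = k by rewrite mulmnE mnm1E eqxx mul1n.
split=> //; first by left.
  split=> [|x]; first by rewrite mcoeff_msupp mcoeff_horner_alg lv eqxx lead_coef_eq0.
  rewrite mcoeff_msupp mcoeff_horner_alg; case: (x =P (U_(v) *+ x v)%MM) => [Dx p_x|_]; last by rewrite eqxx.
  rewrite Dx elimination_order_pow !lv; apply/orP; right.
  by rewrite -ltnS prednK // ltnNge; apply: contra p_x => /leq_sizeP/(_ _ (leqnn _))->.
apply/mnm_lepP => i; rewrite mulmnE mnm1E; case: eqP => [<-|_] //.
rewrite mul1n -ltnS prednK //; apply: leq_trans (p_min g g_neq0 gx0) _.
apply/leq_sizeP => d lt_ud; rewrite coef_sum big_seq big1 // => x fx.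
rewrite coefZ coefXn; case: eqP => [dx|_]; last by rewrite mulr0.
move: lt_ud; rewrite dx; have := u_max x fx.
by rewrite {1}(f_pow x fx) elimination_order_pow e_u0 eqxx /= ltnNge => ->.
Qed.

(** * Six solutions *)

(** Sums and products suffice because [N] is finite over [K]: the field generated by [rs] is the
    ring generated by it. *)
Lemma adjoined_ind (K : fieldType) (N : fieldExtType K) (rs : seq N) (P : N -> Prop) :
  (forall c : K, P c%:A) -> (forall x y, P x -> P y -> P (x + y)) ->
  (forall x y, P x -> P y -> P (x * y)) -> (forall x, x \in rs -> P x) ->
  forall x, x \in <<1 & rs>>%VS -> P x.
Proof.
move=> PC PD PM; elim/last_ind: rs => [|rs z IHrs] Prs x.
  by rewrite adjoin_nil subfield_closed => /vlineP[c ->].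
rewrite adjoin_rcons => /Fadjoin_polyP[p /polyOverP p_rs ->].
have Pz : P z by apply: Prs; rewrite mem_rcons mem_head.
have IH y : y \in <<1 & rs>>%VS -> P y.
  by apply: IHrs => t t_rs; apply: Prs; rewrite mem_rcons in_cons t_rs orbT.
rewrite horner_coef; apply: (big_ind P) => [|//|i _]; first by rewrite -(scale0r 1); apply: PC.
apply: (PM); first exact: IH.
elim: (i : nat) => [|d IHd]; last by rewrite exprS; apply: (PM).
by rewrite expr0 -(scale1r 1); apply: PC.
Qed.

Lemma fixed_simple_adjoin (K : fieldType) (N : splittingFieldType K) (x y : N) :
  [pchar K] =i pred0 ->
  (forall g, g \in 'Gal({:N} / 1%AS)%g -> g x = x -> g y = y) -> y \in <<1; x>>%VS.
Proof.
move=> charK fixP.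
have charN : [pchar N] =i pred0 by move=> p; rewrite (fmorph_pchar (in_alg N)).
have gal_x : galois <<1; x>>%AS {:N}%AS.
  rewrite /galois subvf normalFieldf andbT; apply/separableP => z _.
  exact: pcharf0_separable.
rewrite -(galois_fixedField gal_x); apply/fixedFieldP; first exact: memvf.
move=> g Gg; apply: fixP.
  by move: Gg; apply/subsetP/galS; apply: sub1v.
by apply: (fixed_gal _ Gg); rewrite ?subvf // memv_adjoin.
Qed.

Section SixSolutions.

Variables (K : fieldType) (q : {rmorphism rat -> K}) (B C : 'M[K]_2).
Hypothesis BC_generic : generic_matrices q B C.
Hypothesis K_generated : generated_by_entries q B C.
Variables (L : closedFieldType) (iota : {rmorphism K -> L}).

Let charK : [pchar K] =i pred0.
Proof. by move=> p; rewrite (fmorph_pchar q) pchar_num. Qed.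

Variable Y : 'I_6 -> 'M[L]_2.
Hypothesis Y_inj : injective Y.
Hypothesis solY : forall X, quad_solution iota B C X <-> X \in codom Y.
Hypothesis trY_inj : injective (fun i => \tr (Y i)).
Hypothesis relY : forall (s : {perm 'I_5}) (f : {mpoly K[6 * (2 * 2)]}),
  mmap iota (family_entries Y) f = 0 ->
  mmap iota (family_entries (Y \o lift_perm ord0 ord0 s)) f = 0.

Variables (N : splittingFieldType K) (j : {rmorphism N -> L}).
Hypothesis jK : forall a : K, j a%:A = iota a.
Hypothesis split_N : splittingFieldFor 1%VS (map_poly (in_alg N) (trace_poly B C)) {:N}%VS.
Hypothesis root_preimage : forall z, root (map_poly iota (trace_poly B C)) z ->
  exists y, j y = z.

Let BN := map_mx (in_alg N) B.
Let CN := map_mx (in_alg N) C.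

Let j_solution X : quad_lhs BN CN X = 0 <-> quad_solution iota B C (map_mx j X).
Proof.
have jM (M : 'M[K]_2) : map_mx j (map_mx (in_alg N) M) = map_mx iota M.
  by apply: map_mx_comp_eq.
rewrite /quad_solution -(jM B) -(jM C) -map_quad_lhs; split=> [->|/eqP].
  by rewrite map_mx0.
by rewrite map_mx_eq0 => /eqP.
Qed.

Let solutions_in_N : exists V : 'I_6 -> 'M[N]_2, forall i, map_mx j (V i) = Y i.
Proof.
have pre_tr i : exists t, j t = \tr (Y i).
  apply: root_preimage; rewrite map_trace_poly; apply: root_trace_poly.
  by apply/solY; apply: codom_f.
have [t jt] := fin_all_exists pre_tr.
exists (fun i => solution_of_trace BN CN (t i)) => i.
rewrite map_solution_of_trace jt !(map_mx_comp_eq (h := iota)) //.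
by apply/esym/(solution_of_generic_trace BC_generic)/solY/codom_f.
Qed.

Section Solutions.

Variable V : 'I_6 -> 'M[N]_2.
Hypothesis jV : forall i, map_mx j (V i) = Y i.

Let V_inj : injective V.
Proof. by move=> i l Vil; apply: Y_inj; rewrite -!jV Vil. Qed.

Let solV X : quad_lhs BN CN X = 0 <-> exists i, X = V i.
Proof.
split=> [/j_solution/solY/codomP[i] | [i ->]]; last first.
  by apply/j_solution; rewrite jV; apply/solY/codom_f.
by rewrite -jV => /map_mx_inj->; exists i.
Qed.

Let G := ('Gal({:N} / 1%AS))%G.

Let gal_solution (g : gal_of {:N}) i : exists l, map_mx g (V i) = V l.
Proof.
have gM (M : 'M[K]_2) : map_mx g (map_mx (in_alg N) M) = map_mx (in_alg N) M.
  by apply: map_mx_comp_eq => c; rewrite rmorph_alg.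
have gV : quad_lhs BN CN (map_mx g (V i)) = 0.
  rewrite /BN /CN -(gM B) -(gM C) -map_quad_lhs (solV (V i)).2; last by exists i.
  by rewrite map_mx0.
by have [l] := (solV _).1 gV; exists l.
Qed.

(** The default [i] is never reached, as [imageE] shows. *)
Let image (g : gal_of {:N}) (i : 'I_6) : 'I_6 :=
  odflt i [pick l | V l == map_mx g (V i)].

Let imageE g i : V (image g i) = map_mx g (V i).
Proof.
rewrite /image; case: pickP => [l /eqP // | no_l].
by have [l gV] := gal_solution g i; have := no_l l; rewrite gV eqxx.
Qed.

Let image_inj g : injective (image g).
Proof.
move=> i l gil; apply: V_inj; apply: (map_mx_inj (f := g)).
by rewrite -!imageE gil.
Qed.

Let action (g : gal_of {:N}) : {perm 'I_6} := perm (@image_inj g).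

Let actionE g i : V (action g i) = map_mx g (V i).
Proof. by rewrite permE imageE. Qed.

Let actionM : {in G &, {morph action : g h / (g * h)%g}}.
Proof.
move=> g h _ _; apply/permP => i; apply: V_inj; rewrite permM !actionE.
by apply/matrixP => a b; rewrite !mxE galM ?memvf.
Qed.

Let actionP g s : action g = s <-> forall i, map_mx g (V i) = V (s i).
Proof.
split=> [<- i | gV]; first by rewrite actionE.
by apply/permP => i; apply: V_inj; rewrite actionE gV.
Qed.

Let act_morphism : {morphism G >-> {perm 'I_6}} := Morphism actionM.

Let trV_inj : injective (fun i => \tr (V i)).
Proof. by move=> i l /(congr1 j); rewrite -!trace_map_mx !jV; apply: trY_inj. Qed.

Let root_trace z : root (map_poly (in_alg N) (trace_poly B C)) z -> exists i, z = \tr (V i).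
Proof.
move=> pz; apply: boolp.contrapT => no_i.
have n4 : 4%:R != 0 :> N.
  by rewrite (pcharf0P _).1 // => p; rewrite (fmorph_pchar (in_alg N)) charK.
have P_neq0 := trace_poly_neq0 BN CN n4.
have lt_size : (size (z :: codom (fun i => \tr (V i))) < size (trace_poly BN CN))%N.
  apply: max_poly_roots => //=.
    rewrite -map_trace_poly pz map_trace_poly; apply/allP => _ /codomP[i ->].
    by apply: root_trace_poly; apply/solV; exists i.
  rewrite map_inj_uniq // enum_uniq andbT; apply/codomP => -[i zi].
  by apply: no_i; exists i.
by have := leq_trans lt_size (size_trace_poly BN CN); rewrite /= size_codom card_ord.
Qed.

(** The roots that generate [N] are the traces of the six solutions. *)
Let act_inj : ('injm act_morphism)%g.
Proof.
apply/subsetP => g /morphpreP[Gg /set1gP g1]; rewrite inE.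
have gV i : map_mx g (V i) = V i by rewrite -actionE [action g]g1 perm1.
have [rs Drs genN] := split_N.
apply/gal_eqP => x _; rewrite gal_id.
have : x \in <<1 & rs>>%VS by rewrite genN memvf.
apply: (adjoined_ind (P := fun x => g x = x)) => [c|y z gy gz|y z gy gz|y y_rs].
- by rewrite rmorph_alg.
- by rewrite rmorphD /= gy gz.
- by rewrite rmorphM /= gy gz.
have [|i ->] := @root_trace y; first by rewrite (eqp_root Drs) root_prod_XsubC.
by rewrite -trace_map_mx gV.
Qed.

(** The stabilizer of [ord0] comes from specialization through [relY], and transitivity from the
    maximality of the ideal: any two solutions satisfy the same relations. *)
Let act_image : (act_morphism @* G)%g = [set: {perm 'I_6}].
Proof.
apply: (@point_stabilizer_transitive 5 [group of (act_morphism @* G)%g]) => // [s | l].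
  have [f|g Gg gV] := @gal_conjugate_family K N _ (family_entries V)
      (family_entries (V \o lift_perm ord0 ord0 s)) charK.
    have jf W : j (mmap (in_alg N) (family_entries W) f) =
        mmap iota (family_entries (fun i => map_mx j (W i))) f.
      rewrite rmorph_mmap; apply: eq_mmap => [c|v] /=; first exact: jK.
      exact: map_family_entries.
    have eqY W W' : W =1 W' -> mmap iota (family_entries W) f = mmap iota (family_entries W') f.
      by move=> WW'; apply: eq_mmap => //; apply: eq_family_entries.
    move=> /(congr1 j); rewrite rmorph0 jf (eqY _ Y) // => /(relY s) f0.
    apply: (fmorph_inj j); rewrite rmorph0 jf (eqY _ (Y \o lift_perm ord0 ord0 s)) // => i.
    by rewrite /= jV.
  apply/morphimP; exists g => //; apply/esym/actionP => i.
  rewrite -[RHS](family_entriesK (V \o lift_perm ord0 ord0 s)) -{1}(family_entriesK V).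
  rewrite map_family_of_entries; apply/matrixP => b c; rewrite !mxE /=.
  exact: gV.
have solVi i : quad_lhs BN CN (V i) = 0 by apply/solV; exists i.
have [f f0|g Gg gV] := @gal_conjugate_family K N _ (fun v => mxvec (V ord0) 0 v)
    (fun v => mxvec (V l) 0 v) charK.
  apply: (quad_ideal_vanishes (solVi l)).
  exact: (vanishing_ideal_of_entries BC_generic K_generated (solVi ord0)).
exists (action g); first by apply/morphimP; exists g.
apply: V_inj; rewrite actionE; apply/matrixP => a b.
by rewrite mxE -[V ord0 a b]mxvecE gV mxvecE.
Qed.

Let action_onto s : exists2 g, g \in G & action g = s.
Proof.
have : s \in (act_morphism @* G)%g by rewrite act_image inE.
by case/morphimP => g Gg _ ->; exists g.
Qed.

Let gal_isog : (G \isog [set: {perm 'I_6}])%g.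
Proof. by apply: (isom_isog act_morphism) => //; apply/isomP; split. Qed.

Let image_j x : adjoin iota (is_solution_entry (quad_solution iota B C)) x <->
  exists y, j y = x.
Proof.
split=> [|[y <-]].
  elim=> [c|z [X [/solY/codomP[i ->] [a [b ->]]]]|_ _ _ [y <-] _ [z <-]|_ _ _ [y <-] _ [z <-]].
  - by exists c%:A.
  - by exists (V i a b); rewrite -jV mxE.
  - by exists (y - z); rewrite rmorphB.
  by exists (y / z); rewrite fmorph_div.
have [rs Drs genN] := split_N.
have : y \in <<1 & rs>>%VS by rewrite genN memvf.
pose A := adjoin iota (is_solution_entry (quad_solution iota B C)).
have A0 : A 0 by rewrite -(rmorph0 iota); apply: adjoin_base.
have A1 : A 1 by rewrite -(rmorph1 iota); apply: adjoin_base.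
have AD u w : A u -> A w -> A (u + w).
  by move=> Au Aw; rewrite -[w]opprK -[- w]sub0r; do 2?apply: adjoin_sub.
apply: (adjoined_ind (P := fun y => A (j y))) => [c|u w Au Aw|u w Au Aw|u u_rs].
- by rewrite jK; apply: adjoin_base.
- by rewrite rmorphD; apply: AD.
- by rewrite rmorphM -[j w]invrK -[(j w)^-1]mul1r; do 2?apply: adjoin_div.
have [|i ->] := @root_trace u; first by rewrite (eqp_root Drs) root_prod_XsubC.
rewrite -trace_map_mx jV trmx2E; have solYi : quad_solution iota B C (Y i).
  by apply/solY/codom_f.
by apply: AD; apply: adjoin_gen; exists (Y i); split=> //; [exists 0, 0 | exists 1, 1].
Qed.

Let effective : has_effective_solution (quad_system B C).
Proof.
have [a [b ab]] : exists a b, V 0 a b != V 1 a b.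
  apply: boolp.contrapT => no_ab; suff /V_inj : V 0 = V 1 by [].
  apply/matrixP => a b; apply/eqP/contraT => ab.
  by case: no_ab; exists a, b.
have coord_inj i l : V i a b = V l a b -> i = l.
  move=> Vil; apply/eqP; apply: contraT => ne_il.
  (* [s] sends [i] to 0 and [l] to 1, so a coincidence between [V i] and [V l] at this entry would
     be carried to [V 0] and [V 1], which differ there. *)
  pose s := (tperm i 0%R * tperm (tperm i 0%R l) 1%R)%g.
  have s_i : s i = 0.
    rewrite permM tpermL; apply: tpermD => //.
    by rewrite -[X in _ != X](tpermL i 0) (inj_eq perm_inj) eq_sym.
  have s_l : s l = 1 by rewrite permM tpermL.
  have [g _ /actionP gV] := action_onto s; case/eqP: ab.
  by rewrite -s_i -s_l -!gV !mxE Vil.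
have sol0 : quad_lhs BN CN (V 0) = 0 by apply/solV; exists 0.
(* By [coord_inj], an automorphism fixing this single entry fixes the index 0, hence every entry of
   [V 0]. *)
have gen_x c d : V 0 c d \in <<1; V 0%R a b>>%VS.
  apply: fixed_simple_adjoin charK _ => g Gg gx.
  have g0 : action g 0 = 0.
    by apply: coord_inj; rewrite actionE mxE.
  have /matrixP/(_ c d) := actionE g 0; by rewrite g0 mxE.
have /polyOver1P[p Dp] := minPolyOver 1%AS (V 0 a b).
(* [Fadjoin_poly] has degree below that of the minimal polynomial, which is the bound asked of an
   effective solution. *)
have pp_ex (cd : 'I_2 * 'I_2) : exists r : {poly K}, map_poly (in_alg N) r =
    Fadjoin_poly 1%AS (V 0 a b) (V 0 cd.1 cd.2).
  by have /polyOver1P[r Dr] := Fadjoin_polyOver 1%AS (V 0 a b) (V 0 cd.1 cd.2); exists r.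
have [pp ppE] := fin_all_exists pp_ex.
have size_p : size p = (adjoin_degree 1%AS (V 0 a b)).+1.
  by rewrite -size_minPoly Dp size_map_poly.
apply: (@shape_effective _ _ _ (in_alg N) _ (V 0) a b p (fun c d => pp (c, d))).
- move=> f; split; first exact: quad_ideal_vanishes.
  exact: (vanishing_ideal_of_entries BC_generic K_generated).
- by rewrite -size_poly_eq0 size_p.
- by rewrite -Dp root_minPoly.
- move=> f f_neq0 fx0; rewrite -(size_map_poly (in_alg N) p) -(size_map_poly (in_alg N) f).
  rewrite dvdp_leq ?map_poly_eq0 // -Dp; apply: minPoly_dvdp => //.
  by apply/polyOver1P; exists f.
move=> c d; rewrite -(size_map_poly (in_alg N)) ppE size_p ltnS size_Fadjoin_poly.
by rewrite /= Fadjoin_poly_eq.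
Qed.

Lemma effective_and_symmetric_of_solutions : has_effective_solution (quad_system B C) /\
  solvability_complexity iota (quad_solution iota B C) 6 [set: {perm 'I_6}]%G.
Proof.
split; first exact: effective.
split; last by exists (trace_poly B C), N, j; split.
exists (codom Y); split=> //; last by rewrite size_codom card_ord.
by rewrite map_inj_uniq // enum_uniq.
Qed.

End Solutions.

Lemma effective_and_symmetric_of_splitting_field :
  has_effective_solution (quad_system B C) /\
  solvability_complexity iota (quad_solution iota B C) 6 [set: {perm 'I_6}]%G.
Proof. by have [V jV] := solutions_in_N; apply: effective_and_symmetric_of_solutions jV. Qed.

End SixSolutions.

Lemma quadratic2_effective_and_symmetric (K : fieldType) (q : {rmorphism rat -> K})
    (B C : 'M[K]_2) (L : closedFieldType) (iota : {rmorphism K -> L}) :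
  generic_matrices q B C -> generated_by_entries q B C ->
  has_effective_solution (quad_system B C) /\
  solvability_complexity iota (quad_solution iota B C) 6 [set: {perm 'I_6}]%G.
Proof.
move=> BC_generic K_generated.
have charK : [pchar K] =i pred0 by move=> p; rewrite (fmorph_pchar q) pchar_num.
have [Y [Y_inj solY trY_inj relY]] := six_solutions iota BC_generic K_generated.
have n4 : 4%:R != 0 :> K by rewrite (pcharf0P _).1.
have [N [j [jK split_N pre]]] := splitting_field_in_closed iota charK (trace_poly_neq0 B C n4).
exact: (effective_and_symmetric_of_splitting_field BC_generic K_generated Y_inj solY
  trY_inj relY jK split_N pre).
Qed.

Theorem proposition4 (n : nat) (n_ge2 : (2 <= n)%N)
    (K : fieldType) (q : {rmorphism rat -> K}) (B C : 'M[K]_n)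
    (BC_generic : generic_matrices q B C)
    (K_generated : generated_by_entries q B C)
    (L : closedFieldType) (iota : {rmorphism K -> L})
    (L_closure : is_algebraic_closure iota) :
  (n = 2%N ->
     has_effective_solution (quad_system B C) /\
     solvability_complexity iota (quad_solution iota B C) 6
       [set: {perm 'I_6}]%G) /\
  ((2 < n)%N ->
     finitely_many_solutions (quad_solution iota B C) /\
     non_solvable_equation iota (quad_solution iota B C)).
Proof.
split=> [n2 | n_gt2].
  subst n; exact: (quadratic2_effective_and_symmetric iota BC_generic K_generated).
case: n n_ge2 n_gt2 B C BC_generic K_generated => [|[|m]] // _ _ B C BC_generic K_generated.
exact: (@large_quadratic_not_solvable m _ _ _ _ _ iota BC_generic K_generated L_closure).
Qed.
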